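(* Let $X(\mathbb{R})$ be a reflexive Banach function space such that the Hardy-Littlewood maximal operator $M$ is bounded on $X(\mathbb{R})$ and on its associate space $X'(\mathbb{R})$. Suppose that $\psi$ is an orthonormal $C^1$-wavelet with compact support. Then $\{\psi_{j,k}: j,k\in\mathbb{Z}\}$ is an unconditional basis of $X(\mathbb{R})$, and for every $f\in X(\mathbb{R})$ \[ f=\sum_{j\in\mathbb{Z}}\sum_{k\in\mathbb{Z}}\langle f,\psi_{j,k}\rangle\psi_{j,k}, \] with unconditional convergence in $X(\mathbb{R})$.
   Context: A Banach function norm is a map $\rho$ from nonnegative measurable functions on $\mathbb{R}$ to $[0,\infty]$ that is a norm-like functional ($\rho(f)=0\iff f=0$ a.e., positive homogeneous, subadditive), has the lattice property, the Fatou property ($0\le f_n\uparrow f$ a.e. implies $\rho(f_n)\uparrow\rho(f)$), satisfies $\rho(\chi_E)<\infty$ and $\int_E f\,dx\le C_E\rho(f)$ for every measurable $E$ with $|E|<\infty$. $X(\mathbb{R})$ is the set of measurable $f$ with $\|f\|_{X(\mathbb{R})}:=\rho(|f|)<\infty$; the associate space $X'(\mathbb{R})$ is given by $\rho'(g)=\sup\{\int fg: f\ge0,\ \rho(f)\le1\}$. $M$ is the Hardy-Littlewood maximal operator $(Mf)(x)=\sup_{Q\ni x}\frac1{|Q|}\int_Q|f|$ over bounded intervals $Q\ni x$. A function $\psi\in L^2(\mathbb{R})$ is an orthonormal wavelet if $\psi_{j,k}(x)=2^{j/2}\psi(2^jx-k)$, $j,k\in\mathbb{Z}$, form an orthonormal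 basis of $L^2(\mathbb{R})$. $\langle f,g\rangle=\int_\mathbb{R} f\overline g\,dx$. *)

(* Defs.v *)
From HB Require Import structures.
From mathcomp Require Import all_boot all_order all_algebra.
From mathcomp Require Import all_classical all_reals all_analysis.
From mathcomp Require Import measurable_realfun.
From mathcomp Require Import complex.
Set Implicit Arguments. Unset Strict Implicit. Unset Printing Implicit Defensive.
Import Order.TTheory GRing.Theory Num.Theory.
Import numFieldNormedType.Exports.
Local Open Scope classical_set_scope.
Local Open Scope ring_scope.

Section Defs.
Variable R : realType.
Local Notation C := (R[i]).
Local Notation Leb := (@lebesgue_measure R).

Definition nnmf (f : R -> \bar R) : Prop :=
  measurable_fun [set: R] f /\ forall x, (0 <= f x)%E.

(* Banach function norm, following Luxemburg / Bennett-Sharpley *)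
Record banach_function_norm (rho : (R -> \bar R) -> \bar R) : Prop := {
  bfn_ge0 : forall f, nnmf f -> (0 <= rho f)%E ;
  bfn_eq0 : forall f, nnmf f ->
      (rho f = 0%E <-> {ae Leb, forall x, f x = 0%E}) ;
  bfn_homog : forall f (a : R), nnmf f -> 0 <= a ->
      rho (fun x => (a%:E * f x)%E) = (a%:E * rho f)%E ;
  bfn_subadd : forall f g, nnmf f -> nnmf g ->
      (rho (fun x => f x + g x) <= rho f + rho g)%E ;
  bfn_lattice : forall f g, nnmf f -> nnmf g ->
      {ae Leb, forall x, (g x <= f x)%E} -> (rho g <= rho f)%E ;
  bfn_fatou : forall (fn : nat -> R -> \bar R) f,
      (forall n, nnmf (fn n)) -> nnmf f ->
      {ae Leb, forall x, {homo (fun n => fn n x) : m n / (m <= n)%N >-> (m <= n)%E}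
                          /\ (fun n => fn n x) @ \oo --> f x} ->
      {homo (fun n => rho (fn n)) : m n / (m <= n)%N >-> (m <= n)%E}
      /\ (fun n => rho (fn n)) @ \oo --> rho f ;
  bfn_indic : forall E, measurable E -> (Leb E < +oo)%E ->
      (rho (fun x => (\1_E x)%:E) < +oo)%E ;
  bfn_loc : forall E, measurable E -> (Leb E < +oo)%E ->
      exists CE : R, forall f, nnmf f ->
        (\int[Leb]_(x in E) f x <= CE%:E * rho f)%E
}.

Definition cmeasurable (f : R -> C) : Prop :=
  measurable_fun [set: R] (fun x => complex.Re (f x)) /\ measurable_fun [set: R] (fun x => complex.Im (f x)).

Definition cabs (f : R -> C) : R -> \bar R := fun x => (Normc.normc (f x))%:E.

Definition inX (rho : (R -> \bar R) -> \bar R) (f : R -> C) : Prop :=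
  cmeasurable f /\ (rho (cabs f) < +oo)%E.

Definition assoc_norm (rho : (R -> \bar R) -> \bar R) (g : R -> \bar R) : \bar R :=
  ereal_sup [set (\int[Leb]_x (f x * g x))%E | f in [set f | nnmf f /\ (rho f <= 1)%E]].

Definition maximal_fun (g : R -> \bar R) (x : R) : \bar R :=
  ereal_sup [set v | exists a b : R, [/\ a < b, a <= x <= b &
     v = (((b - a)^-1)%:E * \int[Leb]_(y in `[a, b]) g y)%E]].

Definition maximal_bounded (rho : (R -> \bar R) -> \bar R) : Prop :=
  exists K : R, forall f, inX rho f ->
    (rho (maximal_fun (cabs f)) <= K%:E * rho (cabs f))%E.

Definition functional_bound (rho : (R -> \bar R) -> \bar R)
  (l : (R -> C) -> C) (c : R) : Prop :=
  forall f, inX rho f -> ((Normc.normc (l f))%:E <= c%:E * rho (cabs f))%E.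

Definition in_dual (rho : (R -> \bar R) -> \bar R) (l : (R -> C) -> C) : Prop :=
  (forall f g (a b : C), inX rho f -> inX rho g ->
     l (fun x => a * f x + b * g x) = a * l f + b * l g)
  /\ exists c : R, functional_bound rho l c.

Definition in_bidual (rho : (R -> \bar R) -> \bar R)
  (Phi : ((R -> C) -> C) -> C) : Prop :=
  (forall l1 l2 (a b : C), in_dual rho l1 -> in_dual rho l2 ->
     Phi (fun f => a * l1 f + b * l2 f) = a * Phi l1 + b * Phi l2)
  /\ exists K : R, forall l c, in_dual rho l -> functional_bound rho l c ->
       Normc.normc (Phi l) <= K * c.

Definition reflexive_space (rho : (R -> \bar R) -> \bar R) : Prop :=
  forall Phi, in_bidual rho Phi ->
    exists f, inX rho f /\ forall l, in_dual rho l -> Phi l = l f.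

Definition inner (f g : R -> C) : C :=
  Complex (Rintegral Leb setT (fun x => complex.Re (f x * Num.conj (g x))))
          (Rintegral Leb setT (fun x => complex.Im (f x * Num.conj (g x)))).

Definition inL2 (f : R -> C) : Prop :=
  cmeasurable f /\ (\int[Leb]_x ((Normc.normc (f x)) ^+ 2)%:E < +oo)%E.

Definition wav (psi : R -> C) (j k : int) : R -> C :=
  fun x => real_complex R ((Num.sqrt (2 : R)) ^ j) * psi ((2 : R) ^ j * x - k%:~R).

Definition orthonormal_wavelet (psi : R -> C) : Prop :=
  inL2 psi
  /\ (forall j k j' k', inner (wav psi j k) (wav psi j' k') =
                        if (j == j') && (k == k') then 1 else 0)
  /\ (forall f, inL2 f -> (forall j k, inner f (wav psi j k) = 0) ->
        {ae Leb, forall x, f x = 0}).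

Definition C1_fun (h : R -> R) : Prop :=
  (forall x, derivable h x 1) /\ continuous (derive1 h).
Definition C1 (psi : R -> C) : Prop :=
  C1_fun (fun x => complex.Re (psi x)) /\ C1_fun (fun x => complex.Im (psi x)).

Definition compact_support (psi : R -> C) : Prop :=
  compact (closure [set x | psi x != 0]).

Definition uncond_sum (rho : (R -> \bar R) -> \bar R)
  (c : int * int -> C) (e : int * int -> R -> C) (f : R -> C) : Prop :=
  forall sigma : nat -> int * int, bijective sigma ->
    (fun n => rho (cabs (fun x => f x - \sum_(i < n) c (sigma i) * e (sigma i) x)))
      @ \oo --> 0%E.

Definition uncond_basis (rho : (R -> \bar R) -> \bar R) (e : int * int -> R -> C) : Prop :=
  (forall i, inX rho (e i))
  /\ forall f, inX rho f ->
       exists c, uncond_sum rho c e f /\ forall c', uncond_sum rho c' e f -> c' = c.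

End Defs.

(* Main.v *)
(* The proof replaces Calderon-Zygmund theory by weights and a Bellman function.

   For a pair of weights [s], [w] with [s * w = 1] and bounded A_2 constant, a Bellman
   function that is concave under bisection of intervals controls, along a dyadic tree,
   the sum of the squares of the pairings of [f] with Lipschitz bumps of mean zero by
   [int f^2 w]. Two dyadic grids shifted by a third capture the supports of all the
   wavelets, so [sum_i |<f, psi_i>| |<g, psi_i>| <= K (int |f|^2 w + int |g|^2 s)].

   Since M is bounded on X and X', the Rubio de Francia iteration majorizes [f] in X and
   [g] in X' by A_1 weights F and G of comparable norms; with [w = G / F] the estimate
   becomes [sum_i |<f, psi_i>| |<g, psi_i>| <= K rho(f) rho'(g)]. As rho of a compactly
   supported Lipschitz function is, up to a constant, a supremum of pairings with X', the
   operators [f |-> sum_(i in s) th_i <f, psi_i> psi_i] with [|th_i| <= 1] are bounded on X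
   uniformly in the finite set [s].

   A function of X all of whose coefficients vanish is zero: truncate it, apply Parseval's
   inequality in L^2 to the truncations, and control the error by the weighted estimate.
   By reflexivity the partial sums of [f] have a weak limit, which has the coefficients of
   [f] and hence is [f]; so the wavelets span a dense subspace (Hahn-Banach), and the
   uniform bounds turn density into unconditional convergence. *)
Require Import Defs.
From HB Require Import structures.
From mathcomp Require Import all_boot all_order all_algebra.
From mathcomp Require Import all_classical all_reals all_analysis.
From mathcomp Require Import measurable_realfun.
From mathcomp Require Import complex.
From mathcomp Require Import ring lra zify.
Set Implicit Arguments. Unset Strict Implicit. Unset Printing Implicit Defensive.
Import Order.TTheory GRing.Theory Num.Theory.
Import numFieldNormedType.Exports.
Local Open Scope classical_set_scope.
Local Open Scope ring_scope.

(** * Bellman function *)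

(** The weights are manufactured from the pair (f, g) under test. If F, G majorize |f|, |g| and w =
    G / F, s = F / G, then |f|^2 w and |g|^2 s are both at most F G, whose integral is bounded by
    rho(F) rho'(G). On every interval the means of w and s have product at least 1, so a product c
    c' of coefficients is at most (c^2 <w> + c'^2 <s>) / 2: the bilinear sum falls apart into two
    quadratic sums, and the weights enter the constant only through their A_2 constant, that is
    through the bounds for M.

    A bump of mean zero sees only the fluctuation of f. When an interval is bisected, the centred
    integral of f against the bump is the sum of those over the halves plus (jump of f) *
    (oscillation of the bump). The regularity of the bump gains a factor 4 per generation; part of
    this gain is spent on a geometric damping, so that summing over all nodes counts every jump a
    bounded number of times. The sum of squared jumps is what the Bellman function controls.

    The vanishing mean of psi is itself a consequence of orthogonality between distant scales. *)

Section Bellman.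
Variable R : realFieldType.
Implicit Types (x y f l Q a b : R).

(** By the arithmetic-geometric mean inequality the right side is at least twice the inverse square
    root of [P * S = (1 - a^2) (1 - b^2)^2]. It is the quantitative convexity of [1 / (x y^2)]
    between the two halves of an interval. *)
Lemma harmonic_gap a b : `|a| < 1 -> `|b| < 1 ->
  2 * (1 + a ^+ 2 / 2 + b ^+ 2) <=
  ((1 + a) * (1 + b) ^+ 2)^-1 + ((1 - a) * (1 - b) ^+ 2)^-1.
Proof.
move=> a1 b1; have := a1; have := b1; rewrite !ltr_norml => /andP[b2 b3] /andP[a2 a3].
have P0 : 0 < (1 + a) * (1 + b) ^+ 2 by rewrite mulr_gt0 ?exprn_gt0//; lra.
have R0 : 0 < (1 - a) * (1 - b) ^+ 2 by rewrite mulr_gt0 ?exprn_gt0//; lra.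
set P := (1 + a) * _ in P0 *; set S := (1 - a) * _ in R0 *.
pose m := 1 + a ^+ 2 / 2 + b ^+ 2.
have A1 : a ^+ 2 < 1 by rewrite -real_normK ?num_real// expr_lt1.
have B1 : b ^+ 2 < 1 by rewrite -real_normK ?num_real// expr_lt1.
have A0 := sqr_ge0 a; have B0 := sqr_ge0 b.
have m0 : 0 < m by rewrite /m; lra.
have mPS : m ^+ 2 * (P * S) <= 1.
  have -> : P * S = (1 - a ^+ 2) * (1 - b ^+ 2) ^+ 2 by rewrite /P /S; ring.
  apply: (@le_trans _ _ (((1 + a ^+ 2 / 2) * (1 + b ^+ 2)) ^+ 2 *
      ((1 - a ^+ 2) * (1 - b ^+ 2) ^+ 2))).
    rewrite ler_wpM2r//; first by rewrite mulr_ge0 ?sqr_ge0//; lra.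
    have mle : m <= (1 + a ^+ 2 / 2) * (1 + b ^+ 2).
      by rewrite /m; have := mulr_ge0 A0 B0; lra.
    by rewrite ler_pXn2r// ?nnegrE; apply: ltW => //; exact: lt_le_trans mle.
  have -> : ((1 + a ^+ 2 / 2) * (1 + b ^+ 2)) ^+ 2 * ((1 - a ^+ 2) * (1 - b ^+ 2) ^+ 2) =
    ((1 + a ^+ 2 / 2) ^+ 2 * (1 - a ^+ 2)) * ((1 - (b ^+ 2) ^+ 2) ^+ 2) by ring.
  rewrite mulr_ile1//.
  - by rewrite mulr_ge0 ?sqr_ge0//; lra.
  - by rewrite sqr_ge0.
  - move: (a ^+ 2) A0 A1 => t t0 t1.
    have -> : (1 + t / 2) ^+ 2 * (1 - t) = 1 - t ^+ 2 * (3 / 4 + t / 4) by field.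
    by rewrite gerBl mulr_ge0 ?sqr_ge0//; lra.
  - have t1 : (b ^+ 2) ^+ 2 <= 1 by rewrite expr_le1// ltW.
    by rewrite expr_le1//; have := sqr_ge0 (b ^+ 2); lra.
have PS0 : 0 < P * S by rewrite mulr_gt0.
have h : (2 * m) ^+ 2 <= (P^-1 + S^-1) ^+ 2.
  have : m ^+ 2 <= P^-1 * S^-1 by rewrite -invfM -[leRHS]mul1r ler_pdivlMr.
  by have := sqr_ge0 (P^-1 - S^-1); nra.
rewrite -/m -(@ler_pXn2r _ 2)// nnegrE.
  by rewrite mulr_ge0// ltW.
by rewrite addr_ge0// invr_ge0 ltW.
Qed.

(** The product of the two denominators is [((1 - a) (1 - b)) ((1 + a) (1 + b)) ((1 - b) (1 + b))].
    The hypotheses bound the first two factors below by [1 / Q]. The third is at least [1 / (2 Q)],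
    since [1 - a] and [1 + a] are at most 2 and one of [1 - b], [1 + b] is at least 1. In the
    application the hypotheses compare the lower A_2 bound on a half with the upper one on the
    whole. *)
Lemma inv_doubling_le a b Q : `|a| < 1 -> `|b| < 1 -> 1 <= Q ->
  1 <= Q * ((1 - a) * (1 - b)) -> 1 <= Q * ((1 + a) * (1 + b)) ->
  ((1 - a) * (1 - b) ^+ 2)^-1 * ((1 + a) * (1 + b) ^+ 2)^-1 <= 2 * Q ^+ 3.
Proof.
rewrite !ltr_norml => /andP[a1 a2] /andP[b1 b2] Q1 e1 e2.
have Q0 : 0 < Q by lra.
have am : 0 < 1 - a by lra.
have ap : 0 < 1 + a by lra.
have bm : 0 < 1 - b by lra.
have bp : 0 < 1 + b by lra.
have e3 : 1 <= 2 * Q * (1 - b).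
  apply: (le_trans e1); rewrite -subr_ge0.
  have -> : 2 * Q * (1 - b) - Q * ((1 - a) * (1 - b)) = Q * ((1 - b) * (1 + a)) by ring.
  by rewrite !mulr_ge0// ltW.
have e4 : 1 <= 2 * Q * (1 + b).
  apply: (le_trans e2); rewrite -subr_ge0.
  have -> : 2 * Q * (1 + b) - Q * ((1 + a) * (1 + b)) = Q * ((1 + b) * (1 - a)) by ring.
  by rewrite !mulr_ge0// ltW.
have e5 : 1 <= 2 * Q * ((1 - b) * (1 + b)).
  have [bn|bpos] := lerP b 0.
    apply: (le_trans e4); rewrite -subr_ge0.
    have -> : 2 * Q * ((1 - b) * (1 + b)) - 2 * Q * (1 + b) = 2 * Q * ((1 + b) * - b) by ring.
    by rewrite !mulr_ge0// ?oppr_ge0// ltW.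
  apply: (le_trans e3); rewrite -subr_ge0.
  have -> : 2 * Q * ((1 - b) * (1 + b)) - 2 * Q * (1 - b) = 2 * Q * ((1 - b) * b) by ring.
  by rewrite !mulr_ge0// ltW.
rewrite -invfM invf_ple ?posrE ?mulr_gt0 ?exprn_gt0//.
rewrite -div1r ler_pdivrMr ?mulr_gt0 ?exprn_gt0//.
have -> : (1 - a) * (1 - b) ^+ 2 * ((1 + a) * (1 + b) ^+ 2) * (2 * Q ^+ 3) =
   (Q * ((1 - a) * (1 - b))) * (Q * ((1 + a) * (1 + b))) * (2 * Q * ((1 - b) * (1 + b))).
  by ring.
by apply: mulr_ege1 => //; exact: mulr_ege1.
Qed.

(** The difference of the reciprocals is [(P1 - P2) / (P1 P2)], and [P1 - P2] is of first order in
    the imbalances: its square is at most [32 (a^2 + b^2)]. The constant is [128 = 32 * 2^2]. *)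
Lemma inv_doubling_diff a b Q : `|a| < 1 -> `|b| < 1 -> 1 <= Q ->
  ((1 - a) * (1 - b) ^+ 2)^-1 * ((1 + a) * (1 + b) ^+ 2)^-1 <= 2 * Q ^+ 3 ->
  (((1 + a) * (1 + b) ^+ 2)^-1 - ((1 - a) * (1 - b) ^+ 2)^-1) ^+ 2 <=
    128 * Q ^+ 6 * (a ^+ 2 + b ^+ 2).
Proof.
move=> a1 b1 Q1; have := a1; have := b1.
rewrite !ltr_norml => /andP[b2 b3] /andP[a2 a3].
have P10 : 0 < (1 - a) * (1 - b) ^+ 2 by rewrite mulr_gt0 ?exprn_gt0//; lra.
have P20 : 0 < (1 + a) * (1 + b) ^+ 2 by rewrite mulr_gt0 ?exprn_gt0//; lra.
have PE : (1 - a) * (1 - b) ^+ 2 - (1 + a) * (1 + b) ^+ 2 =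
  - ((2 + 2 * b ^+ 2) * a + 4 * b) by ring.
move: ((1 - a) * _) ((1 + a) * _) P10 P20 PE => P1 P2 P10 P20 PE PP.
have -> : P2^-1 - P1^-1 = (P1 - P2) * (P1^-1 * P2^-1) by field; rewrite !gt_eqF.
rewrite PE exprMn sqrrN.
have k2 : (P1^-1 * P2^-1) ^+ 2 <= 4 * Q ^+ 6.
  have -> : 4 * Q ^+ 6 = (2 * Q ^+ 3) ^+ 2 by ring.
  have PP0 : 0 <= P1^-1 * P2^-1 by rewrite mulr_ge0// invr_ge0 ltW.
  by rewrite ler_pXn2r ?nnegrE//; exact: le_trans PP.
have k1 : ((2 + 2 * b ^+ 2) * a + 4 * b) ^+ 2 <= 32 * (a ^+ 2 + b ^+ 2).
  have bb : b ^+ 2 <= 1 by rewrite -real_normK ?num_real// expr_le1// ltW.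
  have B0 := sqr_ge0 b.
  have h1 : (2 + 2 * b ^+ 2) ^+ 2 <= 16.
    move: (b ^+ 2) bb B0 => t t1 t0.
    have -> : 16 = 4 ^+ 2 :> R by ring.
    by rewrite ler_pXn2r ?nnegrE//; lra.
  have h2 : ((2 + 2 * b ^+ 2) * a + 4 * b) ^+ 2 <=
      2 * ((2 + 2 * b ^+ 2) ^+ 2 * a ^+ 2) + 32 * b ^+ 2.
    by have := sqr_ge0 ((2 + 2 * b ^+ 2) * a - 4 * b); lra.
  apply: (le_trans h2).
  have := ler_wpM2r (sqr_ge0 a) h1; lra.
apply: (le_trans (ler_pM (sqr_ge0 _) (sqr_ge0 _) k1 k2)).
by rewrite le_eqVlt; apply/orP; left; apply/eqP; ring.
Qed.

(* The concave denominator of the Bellman function; it lies between x and 2x when l^2 <= x y. *)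
Definition bden l x y := 2 * x - l ^+ 4 / (x * y ^+ 2).

Lemma bden_ge l x y : 0 < x -> 0 < y -> l ^+ 2 <= x * y -> x <= bden l x y.
Proof.
move=> x0 y0 h; rewrite /bden lerBrDl.
have : l ^+ 4 / (x * y ^+ 2) <= x; last by lra.
rewrite ler_pdivrMr ?mulr_gt0 ?exprn_gt0//.
have -> : x * (x * y ^+ 2) = (x * y) ^+ 2 by ring.
have -> : l ^+ 4 = (l ^+ 2) ^+ 2 by rewrite -exprM.
by rewrite ler_pXn2r ?nnegrE ?sqr_ge0// mulr_ge0 ?ltW.
Qed.

(** Homogeneous of degree one and convex, because [f^2 / D] is jointly convex, decreasing in [D],
    and [D] is concave. With an energy [e >= f^2 / x], the concave and nonnegative quantity of the
    bisection argument is [e - bellman]. *)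
Definition bellman l f x y := f ^+ 2 / bden l x y.

Lemma bellman_ge0 l f x y : 0 < x -> 0 < y -> l ^+ 2 <= x * y -> 0 <= bellman l f x y.
Proof.
move=> x0 y0 h; rewrite /bellman divr_ge0 ?sqr_ge0//.
exact: le_trans (ltW x0) (bden_ge x0 y0 h).
Qed.

Lemma bellman_le l f x y : 0 < x -> 0 < y -> l ^+ 2 <= x * y ->
  bellman l f x y <= f ^+ 2 / x.
Proof.
move=> x0 y0 h; have xD := bden_ge x0 y0 h.
rewrite /bellman ler_wpM2l ?sqr_ge0// lef_pV2 ?posrE//.
exact: lt_le_trans xD.
Qed.

(* Here [a] and [b] are the relative imbalances of the two halves of the interval. *)
Lemma bellman_gap l x y a b f d Q :
  0 < l -> 0 < x -> 0 < y -> `|a| < 1 -> `|b| < 1 -> 1 <= Q ->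
  x * y <= Q * l ^+ 2 ->
  l ^+ 2 <= x * y ->
  l ^+ 2 <= x * (1 - a) * (y * (1 - b)) -> l ^+ 2 <= x * (1 + a) * (y * (1 + b)) ->
  d ^+ 2 * y / l ^+ 2 <= 1200 * Q ^+ 9 *
   (bellman (l / 2) ((f - d) / 2) (x * (1 - a) / 2) (y * (1 - b) / 2)
   + bellman (l / 2) ((f + d) / 2) (x * (1 + a) / 2) (y * (1 + b) / 2)
   - bellman l f x y).
Proof.
move=> l0 x0 y0; rewrite !ltr_norml => /andP[a1 a2] /andP[b1 b2] Q1 xyQ lxy lxy1 lxy2.
pose h := l ^+ 4 / (x * y ^+ 2).
pose P1 := (1 - a) * (1 - b) ^+ 2; pose P2 := (1 + a) * (1 + b) ^+ 2.
have P10 : 0 < P1 by rewrite mulr_gt0 ?exprn_gt0//; lra.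
have P20 : 0 < P2 by rewrite mulr_gt0 ?exprn_gt0//; lra.
have Q0 : 0 < Q by lra.
have l2 : 0 < l ^+ 2 by rewrite exprn_gt0.
have h0 : 0 < h by rewrite divr_gt0 ?mulr_gt0 ?exprn_gt0.
have x10 : 0 < x * (1 - a) / 2 by rewrite divr_gt0// mulr_gt0//; lra.
have x20 : 0 < x * (1 + a) / 2 by rewrite divr_gt0// mulr_gt0//; lra.
have y10 : 0 < y * (1 - b) / 2 by rewrite divr_gt0// mulr_gt0//; lra.
have y20 : 0 < y * (1 + b) / 2 by rewrite divr_gt0// mulr_gt0//; lra.
have hx : h <= x by have := bden_ge x0 y0 lxy; rewrite /bden -/h; lra.
have xh : x <= Q ^+ 2 * h.
  rewrite /h mulrA ler_pdivlMr ?mulr_gt0 ?exprn_gt0//.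
  have -> : x * (x * y ^+ 2) = (x * y) ^+ 2 by ring.
  have -> : Q ^+ 2 * l ^+ 4 = (Q * l ^+ 2) ^+ 2 by rewrite exprMn -exprM.
  by rewrite ler_pXn2r ?nnegrE ?mulr_ge0 ?sqr_ge0//; exact: ltW.
have := @harmonic_gap a b; rewrite !ltr_norml a1 a2 b1 b2 => /(_ isT isT).
rewrite -/P1 -/P2 => hg.
have D1E : bden (l / 2) (x * (1 - a) / 2) (y * (1 - b) / 2) = x * (1 - a) - h / (2 * P1).
  by rewrite /bden /h /P1; field; rewrite ?gt_eqF//; lra.
have D2E : bden (l / 2) (x * (1 + a) / 2) (y * (1 + b) / 2) = x * (1 + a) - h / (2 * P2).
  by rewrite /bden /h /P2; field; rewrite ?gt_eqF//; lra.
have D10 : x * (1 - a) / 2 <= x * (1 - a) - h / (2 * P1).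
  rewrite -D1E; apply: bden_ge => //.
  by rewrite (_ : (l / 2) ^+ 2 = l ^+ 2 / 4); [clear -lxy1; lra|field].
have D20 : x * (1 + a) / 2 <= x * (1 + a) - h / (2 * P2).
  rewrite -D2E; apply: bden_ge => //.
  by rewrite (_ : (l / 2) ^+ 2 = l ^+ 2 / 4); [clear -lxy2; lra|field].
rewrite /bellman D1E D2E.
have DE : bden l x y = 2 * x - h by [].
rewrite DE.
have ihE (P : R) : 0 < P -> h / (2 * P) = h * P^-1 / 2.
  by move=> ?; field; rewrite gt_eqF.
move: D10 D20; rewrite !ihE// => D10 D20.
set D1 := x * (1 - a) - _ in D10 *; set D2 := x * (1 + a) - _ in D20 *.
have D1p : 0 < D1 by exact: lt_le_trans D10.
have D2p : 0 < D2 by exact: lt_le_trans D20.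
pose Ds := D1 + D2; pose g := D2 - D1.
(* The concavity defect of the denominator: its value on the whole minus the sum of its values on
   the halves. *)
pose de := 2 * x - h - Ds.
have de_ge : h * (a ^+ 2 / 2 + b ^+ 2) <= de.
  have -> : de = h * ((P2^-1 + P1^-1) / 2 - 1) by rewrite /de /Ds /D1 /D2; field; rewrite !gt_eqF.
  by apply: ler_wpM2l; [exact: ltW|clear -hg; lra].
have ab0 : 0 <= a ^+ 2 + b ^+ 2 by rewrite addr_ge0 ?sqr_ge0.
have de0 : 0 <= de.
  apply: le_trans de_ge; apply: mulr_ge0; first exact: ltW.
  by rewrite addr_ge0 ?divr_ge0 ?sqr_ge0.
have Dsx : x <= Ds by rewrite /Ds; clear -D10 D20; lra.
have Ds0 : 0 < Ds by exact: lt_le_trans Dsx.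
have Ds2 : Ds <= 2 * x by move: de0 h0; rewrite /de; clear; lra.
have D0 : 0 < 2 * x - h by clear -hx x0; lra.
have PP : P1^-1 * P2^-1 <= 2 * Q ^+ 3.
  apply: inv_doubling_le => //; rewrite ?ltr_norml ?a1 ?b1//.
    rewrite -(ler_pM2l l2) mulr1; apply: le_trans lxy1 _.
    have -> : x * (1 - a) * (y * (1 - b)) = (x * y) * ((1 - a) * (1 - b)) by ring.
    have -> : l ^+ 2 * (Q * ((1 - a) * (1 - b))) = Q * l ^+ 2 * ((1 - a) * (1 - b)) by ring.
    by apply: ler_wpM2r => //; apply: mulr_ge0; rewrite subr_ge0 ltW.
  rewrite -(ler_pM2l l2) mulr1; apply: le_trans lxy2 _.
  have -> : x * (1 + a) * (y * (1 + b)) = (x * y) * ((1 + a) * (1 + b)) by ring.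
  have -> : l ^+ 2 * (Q * ((1 + a) * (1 + b))) = Q * l ^+ 2 * ((1 + a) * (1 + b)) by ring.
  by apply: ler_wpM2r => //; apply: mulr_ge0; rewrite -lerBlDl sub0r ltW.
have PPs : (P2^-1 - P1^-1) ^+ 2 <= 128 * Q ^+ 6 * (a ^+ 2 + b ^+ 2).
  by apply: inv_doubling_diff => //; rewrite ltr_norml ?a1 ?b1.
(* Here [72 = 8 + 128 / 2], from [g = 2 a x - h (P2^-1 - P1^-1) / 2] and [inv_doubling_diff]. *)
have gs : g ^+ 2 <= 72 * Q ^+ 6 * x ^+ 2 * (a ^+ 2 + b ^+ 2).
  have -> : g = 2 * a * x - h * (P2^-1 - P1^-1) / 2 by rewrite /g /D1 /D2; ring.
  have k : (h * (P2^-1 - P1^-1)) ^+ 2 <= x ^+ 2 * (128 * Q ^+ 6 * (a ^+ 2 + b ^+ 2)).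
    rewrite exprMn ler_pM ?sqr_ge0// ler_pXn2r ?nnegrE//; exact: ltW.
  have k2 : (2 * a * x - h * (P2^-1 - P1^-1) / 2) ^+ 2 <= 8 * (a ^+ 2 * x ^+ 2) +
      (h * (P2^-1 - P1^-1)) ^+ 2 / 2.
    by clear; have := sqr_ge0 (2 * a * x + h * (P2^-1 - P1^-1) / 2); lra.
  apply: (le_trans k2).
  have k3 : a ^+ 2 * x ^+ 2 <= Q ^+ 6 * x ^+ 2 * (a ^+ 2 + b ^+ 2).
    have -> : Q ^+ 6 * x ^+ 2 * (a ^+ 2 + b ^+ 2) = ((a ^+ 2 + b ^+ 2) * Q ^+ 6) * x ^+ 2 by ring.
    apply: ler_wpM2r; first exact: sqr_ge0.
    apply: (@le_trans _ _ (a ^+ 2 + b ^+ 2)); first by rewrite lerDl sqr_ge0.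
    by rewrite ler_peMr// exprn_ege1.
  by clear -k k3; lra.
(* The gain has two sources: [G1] comes from the joint convexity of [f^2 / D], [G2] from the
   concavity defect [de]. *)
pose G1 := (f * g - d * Ds) ^+ 2 / Ds ^+ 3; pose G2 := f ^+ 2 * de / (4 * x ^+ 2).
have G10 : 0 <= G1 by rewrite divr_ge0 ?sqr_ge0 ?exprn_ge0// ltW.
have G20 : 0 <= G2 by apply: divr_ge0; apply: mulr_ge0 => //; exact: sqr_ge0.
have GG : G1 + G2 <= ((f - d) / 2) ^+ 2 / D1 + ((f + d) / 2) ^+ 2 / D2 - f ^+ 2 / (2 * x - h).
  have -> : ((f - d) / 2) ^+ 2 / D1 + ((f + d) / 2) ^+ 2 / D2 =
      f ^+ 2 / Ds + (f * g - d * Ds) ^+ 2 / (4 * (D1 * D2) * Ds).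
    by rewrite /g /Ds; field; rewrite !gt_eqF.
  have -> : f ^+ 2 / Ds + (f * g - d * Ds) ^+ 2 / (4 * (D1 * D2) * Ds) - f ^+ 2 / (2 * x - h) =
     (f * g - d * Ds) ^+ 2 / (4 * (D1 * D2) * Ds) + f ^+ 2 * de / (Ds * (2 * x - h)).
    have -> : de = (2 * x - h) - Ds by [].
    move: (2 * x - h) D0 => DD D0.
    by field; rewrite !gt_eqF.
  apply: lerD.
    rewrite /G1 ler_wpM2l ?sqr_ge0// lef_pV2 ?posrE ?exprn_gt0 ?mulr_gt0//.
    rewrite [Ds ^+ 3]exprSr; apply: ler_wpM2r; first exact: ltW.
    by rewrite /Ds; clear; have := sqr_ge0 (D1 - D2); lra.
  apply: ler_wpM2l; first by apply: mulr_ge0 => //; exact: sqr_ge0.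
  have x2 : 0 < 4 * x ^+ 2 by rewrite mulr_gt0// exprn_gt0.
  rewrite lef_pV2 ?posrE ?mulr_gt0//.
  have -> : 4 * x ^+ 2 = (2 * x) * (2 * x) by ring.
  by apply: ler_pM => //; [exact: ltW|exact: ltW|rewrite gerBl ltW].
(* Write [d Ds = f g - (f g - d Ds)]. The bracket is paid for by [G1]; the term [f g] is large only
   if the imbalances are, and then [G2] pays. The constant is [1152 = 2 * 72 * 8]. *)
have dG : d ^+ 2 <= 1152 * Q ^+ 8 * x * (G1 + G2).
  have d1 : d ^+ 2 * Ds ^+ 2 <= 2 * (f * g - d * Ds) ^+ 2 + 2 * (f ^+ 2 * g ^+ 2).
    by clear; have := sqr_ge0 (2 * f * g - d * Ds); lra.
  have d2 : (f * g - d * Ds) ^+ 2 = G1 * Ds ^+ 3 by rewrite /G1 divfK// gt_eqF// exprn_gt0.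
  have d3 : f ^+ 2 * (a ^+ 2 + b ^+ 2) <= 8 * Q ^+ 2 * x * G2.
    have -> : 8 * Q ^+ 2 * x * G2 = f ^+ 2 * (2 * Q ^+ 2 * de / x).
      by rewrite /G2; field; rewrite gt_eqF.
    apply: ler_wpM2l; first exact: sqr_ge0.
    rewrite ler_pdivlMr//.
    have k1 : (a ^+ 2 + b ^+ 2) * x <= (a ^+ 2 + b ^+ 2) * (Q ^+ 2 * h) by rewrite ler_wpM2l.
    have k2 : Q ^+ 2 * (h * (a ^+ 2 / 2 + b ^+ 2)) <= Q ^+ 2 * de by rewrite ler_wpM2l ?sqr_ge0.
    have k3 : 0 <= Q ^+ 2 * h * b ^+ 2.
      by apply: mulr_ge0; [apply: mulr_ge0; [|exact: ltW]|]; exact: sqr_ge0.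
    by clear -k1 k2 k3; lra.
  rewrite -(@ler_pM2r _ (Ds ^+ 2)) ?exprn_gt0//; apply: le_trans d1 _.
  rewrite d2 [_ * (_ + _) * _]mulrAC mulrDr.
  have xDs : x ^+ 2 <= Ds ^+ 2 by rewrite ler_pXn2r ?nnegrE//; exact: ltW.
  apply: lerD.
    have -> : 2 * (G1 * Ds ^+ 3) = (2 * Ds) * (Ds ^+ 2 * G1) by ring.
    rewrite -[leRHS]mulrA; apply: ler_wpM2r; first by rewrite mulr_ge0 ?sqr_ge0.
    have q1 : x <= Q ^+ 8 * x by rewrite ler_peMl ?exprn_ege1// ltW.
    by move: q1 Ds2 x0; rewrite -mulrA; move: (Q ^+ 8 * x) => q; clear; lra.
  have -> : 1152 * Q ^+ 8 * x * Ds ^+ 2 * G2 = 2 * (72 * Q ^+ 6 * Ds ^+ 2 * (8 * Q ^+ 2 * x * G2)) by ring.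
  rewrite ler_wpM2l//.
  apply: (@le_trans _ _ (f ^+ 2 * (72 * Q ^+ 6 * x ^+ 2 * (a ^+ 2 + b ^+ 2)))).
    by rewrite ler_wpM2l ?sqr_ge0.
  have -> : f ^+ 2 * (72 * Q ^+ 6 * x ^+ 2 * (a ^+ 2 + b ^+ 2)) =
    72 * Q ^+ 6 * x ^+ 2 * (f ^+ 2 * (a ^+ 2 + b ^+ 2)) by ring.
  have Q60 : 0 <= 72 * Q ^+ 6 by rewrite mulr_ge0// exprn_ge0// ltW.
  apply: ler_pM => //.
  - by rewrite mulr_ge0 ?sqr_ge0.
  - by rewrite mulr_ge0 ?sqr_ge0.
  - by apply: ler_wpM2l.
set GT := _ - f ^+ 2 / _ in GG *.
(* The upper A_2 bound gives [y / l^2 <= Q / x]; this is the ninth factor [Q]. *)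
apply: (@le_trans _ _ (d ^+ 2 * (Q / x))).
  rewrite -mulrA; apply: ler_wpM2l; first exact: sqr_ge0.
  by rewrite ler_pdivrMr// mulrAC ler_pdivlMr// [y * x]mulrC.
apply: (@le_trans _ _ (1152 * Q ^+ 8 * x * (G1 + G2) * (Q / x))).
  by apply: ler_wpM2r => //; apply: divr_ge0; exact: ltW.
have -> : 1152 * Q ^+ 8 * x * (G1 + G2) * (Q / x) = 1152 * Q ^+ 9 * (G1 + G2).
  by field; rewrite gt_eqF.
have Q9 : 0 <= Q ^+ 9 by rewrite exprn_ge0// ltW.
have GT0 : 0 <= GT by apply: le_trans GG; rewrite addr_ge0.
apply: (@le_trans _ _ (1152 * Q ^+ 9 * GT)).
  by apply: ler_wpM2l; [apply: mulr_ge0; [exact: ler0n|exact: Q9]|exact: GG].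
apply: ler_wpM2r; first exact: GT0.
by apply: ler_wpM2r; [exact: Q9|rewrite ler_nat].
Qed.
End Bellman.

(** * Bisection trees *)
Section BisectionTree.
Variables (R : realFieldType) (fI xI yI eI : R -> R -> R) (Q : R).

(* Functions of [a] and [l] stand for integrals over the interval [a, a + l]. *)
Definition half_additive (g : R -> R -> R) := forall a l, 0 < l ->
  g a l = g a (l / 2) + g (a + l / 2) (l / 2).

Hypotheses (fA : half_additive fI) (xA : half_additive xI) (yA : half_additive yI)
  (eA : half_additive eI).
Hypotheses (x0 : forall a l, 0 < l -> 0 < xI a l) (y0 : forall a l, 0 < l -> 0 < yI a l).
Hypothesis Q1 : 1 <= Q.
Hypothesis xy_ge : forall a l, 0 < l -> l ^+ 2 <= xI a l * yI a l.
Hypothesis xy_le : forall a l, 0 < l -> xI a l * yI a l <= Q * l ^+ 2.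
Hypothesis fe : forall a l, 0 < l -> fI a l ^+ 2 <= eI a l * xI a l.

(** The squared Haar coefficient of [f] on the interval, times the mean of the weight [y]. *)
Definition tree_jump (a l : R) : R :=
  (fI (a + l / 2) (l / 2) - fI a (l / 2)) ^+ 2 * yI a l / l ^+ 2.

Fixpoint tree_sum (N : nat) (a l : R) : R :=
  if N is N'.+1 then
    tree_jump a l + (tree_sum N' a (l / 2) + tree_sum N' (a + l / 2) (l / 2))
  else eI a l.

(** A jump [k] generations below has weight [2^-k]. The factor [l^2] in [centered_bound] drops by 4
    per generation, so a factor 2 can be given away; in return the sum over all nodes counts every
    jump at most twice. *)
Fixpoint tree_damped (N : nat) (a l : R) : R :=
  if N is N'.+1 then
    tree_jump a l + (tree_damped N' a (l / 2) + tree_damped N' (a + l / 2) (l / 2)) / 2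
  else eI a l.

Fixpoint tree_total (N : nat) (a l : R) : R :=
  if N is N'.+1 then
    tree_damped N a l + (tree_total N' a (l / 2) + tree_total N' (a + l / 2) (l / 2))
  else eI a l.

Lemma e_ge0 a l : 0 < l -> 0 <= eI a l.
Proof.
move=> l0; have := le_trans (sqr_ge0 _) (fe a l0).
by rewrite pmulr_lge0// x0.
Qed.

Lemma tree_jump_ge0 a l : 0 < l -> 0 <= tree_jump a l.
Proof.
move=> l0; apply: divr_ge0 (sqr_ge0 _); apply: mulr_ge0 (sqr_ge0 _) _.
exact/ltW/y0.
Qed.

Lemma tree_damped_ge0 N a l : 0 < l -> 0 <= tree_damped N a l.
Proof.
elim: N a l => [|N IH] a l l0 /=; first exact: e_ge0.
have l20 : 0 < l / 2 by rewrite divr_gt0.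
by rewrite addr_ge0 ?tree_jump_ge0// divr_ge0// addr_ge0 ?IH.
Qed.

(** A jump occurs in the damped sums of all its ancestors, with weights [1, 1/2, 1/4, ...] of total
    at most 2. The extra [tree_damped] on the left is the tail of this series and closes the
    induction. *)
Lemma tree_total_le N a l : 0 < l ->
  tree_total N a l + tree_damped N a l <= 2 * tree_sum N a l.
Proof.
elim: N a l => [|N IH] a l l0 /=; first lra.
have l20 : 0 < l / 2 by rewrite divr_gt0.
have := IH a _ l20; have := IH (a + l / 2) _ l20; lra.
Qed.

Lemma tree_jump_le a l : 0 < l ->
  tree_jump a l <= 1200 * Q ^+ 9 *
   (bellman (l / 2) (fI a (l / 2)) (xI a (l / 2)) (yI a (l / 2))
   + bellman (l / 2) (fI (a + l / 2) (l / 2)) (xI (a + l / 2) (l / 2)) (yI (a + l / 2) (l / 2))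
   - bellman l (fI a l) (xI a l) (yI a l)).
Proof.
move=> l0; have l20 : 0 < l / 2 by rewrite divr_gt0.
rewrite /tree_jump; set x1 := xI a (l / 2); set x2 := xI _ (l / 2).
set y1 := yI a (l / 2); set y2 := yI _ (l / 2).
set f1 := fI a (l / 2); set f2 := fI _ (l / 2).
have xE : xI a l = x1 + x2 by exact: xA.
have yE : yI a l = y1 + y2 by exact: yA.
have fE : fI a l = f1 + f2 by exact: fA.
have x10 : 0 < x1 by exact: x0.
have x20 : 0 < x2 by exact: x0.
have y10 : 0 < y1 by exact: y0.
have y20 : 0 < y2 by exact: y0.
have h1 : l ^+ 2 / 4 <= x1 * y1.
  by apply: le_trans (xy_ge _ l20); rewrite (_ : (l / 2) ^+ 2 = l ^+ 2 / 4) //; field.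
have h2 : l ^+ 2 / 4 <= x2 * y2.
  by apply: le_trans (xy_ge _ l20); rewrite (_ : (l / 2) ^+ 2 = l ^+ 2 / 4) //; field.
have h3 := xy_ge a l0; have h4 := xy_le a l0.
rewrite xE yE in h3 h4; rewrite xE yE fE.
have X0 : 0 < x1 + x2 by rewrite addr_gt0.
have Y0 : 0 < y1 + y2 by rewrite addr_gt0.
pose al := (x2 - x1) / (x1 + x2); pose be := (y2 - y1) / (y1 + y2).
have e1 : (x1 + x2) * (1 - al) / 2 = x1 by rewrite /al; field; rewrite gt_eqF.
have e2 : (x1 + x2) * (1 + al) / 2 = x2 by rewrite /al; field; rewrite gt_eqF.
have e3 : (y1 + y2) * (1 - be) / 2 = y1 by rewrite /be; field; rewrite gt_eqF.
have e4 : (y1 + y2) * (1 + be) / 2 = y2 by rewrite /be; field; rewrite gt_eqF.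
have e5 : (f1 + f2 - (f2 - f1)) / 2 = f1 by field.
have e6 : (f1 + f2 + (f2 - f1)) / 2 = f2 by field.
have al1 : `|al| < 1.
  by rewrite /al normrM normfV (gtr0_norm X0) ltr_pdivrMr// mul1r ltr_norml; lra.
have be1 : `|be| < 1.
  by rewrite /be normrM normfV (gtr0_norm Y0) ltr_pdivrMr// mul1r ltr_norml; lra.
have := @bellman_gap _ l (x1 + x2) (y1 + y2) al be (f1 + f2) (f2 - f1) Q
  l0 X0 Y0 al1 be1 Q1 h4 h3.
rewrite e1 e2 e3 e4 e5 e6; apply.
  have -> : (x1 + x2) * (1 - al) * ((y1 + y2) * (1 - be)) = 4 * (x1 * y1).
    by rewrite -{2}e1 -{2}e3; field.
  by rewrite mulrC -ler_pdivrMr.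
have -> : (x1 + x2) * (1 + al) * ((y1 + y2) * (1 + be)) = 4 * (x2 * y2).
  by rewrite -{2}e2 -{2}e4; field.
by rewrite mulrC -ler_pdivrMr.
Qed.

(** The gains of [tree_jump_le] telescope down the tree, and at the leaves [eI - bellman] is
    nonnegative by [fe]. *)
Lemma tree_sum_le N a l : 0 < l ->
  tree_sum N a l <= eI a l + 1200 * Q ^+ 9 * (eI a l - bellman l (fI a l) (xI a l) (yI a l)).
Proof.
have C0 : 0 <= 1200 * Q ^+ 9.
  by apply: mulr_ge0; [exact: ler0n|apply: exprn_ge0; exact: le_trans ler01 Q1].
elim: N a l => [|N IH] a l l0 /=.
  rewrite lerDl mulr_ge0// subr_ge0.
  apply: (le_trans (bellman_le _ _ _ _)); [exact: x0|exact: y0|exact: xy_ge|].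
  by rewrite ler_pdivrMr ?x0// fe.
have l20 : 0 < l / 2 by rewrite divr_gt0.
have := IH a _ l20; have := IH (a + l / 2) _ l20; have := tree_jump_le a l0.
rewrite (eA a l0); lra.
Qed.

(** The factor 2 of [tree_total_le] times [1 + 1200] from [tree_sum_le], with [bellman >= 0]
    dropped. *)
Lemma tree_total_bound N a l : 0 < l ->
  tree_total N a l <= 2402 * Q ^+ 9 * eI a l.
Proof.
move=> l0; have h1 := tree_total_le N a l0; have h2 := tree_damped_ge0 N a l0.
have h3 := tree_sum_le N a l0.
have C0 : 0 <= 1200 * Q ^+ 9.
  by apply: mulr_ge0; [exact: ler0n|apply: exprn_ge0; exact: le_trans ler01 Q1].
have h4 : 1200 * Q ^+ 9 * (eI a l - bellman l (fI a l) (xI a l) (yI a l)) <=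
          1200 * Q ^+ 9 * eI a l.
  apply: ler_wpM2l => //; rewrite gerBl; apply: bellman_ge0; by [exact: x0|exact: y0|exact: xy_ge].
have h5 : eI a l <= Q ^+ 9 * eI a l by rewrite ler_peMl ?exprn_ege1// e_ge0.
lra.
Qed.

Lemma tree_total_nodes N a l :
  tree_total N a l = \sum_(n < N.+1) \sum_(m < 2 ^ n)
    tree_damped (N - n) (a + m%:R * (l / 2 ^+ n)) (l / 2 ^+ n).
Proof.
elim: N a l => [|N IH] a l.
  by rewrite big_ord1 big_ord1 /= mul0r addr0 expr0 divr1.
rewrite big_ord_recl /= expn0 big_ord1 /= mul0r addr0 expr0 divr1; congr (_ + _).
rewrite !IH -big_split /=; apply: eq_bigr => n _.
have lE : l / 2 / 2 ^+ n = l / 2 ^+ n.+1 by rewrite exprS invfM mulrA.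
rewrite lE /bump /= add1n subSS -!(big_mkord xpredT (fun m =>
  tree_damped (N - n) (_ + m%:R * (l / 2 ^+ n.+1)) (l / 2 ^+ n.+1))).
rewrite [RHS](@big_cat_nat _ _ _ (2 ^ n))//=; last by rewrite leq_exp2l.
congr (_ + _).
rewrite -[(2 ^ n)%N in RHS]add0n big_addn.
have -> : (2 ^ n.+1 - 2 ^ n)%N = (2 ^ n)%N by rewrite expnS mul2n -addnn addnK.
apply: eq_bigr => m _; congr tree_damped.
have -> : (m + 2 ^ n)%:R * (l / 2 ^+ n.+1) = m%:R * (l / 2 ^+ n.+1) + l / 2 :> R.
  by rewrite natrD natrX exprS; field; rewrite expf_neq0.
by ring.
Qed.

Section Pairing.
Variables (P Ps : R -> R -> R) (L : R).
Hypotheses (PA : half_additive P) (PsA : half_additive Ps).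
Hypothesis L0 : 0 <= L.
Hypothesis osc : forall a l, 0 < l ->
  `|Ps (a + l / 2) (l / 2) - Ps a (l / 2)| <= L * l ^+ 2 / 2.

(** When [P] and [Ps] integrate [f * theta] and [theta], this is the integral of [theta] against [f]
    minus its mean. *)
Definition centered (a l : R) := P a l - fI a l * Ps a l / l.

Hypothesis base : forall a l, 0 < l ->
  centered a l ^+ 2 <= 4 * L ^+ 2 * l ^+ 2 * (xI a l * eI a l).

(** Passing from an interval to its halves leaves the remainder [e], the jump of [f] times the
    oscillation of [Ps] over [l], and one [tree_jump] pays for it. The decay of [l^2] along the
    generations affords the damping. *)
Lemma centered_bound N a l : 0 < l ->
  centered a l ^+ 2 <= 4 * L ^+ 2 * l ^+ 2 * (xI a l * tree_damped N a l).
Proof.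
elim: N a l => [|N IH] a l l0 /=; first exact: base.
have l20 : 0 < l / 2 by rewrite divr_gt0.
have := IH a _ l20; have := IH (a + l / 2) _ l20.
have U1 := tree_damped_ge0 N a l20; have U2 := tree_damped_ge0 N (a + l / 2) l20.
move: (tree_damped N a _) (tree_damped N (a + _) _) U1 U2 => u1 u2 u10 u20.
pose d := fI (a + l / 2) (l / 2) - fI a (l / 2).
pose p := Ps (a + l / 2) (l / 2) - Ps a (l / 2).
pose e := d * p / l.
have cE : centered a l = centered a (l / 2) + centered (a + l / 2) (l / 2) + e.
  rewrite /centered (PA _ l0) (fA _ l0) (PsA _ l0) /e /d /p; field.
  by rewrite gt_eqF.
have e2 : e ^+ 2 <= L ^+ 2 * l ^+ 2 * (xI a l * tree_jump a l) / 4.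
  have k1 : p ^+ 2 <= (L * l ^+ 2 / 2) ^+ 2.
    rewrite -[leLHS]real_normK ?num_real// ler_pXn2r ?nnegrE ?osc//.
    by rewrite divr_ge0// mulr_ge0// sqr_ge0.
  have -> : e ^+ 2 = d ^+ 2 * p ^+ 2 / l ^+ 2 by rewrite /e; field; rewrite gt_eqF.
  rewrite /tree_jump -/d.
  have -> : L ^+ 2 * l ^+ 2 * (xI a l * (d ^+ 2 * yI a l / l ^+ 2)) / 4 =
     d ^+ 2 * (L ^+ 2 / 4 * (xI a l * yI a l)) by field; rewrite gt_eqF.
  rewrite -mulrA; apply: ler_wpM2l; first exact: sqr_ge0.
  rewrite ler_pdivrMr ?exprn_gt0//; apply: (le_trans k1).
  have -> : (L * l ^+ 2 / 2) ^+ 2 = L ^+ 2 / 4 * l ^+ 2 * l ^+ 2 by field.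
  rewrite ler_wpM2r ?sqr_ge0//; apply: ler_wpM2l; last exact: xy_ge.
  by rewrite divr_ge0// sqr_ge0.
have x10 := x0 a l20; have x20 := x0 (a + l / 2) l20.
rewrite cE (xA _ l0); move: e2; rewrite (xA _ l0).
move: (centered a _) (centered _ (l / 2)) (xI a _) (xI (a + _) _) x10 x20 => t1 t2 x1 x2 x10 x20.
have := tree_jump_ge0 a l0; move: (tree_jump a l) => s s0 e2 h2 h1.
have lE : (l / 2) ^+ 2 = l ^+ 2 / 4 by field.
rewrite lE in h1 h2.
have l2 : 0 <= l ^+ 2 by rewrite sqr_ge0.
have LL : 0 <= L ^+ 2 by rewrite sqr_ge0.
pose c := L ^+ 2 * l ^+ 2; have c0 : 0 <= c by rewrite mulr_ge0.
have k1 : t1 ^+ 2 <= c * (x1 * u1) by apply: (le_trans h1); rewrite /c; lra.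
have k2 : t2 ^+ 2 <= c * (x2 * u2) by apply: (le_trans h2); rewrite /c; lra.
have k3 : (t1 + t2) ^+ 2 <= c * ((x1 + x2) * (u1 + u2)).
  have m1 : t1 ^+ 2 / x1 <= c * u1 by rewrite ler_pdivrMr//; lra.
  have m2 : t2 ^+ 2 / x2 <= c * u2 by rewrite ler_pdivrMr//; lra.
  have X0 : 0 < x1 + x2 by rewrite addr_gt0.
  have m3 : (t1 + t2) ^+ 2 / (x1 + x2) <= t1 ^+ 2 / x1 + t2 ^+ 2 / x2.
    rewrite -subr_ge0.
    have -> : t1 ^+ 2 / x1 + t2 ^+ 2 / x2 - (t1 + t2) ^+ 2 / (x1 + x2) =
      (t1 * x2 - t2 * x1) ^+ 2 / (x1 * x2 * (x1 + x2)) by field; rewrite !gt_eqF.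
    by rewrite divr_ge0 ?sqr_ge0// ltW// !mulr_gt0.
  have : (t1 + t2) ^+ 2 / (x1 + x2) <= c * (u1 + u2) by rewrite mulrDr; lra.
  by rewrite ler_pdivrMr//; lra.
(* With [c = L^2 l^2] the halves contribute at most [c (x1 + x2) (u1 + u2)], because [l^2] has
   fallen to a quarter, while the goal allows twice that. The factor 3/2 therefore fits, and [3 e^2]
   fits into the term of the jump. *)
have k4 : (t1 + t2 + e) ^+ 2 <= 3 / 2 * (t1 + t2) ^+ 2 + 3 * e ^+ 2.
  by have := sqr_ge0 (t1 + t2 - 2 * e); lra.
apply: (le_trans k4).
have -> : 4 * L ^+ 2 * l ^+ 2 * ((x1 + x2) * (s + (u1 + u2) / 2)) =
  4 * (c * ((x1 + x2) * s)) + 2 * (c * ((x1 + x2) * (u1 + u2))) by rewrite /c; field.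
have X0 : 0 <= x1 + x2 by rewrite ltW// addr_gt0.
have w1 : 0 <= c * ((x1 + x2) * (u1 + u2)) by apply: mulr_ge0 c0 (mulr_ge0 X0 (addr_ge0 _ _)).
have w2 : 0 <= c * ((x1 + x2) * s) by exact: mulr_ge0 c0 (mulr_ge0 X0 s0).
have e3 : e ^+ 2 <= c * ((x1 + x2) * s) / 4 by exact: e2.
lra.
Qed.

Lemma pairing_bound N a l : 0 < l -> Ps a l = 0 ->
  P a l ^+ 2 * (yI a l / l) <= 4 * Q * L ^+ 2 * l ^+ 3 * tree_damped N a l.
Proof.
move=> l0 Ps0; have := centered_bound N a l0.
rewrite /centered Ps0 mulr0 mul0r subr0 => h.
have U0 := tree_damped_ge0 N a l0.
apply: (@le_trans _ _ (4 * L ^+ 2 * l ^+ 2 * (xI a l * tree_damped N a l) * (yI a l / l))).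
  by apply: ler_wpM2r => //; rewrite divr_ge0// ltW ?y0.
have -> : 4 * L ^+ 2 * l ^+ 2 * (xI a l * tree_damped N a l) * (yI a l / l) =
  4 * L ^+ 2 * l * tree_damped N a l * (xI a l * yI a l) by field; rewrite gt_eqF.
have -> : 4 * Q * L ^+ 2 * l ^+ 3 * tree_damped N a l =
  4 * L ^+ 2 * l * tree_damped N a l * (Q * l ^+ 2) by ring.
apply: ler_wpM2l; last exact: xy_le.
by apply: mulr_ge0 => //; apply: mulr_ge0 (ltW l0); apply: mulr_ge0 => //; exact: sqr_ge0.
Qed.

End Pairing.
End BisectionTree.

(** * Dyadic grids *)
Section ThirdTrick.
Variable R : realType.
Implicit Types (ell c r A : R).

(* The two dyadic grids of an interval of length [ell], shifted against each other by
   [ell / 3]: at every scale their end points stay a third of the mesh apart. *)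
Definition grid_corner ell (b : bool) : R := if b then - (ell / 3) else - (2 * ell / 3).

(** Hence a third of [ell] is never a multiple of the mesh [ell / 2^n]: it is off by one or two
    thirds of the mesh. *)
Lemma pow2_mod3 n : exists t d : nat, (d = 1 \/ d = 2)%N /\ (2 ^ n = 3 * t + d)%N.
Proof.
elim: n => [|n [t [d [[->|->] h]]]].
- by exists 0%N, 1%N; split; [left|].
- by exists (t * 2)%N, 2%N; split; [right|rewrite expnS h; lia].
- by exists (t * 2 + 1)%N, 1%N; split; [left|rewrite expnS h; lia].
Qed.

Lemma third_trick ell n c r : 0 < ell -> 0 < r -> r <= ell / 2 ^+ n / 3 ->
  - (ell / 3) <= c -> c + r <= ell / 3 ->
  exists b m, [/\ (m < 2 ^ n)%N, grid_corner ell b + m%:R * (ell / 2 ^+ n) <= c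
    & c + r <= grid_corner ell b + m%:R * (ell / 2 ^+ n) + ell / 2 ^+ n].
Proof.
move=> ell0 r0 rq c1 c2; set q := ell / 2 ^+ n in rq *.
have q0 : 0 < q by rewrite divr_gt0 ?exprn_gt0.
have ellE : ell = (2 ^ n)%:R * q.
  by rewrite /q natrX mulrC divfK// expf_neq0.
pose u := (c - grid_corner ell false) / q.
have uq : u * q = c + 2 * ell / 3 by rewrite divfK ?gt_eqF// opprK.
have u0 : 0 <= u by rewrite divr_ge0 ?ltW// /grid_corner opprK; lra.
have /andP[] := truncn_itv u0; set m := Num.truncn u => m1 m2.
have mq1 : m%:R * q <= u * q by rewrite ler_pM2r.
have mq2 : u * q < (m%:R + 1) * q by rewrite ltr_pM2r// natr1.
have [h|h] := lerP ((u + 1/3) * q) ((m%:R + 1) * q).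
  exists false, m; split; rewrite /grid_corner; [|lra|lra].
  have : m%:R * q < (2 ^ n)%:R * q by rewrite -ellE; lra.
  by rewrite ltr_pM2r// ltr_nat.
(* Now [c] lies in the last third of its cell in the first grid. The second grid is displaced by [t]
   cells and [d / 3] of a cell, so there the interval fits into the cell of index [m - t]. *)
have [t [d [dd]]] := pow2_mod3 n => te.
have ellE' : ell = (3 * t%:R + d%:R) * q by rewrite ellE te natrD natrM.
have tm : (t <= m)%N.
  rewrite -ltnS -(ltr_nat R) -natr1 -(ltr_pM2r q0).
  have : 0 <= t%:R * q by rewrite mulr_ge0// ltW.
  have d0 : 0 <= d%:R * q by rewrite mulr_ge0// ltW.
  rewrite ellE' in uq c1; lra.
exists true, (m - t)%N; rewrite natrB// /grid_corner.
have dq : d%:R * q = q \/ d%:R * q = 2 * q by case: dd => ->; [left; rewrite mul1r|right].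
have g1 : - (ell / 3) + (m%:R - t%:R) * q <= c.
  by rewrite ellE'; rewrite ellE' in uq; case: dq => dq; lra.
split => //.
  have : (m - t)%:R * q < (2 ^ n)%:R * q by rewrite -ellE natrB//; lra.
  by rewrite ltr_pM2r// ltr_nat.
by rewrite ellE'; rewrite ellE' in uq; case: dq => dq; lra.
Qed.

Definition node_corner ell (p : bool * nat * nat) : R :=
  grid_corner ell p.1.1 + p.2%:R * (ell / 2 ^+ p.1.2).

Definition node_length ell (p : bool * nat * nat) : R := ell / 2 ^+ p.1.2.

Lemma expz2_nat (j : int) (J n : nat) : j + J%:Z = n%:Z -> (2 : R) ^ j = 2 ^+ n / 2 ^+ J.
Proof.
move=> h; have -> : j = n%:Z - J%:Z by rewrite -h addrK.
by rewrite expfzDr// -exprnP exprnN.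
Qed.

Lemma seq_eventually (T : eqType) (s : seq T) (P : T -> nat -> Prop) :
  (forall i, exists M, forall n, (M <= n)%N -> P i n) ->
  exists M, forall i, i \in s -> P i M.
Proof.
move=> h; suff [M hM] : exists M, forall n, (M <= n)%N -> forall i, i \in s -> P i n.
  by exists M; exact: hM.
elim: s => [|i s [M IH]]; first by exists 0%N.
have [M' hM'] := h i; exists (maxn M M') => n; rewrite geq_max => /andP[n1 n2] k.
by rewrite inE => /predU1P[->|ks]; [exact: hM'|exact: IH].
Qed.

(** A node is [2^t] times as long as the scale [2^-j] of its wavelets, whose supports then fill at
    most a third of it. This fixed ratio also bounds the multiplicity: the wavelets sent to one node
    share [j], and their [k] lie in a window of length [2^t]. *)
Lemma wavelet_nodes A (t : nat) (s : seq (int * int)) : 0 < A -> 6 * A <= 2 ^+ t -> uniq s ->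
  exists (ell : R) (N : nat) (phi : int * int -> bool * nat * nat), 0 < ell /\
   (forall i, i \in s -> [/\ ((phi i).1.2 <= N)%N, ((phi i).2 < 2 ^ (phi i).1.2)%N,
      node_length ell (phi i) * 2 ^ i.1 = 2 ^+ t &
      forall x, `|2 ^ i.1 * x - i.2%:~R| <= A ->
        node_corner ell (phi i) <= x <= node_corner ell (phi i) + node_length ell (phi i)]) /\
   (forall p, (count (fun i => phi i == p) s <= (2 ^ t).+1)%N).
Proof.
move=> A0 tA us.
(* With [ell = 2^(t + J)] the scale [j] sits at level [j + J >= 0], and [J] is so large that all
   supports lie in [[- ell / 3, ell / 3]], the part common to both grids. *)
have [J hJ] : exists J : nat, forall i : int * int, i \in s ->
    0 <= i.1 + J%:Z /\ (`|i.2|%:~R + A) / 2 ^ i.1 <= 2 ^+ t * 2 ^+ J / 3.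
  apply: (@seq_eventually _ s (fun i J => 0 <= i.1 + J%:Z /\
    (`|i.2|%:~R + A) / 2 ^ i.1 <= 2 ^+ t * 2 ^+ J / 3)) => -[j k].
  pose x := 3 * ((`|k|%:~R + A) / 2 ^ j).
  have x0 : 0 <= x.
    by rewrite mulr_ge0// divr_ge0 ?exprz_ge0// addr_ge0 ?(ltW A0)// ler0z.
  exists (maxn `|j|%N (Num.truncn x).+1) => n; rewrite geq_max => /andP[n1 n2]; split => /=.
    by lia.
  rewrite ler_pdivlMr// mulrC -/x.
  have xn : x <= n%:R.
    by apply: ltW; apply: lt_le_trans (truncnS_gt x) _; rewrite ler_nat.
  apply: (le_trans xn); apply: (@le_trans _ _ (2 ^+ n)).
    by rewrite -natrX ler_nat ltnW// ltn_expl.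
  by rewrite ler_peMl ?exprn_ge0// exprn_ege1// ler1n.
pose ell : R := 2 ^+ t * 2 ^+ J.
have ell0 : 0 < ell by rewrite mulr_gt0 ?exprn_gt0.
pose lev (j : int) : nat := absz (j + J%:Z).
have ex (i : int * int) : exists p : bool * nat * nat, i \in s ->
    [/\ p.1.2 = lev i.1, (p.2 < 2 ^ p.1.2)%N, node_length ell p * 2 ^ i.1 = 2 ^+ t &
      forall x, `|2 ^ i.1 * x - i.2%:~R| <= A ->
        node_corner ell p <= x <= node_corner ell p + node_length ell p].
  have [is_|] := boolP (i \in s); last by exists (true, 0%N, 0%N).
  case: i is_ => j k is_; have [/= jJ kA] := hJ _ is_.
  have p2 : 0 < (2 : R) ^ j by rewrite exprz_gt0.
  have levE : j + J%:Z = (lev j)%:Z by rewrite /lev gez0_abs.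
  have jE := expz2_nat levE.
  have qE : ell / 2 ^+ lev j = 2 ^+ t / 2 ^ j.
    by rewrite jE /ell; field; rewrite !expf_neq0.
  pose c := (k%:~R - A) / 2 ^ j; pose r := 2 * A / 2 ^ j.
  have [||||b [m [m1 m2 m3]]] := @third_trick ell (lev j) c r ell0.
  - by rewrite divr_gt0// mulr_gt0.
  - rewrite qE /r [leRHS]mulrAC ler_pM2r ?invr_gt0//; lra.
  - rewrite lerNl -mulNr; apply: le_trans kA; rewrite ler_pM2r ?invr_gt0//.
    rewrite opprB [leRHS]addrC lerD2l -mulrNz ler_int; lia.
  - rewrite /c /r -mulrDl; apply: le_trans kA; rewrite ler_pM2r ?invr_gt0//.
    have : (k%:~R : R) <= `|k|%:~R by rewrite ler_int; lia.
    lra.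
  exists (b, lev j, m) => _; split => //=.
    by rewrite /node_length /= qE divfK// gt_eqF.
  move=> x; rewrite ler_norml /node_corner /node_length /= => /andP[x1 x2].
  apply/andP; split.
    by apply: (le_trans m2); rewrite /c ler_pdivrMr// [x * _]mulrC; lra.
  by apply: le_trans m3; rewrite /c /r -mulrDl ler_pdivlMr// [x * _]mulrC; lra.
have /choice[phi hphi] := ex.
exists ell, (\max_(i <- s) lev i.1), phi; split => //; split.
  move=> i is_; have [h1 h2 h3 h4] := hphi i is_; split => //.
  by rewrite h1; exact: (@leq_bigmax_seq _ s xpredT (fun i => lev i.1)).
move=> p; rewrite -size_filter; set s' := [seq i <- s | _].
case E : s' => [//|i0 s0]; rewrite -E.
have mem i : i \in s' -> i \in s /\ phi i = p by rewrite mem_filter => /andP[/eqP].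
have [i0s i0p] : i0 \in s /\ phi i0 = p by apply: mem; rewrite E mem_head.
have jE i : i \in s' -> i.1 = i0.1.
  move=> /mem[is_ ip]; have [h1 _ _ _] := hphi i is_; have [h2 _ _ _] := hphi i0 i0s.
  have [k1 _] := hJ i is_; have [k2 _] := hJ i0 i0s.
  have : lev i.1 = lev i0.1 by rewrite -h1 -h2 ip i0p.
  by rewrite /lev => /(congr1 Posz); rewrite !gez0_abs// => /addIr.
pose z : int := Num.ceil (2 ^ i0.1 * node_corner ell p).
pose win := [seq (i0.1, z + n%:Z) | n <- iota 0 (2 ^ t).+1].
have sub : {subset s' <= win}.
  move=> [j k] is'; have /= je := jE _ is'; have [is_ ip] := mem _ is'.
  have [_ _ /= h3 h4] := hphi _ is_; rewrite ip in h3 h4.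
  have p2 : 0 < (2 : R) ^ j by rewrite exprz_gt0.
  (* The centre [k / 2^j] of the support lies in the node, which confines [k]. *)
  have /h4/andP[l1 l2] : `|2 ^ j * (k%:~R / 2 ^ j) - k%:~R| <= A.
    by rewrite mulrC divfK ?gt_eqF// subrr normr0 ltW.
  rewrite ler_pdivlMr// in l1; rewrite ler_pdivrMr// mulrDl h3 in l2.
  have z1 : z <= k by rewrite /z ceil_le_int -je mulrC.
  have z2 : k <= z + (2 ^ t)%:Z.
    rewrite -(ler_int R) intrD -pmulrn natrX.
    by apply: (le_trans l2); rewrite lerD2r mulrC je ceil_ge.
  apply/mapP; exists (absz (k - z)); last by rewrite -je; congr (_, _); lia.
  by rewrite mem_iota; lia.
have := uniq_leq_size (filter_uniq _ us) sub.
by rewrite size_map size_iota.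
Qed.

End ThirdTrick.

(** * Weighted wavelet estimates *)
Section IntervalIntegrals.
Variable R : realType.
Local Notation mu := (@lebesgue_measure R).
Implicit Types (f g h : R -> R) (a b l t : R).

Lemma ae_imp (P Q : R -> Prop) : (forall x, P x -> Q x) ->
  {ae mu, forall x, P x} -> {ae mu, forall x, Q x}.
Proof. by move=> PQ; apply: (@filterS _ _ (ae_filter_ringOfSetsType mu)). Qed.

Lemma ae_imp2 (P Q S : R -> Prop) : (forall x, P x -> Q x -> S x) ->
  {ae mu, forall x, P x} -> {ae mu, forall x, Q x} -> {ae mu, forall x, S x}.
Proof. by move=> PQ; apply: (@filterS2 _ _ (ae_filter_ringOfSetsType mu)). Qed.

Lemma ae_all (P : R -> Prop) : (forall x, P x) -> {ae mu, forall x, P x}.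
Proof. by move=> h; exact: (@nearW _ _ P (ae_filter_ringOfSetsType mu)). Qed.

Definition loc_int f := forall a b, mu.-integrable `[a, b] (EFin \o f).

Definition Iab f a l : R := (\int[mu]_(x in `[a, (a + l)%R]) f x)%R.

Definition lipschitz_with L f := forall x y, `|f x - f y| <= L * `|x - y|.

Lemma loc_int_measurable f : loc_int f -> measurable_fun setT f.
Proof.
move=> hf; apply/measurable_EFinP.
have -> : [set: R] = \bigcup_n `[- n%:R, n%:R]%classic.
  apply/esym/seteqP; split => // x _; exists (Num.truncn `|x|).+1 => //=.
  by rewrite in_itv/= -ler_norml ltW// truncnS_gt.
by apply/measurable_fun_bigcup => // n; exact: measurable_int (hf _ _).
Qed.

Lemma loc_int_le f g : measurable_fun setT f -> (forall x, `|f x| <= `|g x|) ->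
  loc_int g -> loc_int f.
Proof.
move=> mf fg hg a b; apply: le_integrable (hg a b) => //.
  by apply/measurable_EFinP; exact: measurable_funS mf.
by move=> x _ /=; rewrite lee_fin.
Qed.

Lemma loc_intD f g : loc_int f -> loc_int g -> loc_int (fun x => f x + g x).
Proof. by move=> hf hg a b; have := integrableD _ (hf a b) (hg a b); exact. Qed.

Lemma loc_intZ (k : R) f : loc_int f -> loc_int (fun x => k * f x).
Proof. by move=> hf a b; have := integrableZl _ k (hf a b); exact. Qed.

Lemma loc_int_norm f : loc_int f -> loc_int (fun x => `|f x|).
Proof. by move=> hf a b; have := integrable_norm (hf a b); exact. Qed.

Lemma loc_int_continuous f : continuous f -> loc_int f.
Proof.
move=> cf a b; apply: continuous_compact_integrable; first exact: segment_compact.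
by move=> x; exact: continuous_subspaceT.
Qed.

Lemma lipschitz_continuous L f : lipschitz_with L f -> continuous f.
Proof.
move=> fL x; apply/cvgrPdist_le => e e0.
have L1 : 0 < `|L| + 1 by rewrite ltr_wpDl.
near=> y; apply: (le_trans (fL x y)).
apply: (@le_trans _ _ ((`|L| + 1) * `|x - y|)).
  by rewrite ler_wpM2r// (le_trans (ler_norm L))// lerDl.
rewrite -ler_pdivlMl// mulrC; near: y.
apply: cvgr_dist_le; first exact: cvg_id.
by rewrite divr_gt0.
Unshelve. all: by end_near. Qed.

Lemma loc_int_mul_continuous f g : loc_int f -> continuous g -> loc_int (fun x => f x * g x).
Proof.
move=> hf cg a b.
have mg : measurable_fun setT g by exact: continuous_measurable_fun.
have := @integrableMl _ _ _ mu `[a, b]%classic _ (EFin \o f) g (hf a b).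
apply => //; first exact: measurable_funS mg.
have := @continuous_compact _ _ g `[a, b]%classic.
move=> /(_ (continuous_subspaceT cg) (@segment_compact _ a b)) /compact_bounded[M [Mr hM]].
exists M; split => // r Mr' x /= xab; apply: (hM _ Mr'); by exists x.
Qed.

Lemma Iab_half f : loc_int f -> half_additive (Iab f).
Proof.
move=> hf a l l0; rewrite /Iab -addrA -splitr.
have := @Rintegral_itvB R f (BLeft a) (BRight (a + l)) (a + l / 2) (hf _ _).
rewrite !bnd_simp Rintegral_itv_obnd_cbnd; last first.
  by apply: integrableS (hf (a + l / 2) (a + l)) => //; apply: subset_itvr; rewrite bnd_simp.
by move=> h; rewrite -h; [rewrite subrKC|lra|lra].
Qed.

Lemma IabD f g a l : loc_int f -> loc_int g ->
  Iab (fun x => f x + g x) a l = Iab f a l + Iab g a l.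
Proof. by move=> hf hg; rewrite /Iab RintegralD. Qed.

Lemma IabZ (k : R) f a l : loc_int f -> Iab (fun x => k * f x) a l = k * Iab f a l.
Proof. by move=> hf; rewrite /Iab RintegralZl. Qed.

Lemma Iab_cst (k : R) a l : 0 <= l -> Iab (fun=> k) a l = k * l.
Proof.
move=> l0; rewrite /Iab Rintegral_cst//= lebesgue_measure_itv/= lte_fin.
case: ltP => h /=; first by rewrite addrC addKr.
by rewrite (_ : l = 0) ?mulr0//; lra.
Qed.

Lemma Iab_ge0 f a l : (forall x, 0 <= f x) -> 0 <= Iab f a l.
Proof. by move=> f0; apply: Rintegral_ge0. Qed.

Lemma Iab_le f g a l : loc_int f -> loc_int g ->
  (forall x, a <= x <= a + l -> f x <= g x) -> Iab f a l <= Iab g a l.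
Proof.
by move=> hf hg fg; apply: le_Rintegral => // x /=; rewrite in_itv/=; exact: fg.
Qed.

Lemma Iab_norm f a l : loc_int f -> `|Iab f a l| <= Iab (fun x => `|f x|) a l.
Proof. by move=> hf; exact: le_normr_Rintegral. Qed.

Lemma Iab_ae_le f g a l : loc_int f -> loc_int g ->
  (forall x, 0 <= f x) -> (forall x, 0 <= g x) ->
  {ae mu, forall x, a <= x <= a + l -> f x <= g x} -> Iab f a l <= Iab g a l.
Proof.
move=> hf hg f0 g0 fg; rewrite /Iab fine_le//.
- exact: integrable_fin_num (hf _ _).
- exact: integrable_fin_num (hg _ _).
- apply: ae_ge0_le_integral => //.
  + by move=> x _; rewrite lee_fin.
  + exact: measurable_int (hf _ _).
  + by move=> x _; rewrite lee_fin.
  + exact: measurable_int (hg _ _).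
Qed.

(** Cauchy-Schwarz from the arithmetic-geometric mean inequality, by the choice [t = c / A]. If
    [A = 0], a large [t] contradicts [0 < c]. *)
Lemma sqr_le_prod (c A B : R) : 0 <= c -> 0 <= A -> 0 <= B ->
  (forall t, 0 < t -> c <= (t * A + B / t) / 2) -> c ^+ 2 <= A * B.
Proof.
move=> c0 A0 B0 h; have [->|cp] := eqVneq c 0; first by rewrite expr0n/= mulr_ge0.
have {}cp : 0 < c by rewrite lt_def cp.
have [AE|Ap] := eqVneq A 0.
  have : 0 < (B + 1) / c by rewrite divr_gt0// ltr_wpDl.
  move=> /h; rewrite AE mulr0 add0r invf_div => h1.
  have : B * (c / (B + 1)) <= c.
    by rewrite mulrA ler_pdivrMr ?ltr_wpDl// mulrC ler_pM2l//; lra.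
  lra.
have {}Ap : 0 < A by rewrite lt_def Ap.
have := h (c / A) (divr_gt0 cp Ap); rewrite divfK ?gt_eqF// invf_div => h1.
have : c <= B * (A / c) by lra.
by rewrite mulrA ler_pdivlMr// -expr2 [B * A]mulrC.
Qed.

(** Pointwise [|f| <= (t f^2 w + s / t) / 2], since [s = 1 / w] almost everywhere. *)
Lemma weighted_CS f (w s : R -> R) a l :
  loc_int f -> loc_int s -> loc_int (fun x => f x ^+ 2 * w x) ->
  (forall x, 0 <= w x) -> (forall x, 0 <= s x) -> {ae mu, forall x, w x * s x = 1} ->
  Iab (fun x => `|f x|) a l ^+ 2 <= Iab (fun x => f x ^+ 2 * w x) a l * Iab s a l.
Proof.
move=> hf hs he w0 s0 ws.
have e0 x : 0 <= f x ^+ 2 * w x by rewrite mulr_ge0// sqr_ge0.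
apply: sqr_le_prod; [exact: Iab_ge0..|move=> t t0].
have -> : (t * Iab (fun x => f x ^+ 2 * w x) a l + Iab s a l / t) / 2 =
   Iab (fun x => t / 2 * (f x ^+ 2 * w x) + (2 * t)^-1 * s x) a l.
  by rewrite IabD ?IabZ//; [field; rewrite gt_eqF|exact: loc_intZ..].
apply: Iab_ae_le.
- exact: loc_int_norm.
- by apply: loc_intD; exact: loc_intZ.
- by move=> x.
- move=> x; apply: addr_ge0; apply: mulr_ge0 => //.
    by rewrite divr_ge0// ltW.
  by rewrite invr_ge0 mulr_ge0// ltW.
- apply: ae_imp ws => x wsx _.
  have w1 : 0 < w x.
    rewrite lt_def w0 andbT; apply/eqP => w1; move: wsx; rewrite w1 mul0r => /eqP.
    by rewrite eq_sym oner_eq0.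
  have -> : s x = (w x)^-1 by apply: (mulfI (lt0r_neq0 w1)); rewrite wsx mulfV ?gt_eqF.
  rewrite -subr_ge0 -[f x ^+ 2]real_normK ?num_real//.
  have -> : t / 2 * (`|f x| ^+ 2 * w x) + (2 * t)^-1 * (w x)^-1 - `|f x| =
     (t * `|f x| * w x - 1) ^+ 2 / (2 * t * w x) by field; rewrite !gt_eqF.
  by rewrite divr_ge0 ?sqr_ge0// ltW// !mulr_gt0.
Qed.

End IntervalIntegrals.

(** * Quadratic sums of wavelet pairings under A_2 weights *)

Section WeightedWaveletEstimate.
Variable R : realType.
Local Notation mu := (@lebesgue_measure R).
Implicit Types (f g th s w : R -> R) (a l L Q A : R).

(** A pair instead of a weight and its reciprocal: the two enter symmetrically, and they are inverse
    to each other only almost everywhere. *)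
Record A2_pair Q s w : Prop := {
  A2_s : loc_int s;
  A2_w : loc_int w;
  A2_s0 : forall x, 0 <= s x;
  A2_w0 : forall x, 0 <= w x;
  A2_ws : {ae mu, forall x, w x * s x = 1};
  A2_le : forall a l, 0 < l -> Iab s a l * Iab w a l <= Q * l ^+ 2 }.

Lemma A2_pair_sym Q s w : A2_pair Q s w -> A2_pair Q w s.
Proof.
case=> h1 h2 h3 h4 h5 h6; split => //.
- by apply: ae_imp h5 => x; rewrite mulrC.
- by move=> a l l0; rewrite mulrC h6.
Qed.

Section A2_facts.
Variables (Q : R) (s w : R -> R).
Hypothesis sw : A2_pair Q s w.

(** Cauchy-Schwarz for the constant function 1. *)
Lemma A2_ge a l : 0 < l -> l ^+ 2 <= Iab s a l * Iab w a l.
Proof.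
move=> l0; have [hs hw s0 w0 ws _] := sw.
have h := @weighted_CS _ (fun=> 1) w s a l _ hs _ w0 s0 ws.
have w1 : (fun x : R => 1 ^+ 2 * w x) = w by apply/funext => x; rewrite expr1n mul1r.
rewrite w1 in h.
have c1 : loc_int (fun _ : R => 1 : R) by apply: loc_int_continuous => x; exact: cvg_cst.
have := h c1 hw; rewrite (_ : (fun _ : R => `|1|) = (fun _ : R => 1 : R)).
  by rewrite (Iab_cst 1 a (ltW l0)) mul1r mulrC.
by apply/funext => x; rewrite normr1.
Qed.

Lemma A2_s_gt0 a l : 0 < l -> 0 < Iab s a l.
Proof.
move=> l0; have := A2_ge a l0; have l2 : 0 < l ^+ 2 by rewrite exprn_gt0.
move=> /(lt_le_trans l2) h; rewrite lt_def Iab_ge0 ?andbT; last exact: A2_s0 sw.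
by apply/eqP => h0; rewrite h0 mul0r ltxx in h.
Qed.

Lemma A2_w_gt0 a l : 0 < l -> 0 < Iab w a l.
Proof.
move=> l0; have := A2_ge a l0; have l2 : 0 < l ^+ 2 by rewrite exprn_gt0.
move=> /(lt_le_trans l2) h; rewrite lt_def Iab_ge0 ?andbT; last exact: A2_w0 sw.
by apply/eqP => h0; rewrite h0 mulr0 ltxx in h.
Qed.

Lemma A2_const_ge1 : 1 <= Q.
Proof.
have := A2_ge 0 (@ltr01 R); have := A2_le sw 0 (@ltr01 R).
by rewrite expr1n mulr1 => h1 h2; exact: le_trans h2 h1.
Qed.

End A2_facts.

Definition dil th (i : int * int) : R -> R :=
  fun x => Num.sqrt 2 ^ i.1 * th (2 ^ i.1 * x - i.2%:~R).

Lemma dil_lipschitz L th i : lipschitz_with L th ->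
  lipschitz_with (Num.sqrt 2 ^ i.1 * 2 ^ i.1 * L) (dil th i).
Proof.
move=> hL x y; rewrite /dil -mulrBr normrM ger0_norm ?exprz_ge0 ?sqrtr_ge0//.
rewrite -!mulrA ler_wpM2l ?exprz_ge0 ?sqrtr_ge0//.
apply: (le_trans (hL _ _)).
have -> : 2 ^ i.1 * x - i.2%:~R - (2 ^ i.1 * y - i.2%:~R) = 2 ^ i.1 * (x - y) by ring.
by rewrite normrM ger0_norm ?exprz_ge0// mulrCA.
Qed.

Lemma dil_lipschitz_sqr L (j : int) :
  (Num.sqrt 2 ^ j * 2 ^ j * L) ^+ 2 = (2 ^ j) ^+ 3 * L ^+ 2 :> R.
Proof.
have : (Num.sqrt 2 ^ j) ^+ 2 = 2 ^ j :> R.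
  by rewrite exprnP exprz_exp mulrC -exprz_exp -exprnP sqr_sqrtr.
move=> h; have -> : (Num.sqrt 2 ^ j * 2 ^ j * L) ^+ 2 = (Num.sqrt 2 ^ j) ^+ 2 * (2 ^ j) ^+ 2 * L ^+ 2.
  by rewrite !exprMn.
by rewrite h; ring.
Qed.

(** Both halves lie within [l / 2] of the midpoint [m], so each of the two integrals is
    [th m * (l / 2)] up to [L l^2 / 4]. *)
Lemma lipschitz_osc L th a l : 0 <= L -> lipschitz_with L th -> 0 < l ->
  `|Iab th (a + l / 2) (l / 2) - Iab th a (l / 2)| <= L * l ^+ 2 / 2.
Proof.
move=> L0 hL l0; have l20 : 0 < l / 2 by rewrite divr_gt0.
have ith : loc_int th by apply: loc_int_continuous; exact: lipschitz_continuous hL.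
have ic k : loc_int (fun _ : R => k) by apply: loc_int_continuous => x; exact: cvg_cst.
pose m := a + l / 2.
have bnd b : (forall x, b <= x <= b + l / 2 -> `|x - m| <= l / 2) ->
    `|Iab th b (l / 2) - th m * (l / 2)| <= L * l ^+ 2 / 4.
  move=> hb; have k x : b <= x <= b + l / 2 ->
      th m - L * (l / 2) <= th x <= th m + L * (l / 2).
    move=> /hb xm; have := hL x m.
    have : L * `|x - m| <= L * (l / 2) by rewrite ler_wpM2l.
    by move=> h1 /le_trans/(_ h1); rewrite ler_norml; lra.
  have u : Iab th b (l / 2) <= (th m + L * (l / 2)) * (l / 2).
    by rewrite -(Iab_cst _ b (ltW l20)); apply: Iab_le => // x /k/andP[].
  have v : (th m - L * (l / 2)) * (l / 2) <= Iab th b (l / 2).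
    by rewrite -(Iab_cst _ b (ltW l20)); apply: Iab_le => // x /k/andP[].
  by rewrite ler_norml; lra.
have h1 := bnd m; have h2 := bnd a.
have {}h1 : `|Iab th m (l / 2) - th m * (l / 2)| <= L * l ^+ 2 / 4.
  by apply: h1 => x h; rewrite ler_norml; lra.
have {}h2 : `|Iab th a (l / 2) - th m * (l / 2)| <= L * l ^+ 2 / 4.
  by apply: h2 => x; rewrite /m => h; rewrite ler_norml; lra.
move: h1 h2; rewrite !ler_norml -/m; lra.
Qed.

(** Centring kills constants, so [th] may be replaced by [th - th a], of size at most [L l] on the
    interval. This crude bound serves the leaves of the tree. *)
Lemma centered_base Q s w f L th a l : A2_pair Q s w -> loc_int f ->
  loc_int (fun x => f x ^+ 2 * w x) -> 0 <= L -> lipschitz_with L th -> 0 < l ->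
  (Iab (fun x => f x * th x) a l - Iab f a l * Iab th a l / l) ^+ 2 <=
  4 * L ^+ 2 * l ^+ 2 * (Iab s a l * Iab (fun x => f x ^+ 2 * w x) a l).
Proof.
move=> sw hf he L0 hL l0.
have cth : continuous th := lipschitz_continuous hL.
have ith : loc_int th by exact: loc_int_continuous.
have ic k : loc_int (fun _ : R => k) by apply: loc_int_continuous => x; exact: cvg_cst.
pose r x := th x - th a.
have cr : continuous r by move=> x; apply: cvgB; [exact: cth|exact: cvg_cst].
have ir : loc_int r by exact: loc_int_continuous.
have ifr : loc_int (fun x => f x * r x) by exact: loc_int_mul_continuous.
have rL x : a <= x <= a + l -> `|r x| <= L * l.
  move=> xal; apply: (le_trans (hL _ _)); rewrite ler_wpM2l// ler_norml; lra.
have e1 : Iab (fun x => f x * th x) a l = th a * Iab f a l + Iab (fun x => f x * r x) a l.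
  rewrite -IabZ// -IabD//; last exact: loc_intZ.
  by congr Iab; apply/funext => x; rewrite /r; ring.
have e2 : Iab th a l = th a * l + Iab r a l.
  rewrite -(Iab_cst (th a) a (ltW l0)) -IabD//.
  by congr Iab; apply/funext => x; rewrite /r addrC subrK.
have If0 : 0 <= Iab (fun x => `|f x|) a l by exact: Iab_ge0.
have b1 : `|Iab (fun x => f x * r x) a l| <= L * l * Iab (fun x => `|f x|) a l.
  apply: (le_trans (Iab_norm _ _ ifr)); rewrite -IabZ; last exact: loc_int_norm.
  apply: Iab_le; [exact: loc_int_norm|exact/loc_intZ/loc_int_norm|].
  by move=> x /rL rx; rewrite normrM mulrC ler_wpM2r.
have b2 : `|Iab r a l| <= L * l * l.
  apply: (le_trans (Iab_norm _ _ ir)); rewrite -(Iab_cst (L * l) a (ltW l0)).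
  by apply: Iab_le => //; exact: loc_int_norm.
have b3 := Iab_norm a l hf.
have -> : Iab (fun x => f x * th x) a l - Iab f a l * Iab th a l / l =
    Iab (fun x => f x * r x) a l - Iab f a l * Iab r a l / l.
  by rewrite e1 e2; field; rewrite gt_eqF.
have b4 : `|Iab f a l * Iab r a l / l| <= L * l * Iab (fun x => `|f x|) a l.
  rewrite !normrM normfV (gtr0_norm l0) ler_pdivrMr//.
  have -> : L * l * Iab (fun x => `|f x|) a l * l = Iab (fun x => `|f x|) a l * (L * l * l) by ring.
  by rewrite ler_pM.
have b5 : `|Iab (fun x => f x * r x) a l - Iab f a l * Iab r a l / l| <=
    2 * L * l * Iab (fun x => `|f x|) a l.
  by apply: (le_trans (ler_normB _ _)); lra.
rewrite -real_normK ?num_real//.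
have cs := weighted_CS a l hf (A2_s sw) he (A2_w0 sw) (A2_s0 sw) (A2_ws sw).
apply: (@le_trans _ _ ((2 * L * l * Iab (fun x => `|f x|) a l) ^+ 2)).
  by rewrite ler_pXn2r ?nnegrE// !mulr_ge0// ltW.
have -> : (2 * L * l * Iab (fun x => `|f x|) a l) ^+ 2 =
  4 * L ^+ 2 * l ^+ 2 * Iab (fun x => `|f x|) a l ^+ 2 by ring.
apply: ler_wpM2l; last by rewrite mulrC.
by rewrite mulr_ge0 ?sqr_ge0// mulr_ge0 ?sqr_ge0.
Qed.

Lemma sum_fiber_le (I J : eqType) (s : seq I) (nodes : seq J) (phi : I -> J) (h : J -> R) (c : nat) :
  (forall i, i \in s -> phi i \in nodes) -> (forall p, p \in nodes -> 0 <= h p) ->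
  (forall p, (count (fun i => phi i == p) s <= c)%N) ->
  \sum_(i <- s) h (phi i) <= c%:R * \sum_(p <- nodes) h p.
Proof.
move=> hs h0 hc; rewrite mulr_sumr.
apply: (@le_trans _ _ (\sum_(i <- s) \sum_(p <- nodes) h p *+ (phi i == p))).
  rewrite big_seq [leRHS]big_seq; apply: ler_sum => i /hs pin.
  rewrite (big_rem _ pin)/= eqxx mulr1n lerDl big_seq sumr_ge0// => p pr.
  by rewrite mulrn_wge0// h0// (mem_rem pr).
rewrite exchange_big/= big_seq [leRHS]big_seq; apply: ler_sum => p pn.
rewrite sumrMnr (_ : (\sum_(i <- s) (phi i == p))%N = count (fun i => phi i == p) s).
  by rewrite mulr_natl ler_wpMn2l ?h0.
by elim: {hs hc} s => [|i s' IH]; rewrite ?big_nil// big_cons /= IH.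
Qed.

Definition grid_nodes (N : nat) : seq (bool * nat * nat) :=
  [seq (bn, m) | bn <- [seq (b, n) | b <- [:: false; true], n <- iota 0 N.+1],
                 m <- iota 0 (2 ^ bn.2)].

Lemma mem_grid_nodes N (p : bool * nat * nat) :
  (p \in grid_nodes N) = (p.1.2 <= N)%N && (p.2 < 2 ^ p.1.2)%N.
Proof.
case: p => -[b n] m; apply/allpairsPdep/andP.
  move=> [[b' n'] [m' [/allpairsP[[b2 n2] [_ h1 e1]] h2 e2]]].
  by move: e1 e2 h1 h2 => [_ ->] [_ -> ->]; rewrite !mem_iota !add0n !ltnS.
move=> [nN mn]; exists (b, n), m; split => //.
  apply/allpairsP; exists (b, n); split => //; last by rewrite mem_iota.
  by rewrite !inE /=; case: (b).
by rewrite mem_iota.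
Qed.

Lemma sum_grid_nodes N (h : bool * nat * nat -> R) :
  \sum_(p <- grid_nodes N) h p =
  \sum_(b <- [:: false; true]) \sum_(n < N.+1) \sum_(m < 2 ^ n) h (b, nat_of_ord n, nat_of_ord m).
Proof.
rewrite /grid_nodes big_allpairs_dep big_allpairs_dep; apply: eq_bigr => b _.
rewrite -(big_mkord xpredT (fun n => \sum_(m < 2 ^ n) h (b, n, nat_of_ord m))).
rewrite /index_iota subn0; apply: eq_bigr => n _.
by rewrite -(big_mkord xpredT (fun m => h (b, n, m))) /index_iota subn0.
Qed.

Lemma wavelet_weighted_sum L Q th (t : nat) (s : seq (int * int)) ell N phi
  (sg w f : R -> R) E :
  0 <= L -> lipschitz_with L th -> 0 < ell ->
  (forall i, i \in s -> [/\ ((phi i).1.2 <= N)%N, ((phi i).2 < 2 ^ (phi i).1.2)%N,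
     node_length ell (phi i) * 2 ^ i.1 = 2 ^+ t &
     Iab (dil th i) (node_corner ell (phi i)) (node_length ell (phi i)) = 0]) ->
  (forall p, (count (fun i => phi i == p) s <= (2 ^ t).+1)%N) ->
  A2_pair Q sg w -> loc_int f -> loc_int (fun x => f x ^+ 2 * w x) ->
  (forall a l, 0 < l -> Iab (fun x => f x ^+ 2 * w x) a l <= E) ->
  \sum_(i <- s) Iab (fun x => f x * dil th i x) (node_corner ell (phi i)) (node_length ell (phi i)) ^+ 2 *
     (Iab w (node_corner ell (phi i)) (node_length ell (phi i)) / node_length ell (phi i))
  <= 8 * Q * L ^+ 2 * 2 ^+ (3 * t) * (2 ^ t).+1%:R * (2402 * Q ^+ 9) * E.
Proof.
move=> L0 hL ell0 hphi hc sw hf he hE.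
pose eI := Iab (fun x => f x ^+ 2 * w x).
pose U := tree_damped (Iab f) (Iab w) eI.
have Q1 := A2_const_ge1 sw.
have hfe a l : 0 < l -> Iab f a l ^+ 2 <= eI a l * Iab sg a l.
  move=> l0; apply: le_trans (weighted_CS a l hf (A2_s sw) he (A2_w0 sw) (A2_s0 sw) (A2_ws sw)).
  rewrite -[leLHS]real_normK ?num_real// ler_pXn2r ?nnegrE//; first exact: Iab_norm.
  exact: Iab_ge0.
pose nU (p : bool * nat * nat) := U (N - p.1.2)%N (node_corner ell p) (node_length ell p).
have nl0 p : 0 < node_length ell p by rewrite divr_gt0// exprn_gt0.
have hyp := (Iab_half hf, Iab_half (A2_s sw), Iab_half (A2_w sw), Iab_half he).
have U0 p : 0 <= nU p.
  exact: (tree_damped_ge0 (A2_s_gt0 sw) (A2_w_gt0 sw) hfe).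
have one i : i \in s ->
  Iab (fun x => f x * dil th i x) (node_corner ell (phi i)) (node_length ell (phi i)) ^+ 2 *
   (Iab w (node_corner ell (phi i)) (node_length ell (phi i)) / node_length ell (phi i))
   <= 4 * Q * L ^+ 2 * 2 ^+ (3 * t) * nU (phi i).
  move=> /hphi[_ _ h3 h4]; pose Li := Num.sqrt 2 ^ i.1 * 2 ^ i.1 * L.
  have Li0 : 0 <= Li by rewrite mulr_ge0// mulr_ge0// exprz_ge0// sqrtr_ge0.
  have hLi := dil_lipschitz i hL; have cdil := lipschitz_continuous hLi.
  have hfd := loc_int_mul_continuous hf cdil.
  have hosc a l : 0 < l -> `|Iab (dil th i) (a + l / 2) (l / 2) - Iab (dil th i) a (l / 2)| <=
      Li * l ^+ 2 / 2 by exact: lipschitz_osc.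
  have hbase a l : 0 < l -> centered (Iab f) (Iab (fun x => f x * dil th i x)) (Iab (dil th i)) a l ^+ 2 <=
      4 * Li ^+ 2 * l ^+ 2 * (Iab sg a l * eI a l).
    by move=> l0; apply: (centered_base a sw).
  have := pairing_bound (Iab_half hf) (Iab_half (A2_s sw))
    (A2_s_gt0 sw) (A2_w_gt0 sw) (A2_ge sw) (A2_le sw) hfe
    (Iab_half hfd) (Iab_half (loc_int_continuous cdil)) Li0 hosc hbase (N - (phi i).1.2)%N (nl0 _) h4.
  move=> h; apply: (le_trans h).
  rewrite le_eqVlt; apply/orP; left; apply/eqP; rewrite /nU /U.
  (* On the node [l * 2^j = 2^t], so the squared Lipschitz constant [2^(3 j) L^2] times [l^3] is
     [2^(3 t) L^2] at every scale. *)
  rewrite dil_lipschitz_sqr exprM.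
  have -> : (2 ^+ 3) ^+ t = (node_length ell (phi i) * 2 ^ i.1) ^+ 3 :> R.
    by rewrite h3 -!exprM mulnC.
  move: (2 ^ i.1) (tree_damped _ _ _ _ _ _) => p u; ring.
apply: (@le_trans _ _ (4 * Q * L ^+ 2 * 2 ^+ (3 * t) * \sum_(i <- s) nU (phi i))).
  by rewrite mulr_sumr big_seq [leRHS]big_seq; apply: ler_sum.
have C0 : 0 <= 4 * Q * L ^+ 2 * 2 ^+ (3 * t).
  apply: mulr_ge0; last exact: exprn_ge0.
  by apply: mulr_ge0 (sqr_ge0 _); apply: mulr_ge0 => //; exact: le_trans ler01 Q1.
(* One tree for each of the two grids. *)
have tot : \sum_(p <- grid_nodes N) nU p <= 2 * (2402 * Q ^+ 9 * E).
  have tb b : \sum_(n < N.+1) \sum_(m < 2 ^ n) nU (b, nat_of_ord n, nat_of_ord m) <= 2402 * Q ^+ 9 * E.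
    rewrite -(tree_total_nodes (Iab f) (Iab w) eI N (grid_corner ell b) ell).
    apply: (le_trans (tree_total_bound (Iab_half hf) (Iab_half (A2_s sw)) (Iab_half (A2_w sw))
       (Iab_half he) (A2_s_gt0 sw) (A2_w_gt0 sw) Q1 (A2_ge sw) (A2_le sw) hfe _ _ ell0)).
    apply: ler_wpM2l; last exact: hE.
    by apply: mulr_ge0; [exact: ler0n|apply: exprn_ge0; exact: le_trans ler01 Q1].
  rewrite sum_grid_nodes big_cons big_seq1; have := tb false; have := tb true.
  move: (2402 * Q ^+ 9 * E) => X; lra.
have := @sum_fiber_le _ _ s (grid_nodes N) phi nU (2 ^ t).+1 _ (fun p _ => U0 p) hc.
move=> /(_ _)/le_trans fib.
apply: (@le_trans _ _ (4 * Q * L ^+ 2 * 2 ^+ (3 * t) * ((2 ^ t).+1%:R * (2 * (2402 * Q ^+ 9 * E))))).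
  apply: ler_wpM2l => //; apply: fib; last by apply: ler_wpM2l.
  by move=> i /hphi[h1 h2 _ _]; rewrite mem_grid_nodes h1.
move: (2402 * Q ^+ 9) => X.
by rewrite le_eqVlt; apply/orP; left; apply/eqP; ring.
Qed.

End WeightedWaveletEstimate.

(** * Bilinear sums of complex wavelet coefficients *)

Section ComplexPairing.
Variable R : realType.
Local Notation C := (R[i]).
Local Notation mu := (@lebesgue_measure R).
Implicit Types (th w s : R -> R) (f g psi : R -> C) (L A Q a l E : R).

(** The vanishing mean is stated for all dilates and all intervals containing their supports, since
    this is how the nodes use it; the change of variables behind it is then made only once. *)
Definition bump L A th := [/\ 0 <= L, lipschitz_with L th,
  forall x, A < `|x| -> th x = 0 &
  forall i a l, (forall x, `|2 ^ i.1 * x - i.2%:~R| <= A -> a <= x <= a + l) ->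
    Iab (dil th i) a l = 0].

Lemma Rintegral_supported (h : R -> R) a l : (forall x, ~ (a <= x <= a + l) -> h x = 0) ->
  \int[mu]_x h x = Iab h a l.
Proof.
move=> h0; rewrite /Iab [RHS]Rintegral_mkcond; congr Rintegral; apply/funext => x.
rewrite /patch; case: ifPn => //; rewrite notin_setE/= in_itv/= => /h0 ->//.
Qed.

Lemma re_wav psi (i : int * int) x :
  complex.Re (wav psi i.1 i.2 x) = dil (fun y => complex.Re (psi y)) i x.
Proof. by rewrite /wav /dil; case: (psi _) => a b /=; rewrite mul0r subr0. Qed.

Lemma im_wav psi (i : int * int) x :
  complex.Im (wav psi i.1 i.2 x) = dil (fun y => complex.Im (psi y)) i x.
Proof. by rewrite /wav /dil; case: (psi _) => a b /=; rewrite mul0r addr0. Qed.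

Lemma re_mul_conj (z u : C) : complex.Re (z * Num.conj u) =
  complex.Re z * complex.Re u + complex.Im z * complex.Im u.
Proof. by case: z u => [a b] [c d] /=; rewrite mulrN opprK. Qed.

Lemma im_mul_conj (z u : C) : complex.Im (z * Num.conj u) =
  complex.Im z * complex.Re u - complex.Re z * complex.Im u.
Proof. by case: z u => [a b] [c d] /=; rewrite mulrN addrC. Qed.

Lemma normc_sqr (z : C) : Normc.normc z ^+ 2 = complex.Re z ^+ 2 + complex.Im z ^+ 2.
Proof. by case: z => a b /=; rewrite sqr_sqrtr// addr_ge0 ?sqr_ge0. Qed.

Lemma normc_ge0 (z : C) : 0 <= Normc.normc z.
Proof. by case: z => a b /=; exact: sqrtr_ge0. Qed.

Lemma ler_re_normc (z : C) : `|complex.Re z| <= Normc.normc z.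
Proof.
rewrite -(@ler_pXn2r _ 2) ?nnegrE ?normc_ge0// normc_sqr real_normK ?num_real//.
by rewrite lerDl sqr_ge0.
Qed.

Lemma ler_im_normc (z : C) : `|complex.Im z| <= Normc.normc z.
Proof.
rewrite -(@ler_pXn2r _ 2) ?nnegrE ?normc_ge0// normc_sqr real_normK ?num_real//.
by rewrite lerDr sqr_ge0.
Qed.

Definition cloc_int f := loc_int (fun x => complex.Re (f x)) /\ loc_int (fun x => complex.Im (f x)).

Section InnerParts.
Variables (psi f : R -> C) (A : R) (i : int * int) (a l : R).
Let thr x := complex.Re (psi x).
Let thi x := complex.Im (psi x).
Hypotheses (cr : continuous thr) (ci : continuous thi).
Hypotheses (r0 : forall x, A < `|x| -> thr x = 0) (i0 : forall x, A < `|x| -> thi x = 0).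
Hypothesis sup : forall x, `|2 ^ i.1 * x - i.2%:~R| <= A -> a <= x <= a + l.
Hypothesis cf : cloc_int f.

Lemma dil_continuous th : continuous th -> continuous (dil th i).
Proof.
move=> ct x; rewrite /dil; apply: cvgM; first exact: cvg_cst.
apply: continuous_comp; last exact: ct.
by apply: cvgB; [apply: cvgM; [exact: cvg_cst|exact: cvg_id]|exact: cvg_cst].
Qed.

Lemma dil_supported th x : (forall x, A < `|x| -> th x = 0) -> ~ (a <= x <= a + l) -> dil th i x = 0.
Proof.
by move=> th0 xal; rewrite /dil th0 ?mulr0// ltNge; apply/negP => /sup; exact: xal.
Qed.

Lemma re_inner_wav : complex.Re (inner f (wav psi i.1 i.2)) =
  Iab (fun x => complex.Re (f x) * dil thr i x) a l + Iab (fun x => complex.Im (f x) * dil thi i x) a l.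
Proof.
have [fr fi] := cf; have dr := dil_continuous cr; have di := dil_continuous ci.
rewrite /inner /= (@Rintegral_supported _ a l); last first.
  by move=> x xal; rewrite re_mul_conj re_wav im_wav !dil_supported// !mulr0 addr0.
rewrite -IabD; [|exact: loc_int_mul_continuous..].
by congr Iab; apply/funext => x; rewrite re_mul_conj re_wav im_wav.
Qed.

Lemma im_inner_wav : complex.Im (inner f (wav psi i.1 i.2)) =
  Iab (fun x => complex.Im (f x) * dil thr i x) a l - Iab (fun x => complex.Re (f x) * dil thi i x) a l.
Proof.
have [fr fi] := cf; have dr := dil_continuous cr; have di := dil_continuous ci.
rewrite /inner /= (@Rintegral_supported _ a l); last first.
  by move=> x xal; rewrite im_mul_conj re_wav im_wav !dil_supported// !mulr0 subr0.
rewrite -mulN1r -IabZ; last exact: loc_int_mul_continuous.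
rewrite -IabD; [|exact: loc_int_mul_continuous|apply: loc_intZ; exact: loc_int_mul_continuous].
by congr Iab; apply/funext => x; rewrite im_mul_conj re_wav im_wav mulN1r.
Qed.

Lemma inner_wav_sqr_le : Normc.normc (inner f (wav psi i.1 i.2)) ^+ 2 <= 2 *
   ((Iab (fun x => complex.Re (f x) * dil thr i x) a l ^+ 2 +
     Iab (fun x => complex.Im (f x) * dil thi i x) a l ^+ 2) +
    (Iab (fun x => complex.Im (f x) * dil thr i x) a l ^+ 2 +
     Iab (fun x => complex.Re (f x) * dil thi i x) a l ^+ 2)).
Proof.
rewrite normc_sqr re_inner_wav im_inner_wav.
move: (Iab _ a l) (Iab _ a l) (Iab _ a l) (Iab _ a l) => p q u v.
have := sqr_ge0 (p - q); have := sqr_ge0 (p + q).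
have := sqr_ge0 (u - v); have := sqr_ge0 (u + v); lra.
Qed.

End InnerParts.

Lemma wavelet_pairing_bound L A psi Q :
  0 < A -> bump L A (fun y => complex.Re (psi y)) -> bump L A (fun y => complex.Im (psi y)) ->
  exists2 K, 0 <= K & forall s w, A2_pair Q s w -> forall f g E E',
    cloc_int f -> cloc_int g ->
    loc_int (fun x => Normc.normc (f x) ^+ 2 * w x) ->
    loc_int (fun x => Normc.normc (g x) ^+ 2 * s x) ->
    (forall a l, 0 < l -> Iab (fun x => Normc.normc (f x) ^+ 2 * w x) a l <= E) ->
    (forall a l, 0 < l -> Iab (fun x => Normc.normc (g x) ^+ 2 * s x) a l <= E') ->
    forall I : seq (int * int), uniq I ->
    \sum_(i <- I) Normc.normc (inner f (wav psi i.1 i.2)) * Normc.normc (inner g (wav psi i.1 i.2))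
      <= K * (E + E').
Proof.
move=> A0 bre bim.
have [t tA] : exists t : nat, 6 * A <= 2 ^+ t.
  exists (Num.truncn (6 * A)).+1; apply: (le_trans (ltW (truncnS_gt _))).
  by rewrite -natrX ler_nat ltnW// ltn_expl.
pose K0 := 8 * Q * L ^+ 2 * 2 ^+ (3 * t) * (2 ^ t).+1%:R * (2402 * Q ^+ 9).
(* Each side costs [8 K0]: two parts of the function against two parts of [psi], doubled by
   [inner_wav_sqr_le]. The final inequality for [2 c c'] halves this. *)
exists (4 * `|K0|) => [|s w sw f g E E' cf cg hf hg hE hE' I uI].
  by rewrite mulr_ge0.
have [ell [N [phi [ell0 [hphi hc]]]]] := wavelet_nodes A0 tA uI.
pose ac i := node_corner ell (phi i); pose lc i := node_length ell (phi i).
have lc0 i : 0 < lc i by rewrite divr_gt0// exprn_gt0.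
have nodeok th : bump L A th -> forall i, i \in I -> [/\ ((phi i).1.2 <= N)%N,
     ((phi i).2 < 2 ^ (phi i).1.2)%N, node_length ell (phi i) * 2 ^ i.1 = 2 ^+ t &
     Iab (dil th i) (node_corner ell (phi i)) (node_length ell (phi i)) = 0].
  by move=> [_ _ _ b4] i /hphi[h1 h2 h3 h4]; split => //; exact: b4.
have one s' w' h F (part : C -> R) th : A2_pair Q s' w' -> cloc_int h ->
    (part = @complex.Re R \/ part = @complex.Im R) -> bump L A th ->
    loc_int (fun x => Normc.normc (h x) ^+ 2 * w' x) ->
    (forall a l, 0 < l -> Iab (fun x => Normc.normc (h x) ^+ 2 * w' x) a l <= F) ->
    \sum_(i <- I) Iab (fun x => part (h x) * dil th i x) (ac i) (lc i) ^+ 2 *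
     (Iab w' (ac i) (lc i) / lc i) <= K0 * F.
  move=> sw' [hr hi] hpart bth hw hF; have [L0 thL _ _] := bth.
  have part_le z : `|part z| <= Normc.normc z.
    by case: hpart => ->; [exact: ler_re_normc|exact: ler_im_normc].
  have hp : loc_int (fun x => part (h x)) by case: hpart => ->.
  have sq_le x : part (h x) ^+ 2 * w' x <= Normc.normc (h x) ^+ 2 * w' x.
    apply: ler_wpM2r; first exact: A2_w0 sw' x.
    rewrite -[leLHS]real_normK ?num_real// ler_pXn2r ?nnegrE// ?normc_ge0//.
  have hpw : loc_int (fun x => part (h x) ^+ 2 * w' x).
    apply: loc_int_le hw.
      apply: measurable_funM; last exact: loc_int_measurable (A2_w sw').
      by apply: measurable_funX; exact: loc_int_measurable.
    move=> x; rewrite !ger0_norm ?sq_le//.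
      by rewrite mulr_ge0 ?sqr_ge0// (A2_w0 sw').
    by rewrite mulr_ge0 ?sqr_ge0// (A2_w0 sw').
  have hpF a l : 0 < l -> Iab (fun x => part (h x) ^+ 2 * w' x) a l <= F.
    by move=> l0; apply: le_trans (hF a l l0); exact: Iab_le.
  exact: (wavelet_weighted_sum L0 thL ell0 (nodeok _ bth) hc sw' hp hpw hpF).
have side s' w' h F : A2_pair Q s' w' -> cloc_int h ->
    loc_int (fun x => Normc.normc (h x) ^+ 2 * w' x) ->
    (forall a l, 0 < l -> Iab (fun x => Normc.normc (h x) ^+ 2 * w' x) a l <= F) ->
    \sum_(i <- I) Normc.normc (inner h (wav psi i.1 i.2)) ^+ 2 * (Iab w' (ac i) (lc i) / lc i)
      <= 8 * K0 * F.
  move=> sw' ch hw hF.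
  have h1 := one s' w' h F _ _ sw' ch (or_introl erefl) bre hw hF.
  have h2 := one s' w' h F _ _ sw' ch (or_intror erefl) bim hw hF.
  have h3 := one s' w' h F _ _ sw' ch (or_intror erefl) bre hw hF.
  have h4 := one s' w' h F _ _ sw' ch (or_introl erefl) bim hw hF.
  apply: (@le_trans _ _ (2 * ((K0 * F + K0 * F) + (K0 * F + K0 * F)))); last first.
    by rewrite le_eqVlt; apply/orP; left; apply/eqP; ring.
  apply: le_trans (ler_wpM2l _ (lerD (lerD h1 h2) (lerD h3 h4))) => //.
  rewrite -!big_split/= mulr_sumr big_seq [leRHS]big_seq; apply: ler_sum => i iI.
  rewrite -!mulrDl mulrA; apply: ler_wpM2r.
    by rewrite divr_ge0 ?ltW// (A2_w_gt0 sw').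
  have [_ _ _ h5] := hphi i iI.
  have [_ lr zr _] := bre; have [_ li zi _] := bim.
  exact: (inner_wav_sqr_le (lipschitz_continuous lr) (lipschitz_continuous li) zr zi h5 ch).
have k1 := side s w f E sw cf hf hE.
have k2 := side w s g E' (A2_pair_sym sw) cg hg hE'.
apply: (@le_trans _ _ ((8 * K0 * E + 8 * K0 * E') / 2)); last first.
  have E0 : 0 <= E.
    apply: le_trans (hE 0 1 ltr01); apply: Iab_ge0 => x.
    by rewrite mulr_ge0 ?sqr_ge0// (A2_w0 sw).
  have E'0 : 0 <= E'.
    apply: le_trans (hE' 0 1 ltr01); apply: Iab_ge0 => x.
    by rewrite mulr_ge0 ?sqr_ge0// (A2_s0 sw).
  have := ler_norm K0; move: (K0) (`|K0|) => k k' kk.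
  have : (E + E') * k <= (E + E') * k' by rewrite ler_wpM2l// addr_ge0.
  lra.
rewrite ler_pdivlMr//; apply: le_trans (lerD k1 k2).
rewrite -big_split mulr_suml; apply: ler_sum => i _.
have := A2_ge sw (ac i) (lc0 i).
have := A2_w_gt0 sw (ac i) (lc0 i); have := A2_s_gt0 sw (ac i) (lc0 i).
move: (Iab s _ _) (Iab w _ _) => x y x0 y0; move: (lc i) (lc0 i) => l' l0 xy.
move: (Normc.normc (inner f _)) (Normc.normc (inner g _)) (normc_ge0 (inner f (wav psi i.1 i.2)))
  (normc_ge0 (inner g (wav psi i.1 i.2))) => c c' c0 c'0.
have X0 : 0 < x / l' by rewrite divr_gt0.
have Y0 : 0 < y / l' by rewrite divr_gt0.
(* The means [X] of [s] and [Y] of [w] have product at least 1, which yields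
   [2 c c' <= c^2 Y + c'^2 X] and separates the two functions. *)
have XY : 1 <= (x / l') * (y / l').
  by rewrite mulf_div ler_pdivlMr ?mulr_gt0// mul1r -expr2.
move: (x / l') (y / l') X0 Y0 XY => X Y X0 Y0 XY.
have k3 : (2 * (c * c')) ^+ 2 <= (c ^+ 2 * Y + c' ^+ 2 * X) ^+ 2.
  have h1 : (c * c') ^+ 2 <= (c * c') ^+ 2 * (X * Y) by rewrite ler_peMr// sqr_ge0.
  have := sqr_ge0 (c ^+ 2 * Y - c' ^+ 2 * X).
  have -> : (c ^+ 2 * Y - c' ^+ 2 * X) ^+ 2 = (c ^+ 2 * Y + c' ^+ 2 * X) ^+ 2 -
    4 * ((c * c') ^+ 2 * (X * Y)) by ring.
  have -> : (2 * (c * c')) ^+ 2 = 4 * (c * c') ^+ 2 by ring.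
  lra.
have P1 : 0 <= 2 * (c * c') by rewrite !mulr_ge0.
have P2 : 0 <= c ^+ 2 * Y + c' ^+ 2 * X.
  by rewrite addr_ge0// mulr_ge0 ?sqr_ge0 ?(ltW X0) ?(ltW Y0).
have k4 : 2 * (c * c') <= c ^+ 2 * Y + c' ^+ 2 * X by move: k3; rewrite ler_pXn2r ?nnegrE.
by apply: le_trans k4; rewrite mulrC.
Qed.

End ComplexPairing.

(** * Maximal operator and A_1 weights *)
Section RubioDeFrancia.
Variable R : realType.
Local Notation mu := (@lebesgue_measure R).
Implicit Types (f g : R -> \bar R).
Local Open Scope ereal_scope.

Lemma maximal_fun_ge f a b x : (a < b)%R -> (a <= x <= b)%R ->
  \int[mu]_(y in `[a, b]) f y <= (b - a)%:E * maximal_fun f x.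
Proof.
move=> ab xab; rewrite -lee_pdivrMl ?subr_gt0//.
by apply: ereal_sup_ubound; exists a, b.
Qed.

Lemma maximal_fun_ge0 f x : (forall y, 0 <= f y) -> 0 <= maximal_fun f x.
Proof.
move=> f0; apply: (@le_trans _ _ (((x + 1 - x)^-1)%:E * \int[mu]_(y in `[x, (x + 1)%R]) f y)).
  apply: mule_ge0; last exact: integral_ge0.
  by rewrite lee_fin invr_ge0; lra.
by apply: ereal_sup_ubound; exists x, (x + 1)%R; split => //; lra.
Qed.

(** Lower semicontinuity: an interval around [x] with mean above [t], slightly enlarged, contains
    all nearby points and still has mean above [t]. *)
Lemma maximal_fun_measurable f : nnmf f -> measurable_fun setT (maximal_fun f).
Proof.
move=> [mf f0]; apply: lower_semicontinuous_measurable => x t.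
have [t0|t0 tM] := ltP t 0%R.
  move=> _; exists setT; first exact: filterT.
  move=> y _; apply: lt_le_trans (maximal_fun_ge0 y f0).
  by rewrite lte_fin.
have /ereal_sup_gt[_ [a [b [ab xab ->]]]] := tM.
rewrite lte_pdivlMl ?subr_gt0// -EFinM => tI.
have [e e0 te] : exists2 e : R, (0 < e)%R &
    ((b - a + 2 * e) * t)%:E < \int[mu]_(y in `[a, b]) f y.
  move: tI (integral_ge0 mu (D := `[a, b]%classic) (fun x _ => f0 x)).
  case: (\int[mu]_(y in `[a, b]) f y) => [r| |//].
    (* This makes [2 e t] at most half of the slack [r - (b - a) t]; the [+ 1] covers [t = 0]. *)
    rewrite lte_fin => tr _; exists ((r - (b - a) * t) / (4 * (t + 1)))%R.
      by rewrite divr_gt0//; lra.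
    rewrite lte_fin mulrDl -ltrBrDl.
    have -> : (2 * ((r - (b - a) * t) / (4 * (t + 1))) * t =
      (r - (b - a) * t) * (t / (t + 1)) / 2)%R by field; lra.
    have h1 : (t / (t + 1) <= 1)%R by rewrite ler_pdivrMr; lra.
    have h2 : (0 < r - (b - a) * t)%R by lra.
    have := ler_wpM2l (ltW h2) h1; lra.
  by move=> _ _; exists 1%R => //; rewrite ltey.
exists (ball x e); first exact: nbhsx_ballx.
move=> y; rewrite /ball/= ltr_norml => xy.
apply: (@lt_le_trans _ _ (((b + e - (a - e))^-1)%:E * \int[mu]_(z in `[(a - e)%R, (b + e)%R]) f z)).
  rewrite lte_pdivlMl; last lra.
  rewrite -EFinM; have -> : (b + e - (a - e) = b - a + 2 * e)%R by ring.
  apply: (lt_le_trans te); apply: ge0_subset_integral => //.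
    exact: measurable_funS mf.
  by apply: subset_itv; rewrite bnd_simp; lra.
by apply: ereal_sup_ubound; exists (a - e)%R, (b + e)%R; split => //; lra.
Qed.

Lemma nnmf_maximal f : nnmf f -> nnmf (maximal_fun f).
Proof.
by move=> nf; split; [exact: maximal_fun_measurable|move=> x; apply: maximal_fun_ge0; case: nf].
Qed.

Lemma maximal_fun_ae_eq f g : nnmf f -> nnmf g -> {ae mu, forall x, f x = g x} ->
  maximal_fun f = maximal_fun g.
Proof.
move=> [mf f0] [mg g0] fg; apply/funext => x; rewrite /maximal_fun; congr ereal_sup.
have E a b : \int[mu]_(y in `[a, b]) f y = \int[mu]_(y in `[a, b]) g y.
  apply: ge0_ae_eq_integral => //; [exact: measurable_funS mf|exact: measurable_funS mg|].
  by apply: ae_imp fg.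
apply/seteqP; split => v [a [b [h1 h2 ->]]]; exists a, b; split => //; by rewrite E.
Qed.

(* The part of the properties of a Banach function norm that passes to the associate norm. *)
Record sublinear_norm (N : (R -> \bar R) -> \bar R) : Prop := {
  sn_ge0 : forall f, nnmf f -> 0 <= N f ;
  sn_le : forall f g, nnmf f -> nnmf g -> {ae mu, forall x, g x <= f x} -> N g <= N f ;
  sn_homog : forall f (a : R), nnmf f -> (0 <= a)%R -> N (fun x => a%:E * f x) <= a%:E * N f ;
  sn_series : forall fn : nat -> R -> \bar R, (forall n, nnmf (fn n)) ->
    N (fun x => \sum_(n <oo) fn n x) <= \sum_(n <oo) N (fn n) ;
  sn_loc : forall f a b, nnmf f -> N f < +oo -> \int[mu]_(x in `[a, b]) f x < +oo }.

Lemma nnmf_series (fn : nat -> R -> \bar R) : (forall n, nnmf (fn n)) ->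
  nnmf (fun x => \sum_(n <oo) fn n x).
Proof.
move=> h; split; last by move=> x; apply: nneseries_ge0 => n _ _; case: (h n).
by apply: ge0_emeasurable_sum => [n x _ _|n _]; case: (h n).
Qed.

Lemma nnmfZ f (a : R) : nnmf f -> (0 <= a)%R -> nnmf (fun x => a%:E * f x).
Proof.
move=> [mf f0] a0; split; first exact: measurable_funeM.
by move=> x; rewrite mule_ge0.
Qed.

Lemma nnmfD f g : nnmf f -> nnmf g -> nnmf (fun x => f x + g x).
Proof.
move=> [mf f0] [mg g0]; split; first exact: emeasurable_funD.
by move=> x; rewrite adde_ge0.
Qed.

Lemma sn_finite_ae N f : sublinear_norm N -> nnmf f -> N f < +oo ->
  {ae mu, forall x, f x \is a fin_num}.
Proof.
move=> sN nf Nf; have [mf f0] := nf.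
have h (n : nat) : {ae mu, forall x, [set` `[(- n%:R : R)%R, (n%:R : R)%R]] x -> f x \is a fin_num}.
  apply: integrable_ae => //; apply/integrableP; split; first exact: measurable_funS mf.
  apply: le_lt_trans (sn_loc sN (- (n%:R : R))%R (n%:R : R)%R nf Nf).
  by rewrite le_eqVlt; apply/orP; left; apply/eqP/eq_integral => x _; rewrite gee0_abs.
have := @ae_foralln _ _ _ mu _ h.
apply: ae_imp => x hx; apply: (hx (Num.truncn `|x|%R).+1) => /=.
by rewrite in_itv/= -ler_norml ltW// truncnS_gt.
Qed.

(** [maximal_bounded] speaks of finite complex functions. An extended [f] of finite norm is finite
    almost everywhere, and the maximal function ignores null sets, so [fine \o f] can stand for it.
    A positive constant is needed to divide by in the iteration. *)
Lemma maximal_bounded_nnmf N : sublinear_norm N -> maximal_bounded N ->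
  exists2 K : R, (0 < K)%R & forall f, nnmf f -> N f < +oo ->
    N (maximal_fun f) <= K%:E * N f.
Proof.
move=> sN [K hK]; exists (`|K| + 1)%R => [|f nf Nf]; first by rewrite ltr_wpDl.
have [mf f0] := nf.
pose h x : R[i] := Complex (fine (f x)) 0%R.
have mfin : measurable_fun setT (fine \o f) by apply: measurableT_comp.
have hE x : f x \is a fin_num -> cabs h x = f x.
  move=> fx; rewrite /cabs /= expr0n/= addr0 sqrtr_sqr ger0_norm ?fineK//.
  exact: fine_ge0.
have nh : nnmf (cabs h).
  split => [|x]; last by rewrite /cabs lee_fin normc_ge0.
  have -> : cabs h = EFin \o (fine \o f).
    apply/funext => x; rewrite /cabs /= expr0n/= addr0 sqrtr_sqr ger0_norm//.
    exact: fine_ge0.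
  exact/measurable_EFinP.
have aeE : {ae mu, forall x, cabs h x = f x}.
  by apply: ae_imp (sn_finite_ae sN nf Nf) => x /hE.
have aeE' : {ae mu, forall x, f x = cabs h x} by apply: ae_imp aeE => x ->.
have NE : N (cabs h) = N f.
  apply/eqP; rewrite eq_le; apply/andP; split; apply: sn_le => //.
    by apply: ae_imp aeE => x ->.
  by apply: ae_imp aeE => x ->.
have hX : inX N h.
  split; last by rewrite NE.
  by split => //=; exact: measurable_cst.
have := hK h hX; rewrite (maximal_fun_ae_eq nh nf aeE) NE => /le_trans; apply.
apply: lee_wpmul2r; first exact: sn_ge0.
by rewrite lee_fin (le_trans (ler_norm K))// lerDl.
Qed.

(** [F] is the sum of [M^k f / (2 K)^k]. The [k]-th term has norm at most [2^-k] times that of [f],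
    and averaging [F] shifts the series by one index at the price of [2 K]. *)
Lemma rubio_de_francia N (K : R) : sublinear_norm N -> (0 < K)%R ->
  (forall f, nnmf f -> N f < +oo -> N (maximal_fun f) <= K%:E * N f) ->
  forall f, nnmf f -> N f < +oo -> exists F, [/\ nnmf F, forall x, f x <= F x,
    N F <= 2%:E * N f &
    forall a b x, (a < b)%R -> (a <= x <= b)%R ->
      \int[mu]_(y in `[a, b]) F y <= (2 * K * (b - a))%:E * F x].
Proof.
move=> sN K0 hK f nf Nf.
pose Rk k := iter k (@maximal_fun R) f.
have nRk k : nnmf (Rk k) by elim: k => [//|k IH]; exact: nnmf_maximal.
have NRk k : N (Rk k) <= (K ^+ k)%:E * N f /\ N (Rk k) < +oo.
  elim: k => [|k [IH1 IH2]]; first by rewrite /= expr0 mul1e.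
  have h : N (Rk k.+1) <= (K ^+ k.+1)%:E * N f.
    apply: (le_trans (hK _ (nRk k) IH2)); rewrite exprS EFinM -muleA.
    by apply: lee_wpmul2l => //; rewrite lee_fin ltW.
  split => //; apply: (le_lt_trans h); rewrite lte_mul_pinfty// ?lee_fin ?exprn_ge0 ?ltW//.
pose c k : R := (((2 * K) ^+ k)^-1)%R.
have c0 k : (0 <= c k)%R by rewrite invr_ge0 exprn_ge0// mulr_ge0// ltW.
pose F x := \sum_(k <oo) (c k)%:E * Rk k x.
have ncR k : nnmf (fun x => (c k)%:E * Rk k x) by exact: nnmfZ.
have t0 x k : 0 <= (c k)%:E * Rk k x by case: (ncR k).
have nF : nnmf F := nnmf_series ncR.
exists F; split => //.
- move=> x; rewrite /F nneseries_recl//.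
  rewrite /c expr0 invr1 mul1e /= leeDl//; apply: nneseries_ge0 => n _ _; exact: t0.
- apply: (le_trans (sn_series sN ncR)).
  have Nf0 := sn_ge0 sN nf.
  have Nfin : N f \is a fin_num by rewrite ge0_fin_numE.
  apply: (@le_trans _ _ (\sum_(k <oo) ((2 * fine (N f)) / (2 ^ k.+1)%:R)%:E)).
    apply: lee_nneseries => [k _ _|k _]; first exact: sn_ge0.
    apply: (le_trans (sn_homog sN (nRk k) (c0 k))).
    apply: (@le_trans _ _ ((c k)%:E * ((K ^+ k)%:E * N f))).
      by apply: lee_wpmul2l; [rewrite lee_fin|case: (NRk k)].
    rewrite -{1}(fineK Nfin) -!EFinM lee_fin /c exprMn natrX exprS.
    rewrite le_eqVlt; apply/orP; left; apply/eqP; field.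
    by rewrite !expf_neq0// gt_eqF.
  apply: (le_trans (epsilon_trick0 _ _)).
    by rewrite mulr_ge0// fine_ge0.
  by rewrite EFinM fineK.
- move=> a b x ab xab.
  have ba0 : (0 < b - a)%R by rewrite subr_gt0.
  rewrite /F integral_nneseries//; last by move=> k; apply: measurable_funS (ncR k).1.
  apply: (@le_trans _ _ (\sum_(k <oo) (2 * K * (b - a))%:E * ((c k.+1)%:E * Rk k.+1 x))).
    apply: lee_nneseries => [k _ _|k _]; first by apply: integral_ge0 => y _; exact: t0.
    rewrite ge0_integralZl ?lee_fin//; last 2 first.
    - exact: measurable_funS (nRk k).1.
    - by move=> y _; case: (nRk k).
    apply: (@le_trans _ _ ((c k)%:E * ((b - a)%:E * Rk k.+1 x))).
      by apply: lee_wpmul2l; [rewrite lee_fin|exact: maximal_fun_ge].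
    rewrite !muleA -!EFinM; apply: lee_wpmul2r; first by case: (nRk k.+1).
    rewrite lee_fin le_eqVlt; apply/orP; left; apply/eqP; rewrite /c exprS; field.
    by rewrite expf_neq0 ?gt_eqF// mulr_gt0.
  rewrite nneseriesZl; last by move=> k _; exact: t0.
  apply: lee_wpmul2l; first by rewrite lee_fin !mulr_ge0// ltW.
  rewrite [leRHS]nneseries_recl//.
  have := @nneseries_addn _ (fun k => (c k)%:E * Rk k x) 1 (t0 x).
  under eq_eseriesr => k _ do rewrite addn1.
  by move=> ->; rewrite leeDr.
Qed.

End RubioDeFrancia.

(** * Banach function norms and their associate norms *)

Section FunctionNorms.
Variable R : realType.
Local Notation C := (R[i]).
Local Notation mu := (@lebesgue_measure R).
Variable rho : (R -> \bar R) -> \bar R.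
Hypothesis bfn : banach_function_norm rho.
Local Notation rho' := (assoc_norm rho).

(** Countable subadditivity is the Fatou property of the partial sums. *)
Lemma bfn_sublinear : sublinear_norm rho.
Proof.
split.
- exact: bfn_ge0.
- exact: bfn_lattice.
- by move=> f a nf a0; rewrite (bfn_homog bfn).
- move=> fn nfn.
  pose S n x := (\sum_(0 <= k < n) fn k x)%E.
  have nS n : nnmf (S n).
    split; first by apply: emeasurable_sum => k; case: (nfn k).
    by move=> x; apply: sume_ge0 => k _; case: (nfn k).
  have rS n : (rho (S n) <= \sum_(0 <= k < n) rho (fn k))%E.
    elim: n => [|n IH].
      rewrite big_geq// (_ : rho (S 0%N) = 0%E)//; apply/(bfn_eq0 bfn) => //.
      by apply: ae_all => x; rewrite /S big_geq.
    rewrite big_nat_recr//= (_ : S n.+1 = fun x => (S n x + fn n x)%E).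
      by apply: (le_trans (bfn_subadd bfn (nS n) (nfn n))); rewrite leeD2r.
    by apply/funext => x; rewrite /S big_nat_recr.
  have nF := nnmf_series nfn.
  have [] := bfn_fatou bfn nS nF.
    apply: ae_all => x; split.
      by move=> m n mn; apply: lee_sum_nneg_natr => // k _ _; case: (nfn k).
    by apply: is_cvg_nneseries => k _ _; case: (nfn k).
  move=> _ cvS; rewrite -(cvg_lim _ cvS)//; apply: lime_le.
    by apply/cvg_ex; exists (rho (fun x => \sum_(n <oo) fn n x)%E).
  apply: nearW => n; apply: (le_trans (rS n)).
  by apply: nneseries_lim_ge => k _ _; exact: bfn_ge0.
- move=> f a b nf rf; have [||CE hCE] := bfn_loc bfn (E := `[a, b]%classic) => //.
    by rewrite lebesgue_measure_itv/=; case: ifP => _; rewrite ltry.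
  apply: (le_lt_trans (hCE f nf)); have := bfn_ge0 bfn nf.
  by move: rf; case: (rho f) => // r _ _; rewrite -EFinM ltry.
Qed.

Lemma nnmf_indic (E : set R) : measurable E -> nnmf (fun x => (\1_E x)%:E).
Proof.
move=> mE; split; last by move=> x; rewrite lee_fin indicE.
exact/measurable_EFinP/measurable_indic.
Qed.

Lemma indic_itv_finite (a b : R) : (rho (fun x => (\1_`[a, b] x)%:E) < +oo)%E.
Proof.
apply: (bfn_indic bfn) => //.
by rewrite lebesgue_measure_itv/=; case: ifP => _; rewrite ltry.
Qed.

Lemma assoc_norm_ubound f g : nnmf f -> (rho f <= 1)%E ->
  (\int[mu]_x (f x * g x) <= rho' g)%E.
Proof. by move=> nf rf; apply: ereal_sup_ubound; exists f. Qed.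

Lemma assoc_norm_ge0 g : (0 <= rho' g)%E.
Proof.
have n0 : nnmf (fun _ : R => 0%:E) by split => //; exact: measurable_cst.
apply: le_trans (assoc_norm_ubound g n0 _).
  by rewrite integral0_eq// => x _; rewrite mul0e.
rewrite (_ : rho _ = 0%E)//; apply/(bfn_eq0 bfn) => //; exact: ae_all.
Qed.

Lemma hoelder_assoc f g : nnmf f -> nnmf g -> (rho f < +oo)%E ->
  (\int[mu]_x (f x * g x) <= rho f * rho' g)%E.
Proof.
move=> nf ng rf; have [mf f0] := nf; have [mg g0] := ng.
have r0 := bfn_ge0 bfn nf.
(* A function of norm 0 cannot be normalized. It vanishes almost everywhere, and the bound
   [0 * rho' g] is 0 even if [rho' g] is infinite. *)
have [rE|rN] := eqVneq (rho f) 0%E.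
  rewrite rE mul0e; have fae := (bfn_eq0 bfn nf).1 rE.
  rewrite le_eqVlt; apply/orP; left; apply/eqP.
  rewrite -[RHS](integral0 mu setT); apply: ae_eq_integral => //.
    exact: emeasurable_funM.
  by apply: ae_imp fae => x fx _; rewrite fx mul0e.
have rfin : rho f \is a fin_num by rewrite ge0_fin_numE.
have rp : 0 < fine (rho f) by rewrite fine_gt0// rf andbT lt_def rN.
pose c := (fine (rho f))^-1; have c0 : 0 <= c by rewrite invr_ge0 ltW.
have h := assoc_norm_ubound g (nnmfZ nf c0) _.
rewrite (bfn_homog bfn)// -{1}(fineK rfin) -EFinM mulVf ?gt_eqF// in h.
have {}h := h (lexx _).
rewrite -(fineK rfin) -lee_pdivrMl//.
apply: le_trans h; rewrite -ge0_integralZl//.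
- by apply: ge0_le_integral => //; [move=> x _; rewrite !mule_ge0|
   apply: measurable_funeM; exact: emeasurable_funM|
   apply: emeasurable_funM => //; exact: measurable_funeM|
   move=> x _; rewrite muleA].
- exact: emeasurable_funM.
- by move=> x _; rewrite mule_ge0.
Qed.

(** The case [a = +oo] matters: the test functions in [assoc_norm] may take this value. *)
Lemma nneseries_mule (u : nat -> \bar R) (a : \bar R) : (0 <= a)%E -> (forall n, (0 <= u n)%E) ->
  (\sum_(n <oo) a * u n = a * \sum_(n <oo) u n)%E.
Proof.
move=> a0 u0; case: a a0 => [r r0|_|//]; first exact: nneseriesZl.
have [u00|/existsNP[n un]] := pselect (forall n, u n = 0%E).
  rewrite [X in (_ = _ * X)%E]eseries0; last by move=> n _ _; exact: u00.
  by rewrite mule0 eseries0// => n _ _; rewrite u00 mule0.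
have unp : (0 < u n)%E by rewrite lt_def u0 andbT; apply/eqP.
have Sp : (0 < \sum_(n <oo) u n)%E.
  apply: (lt_le_trans unp); rewrite (nneseriesD1 (n := n))// leeDl//.
  exact: nneseries_ge0.
rewrite gt0_mulye//; apply/eqP; rewrite -leye_eq (nneseriesD1 (n := n))//; last first.
  by move=> k _; rewrite mule_ge0.
rewrite gt0_mulye// leeDl//; apply: nneseries_ge0 => k _ _; exact: mule_ge0.
Qed.

Lemma assoc_sublinear : sublinear_norm rho'.
Proof.
split.
- by move=> f _; exact: assoc_norm_ge0.
- move=> f g nf ng gf; apply: ge_ereal_sup => _ [h [nh rh] <-].
  apply: le_trans (assoc_norm_ubound f nh rh).
  have [mh h0] := nh; have [mf f0] := nf; have [mg g0] := ng.
  apply: ae_ge0_le_integral => //; try exact: emeasurable_funM.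
  + by move=> x _; rewrite mule_ge0.
  + by move=> x _; rewrite mule_ge0.
  + by apply: ae_imp gf => x gfx _; rewrite lee_wpmul2l.
- move=> f a nf a0; apply: ge_ereal_sup => _ [h [nh rh] <-].
  have [mh h0] := nh; have [mf f0] := nf.
  rewrite (_ : (fun x => h x * (a%:E * f x))%E = (fun x => a%:E * (h x * f x))%E); last first.
    by apply/funext => x; rewrite muleCA.
  rewrite ge0_integralZl//.
  + by apply: lee_wpmul2l; rewrite ?lee_fin//; exact: assoc_norm_ubound.
  + exact: emeasurable_funM.
  + by move=> x _; rewrite mule_ge0.
- move=> fn nfn; apply: ge_ereal_sup => _ [h [nh rh] <-].
  have [mh h0] := nh.
  rewrite (_ : (fun x => h x * \sum_(n <oo) fn n x)%E =
     (fun x => \sum_(n <oo) (h x * fn n x))%E); last first.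
    by apply/funext => x; rewrite nneseries_mule// => n; case: (nfn n).
  rewrite integral_nneseries//.
  + apply: lee_nneseries => [k _ _|k _]; last exact: assoc_norm_ubound.
    by apply: integral_ge0 => x _; rewrite mule_ge0//; case: (nfn k).
  + by move=> k; apply: emeasurable_funM => //; case: (nfn k).
  + by move=> k x _; rewrite mule_ge0//; case: (nfn k).
- move=> g a b ng rg; have [mg g0] := ng.
  have ni := nnmf_indic (E := `[a, b]%classic) (measurable_itv _).
  apply: (@le_lt_trans _ _ (rho (fun x => (\1_`[a, b] x)%:E) * rho' g)%E).
    apply: le_trans (hoelder_assoc ni ng (indic_itv_finite a b)).
    rewrite integral_mkcond; apply: ge0_le_integral => //.
    + by move=> x _; rewrite /patch; case: ifP.
    + by apply/(measurable_restrictT _ _).1 => //; exact: measurable_funS mg.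
    + by apply: emeasurable_funM => //; case: ni.
    + move=> x _; rewrite /patch indicE; case: ifP => _; rewrite ?mul1e//.
      by rewrite mul0e.
  apply: lte_mul_pinfty => //; first exact: bfn_ge0.
  by rewrite ge0_fin_numE ?indic_itv_finite//; exact: bfn_ge0.
Qed.

End FunctionNorms.

(** * A_2 weights from A_1 majorants of a dual pair *)

Section DominatingWeights.
Variable R : realType.
Local Notation C := (R[i]).
Local Notation mu := (@lebesgue_measure R).

Lemma measurable_funV_ge0 (h : R -> R) : measurable_fun setT h -> (forall x, 0 <= h x) ->
  measurable_fun setT (fun x => (h x)^-1).
Proof.
move=> mh h0; have -> : (fun x => (h x)^-1) = (@powR R ^~ (-1)) \o h.
  by apply/funext => x /=; rewrite powR_inv1.
by apply: measurableT_comp => //; exact: measurable_powR.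
Qed.

Lemma cabs_measurable (f : R -> C) : cmeasurable f ->
  measurable_fun setT (fun x => Normc.normc (f x)).
Proof.
move=> [mr mi].
have -> : (fun x => Normc.normc (f x)) =
  (fun x => Num.sqrt (complex.Re (f x) ^+ 2 + complex.Im (f x) ^+ 2)).
  by apply/funext => x; case: (f x).
apply: measurableT_comp => //.
  by apply: continuous_measurable_fun; exact: sqrt_continuous.
by apply: measurable_funD; exact: measurable_funX.
Qed.

Lemma nnmf_cabs (f : R -> C) : cmeasurable f -> nnmf (cabs f).
Proof.
move=> mf; split; last by move=> x; rewrite lee_fin normc_ge0.
by rewrite /cabs; apply/measurable_EFinP; exact: cabs_measurable.
Qed.

Lemma nnmf_fine_loc_int (F : R -> \bar R) : nnmf F ->
  (forall a b, (\int[mu]_(x in `[a, b]) F x < +oo)%E) -> loc_int (fun x => fine (F x)).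
Proof.
move=> [mF F0] hF a b; apply/integrableP; split.
  by apply/measurable_EFinP; apply: measurableT_comp => //; exact: measurable_funS mF.
apply: le_lt_trans (hF a b); apply: ge0_le_integral => //.
- do 2 apply: measurableT_comp => //.
  by apply: measurableT_comp => //; exact: measurable_funS mF.
- exact: measurable_funS mF.
- move=> x _ /=; rewrite ger0_norm ?fine_ge0//.
  by case: (F x) (F0 x) => [r _|_|//] //=; rewrite leey.
Qed.

Lemma sn_loc_int (N : (R -> \bar R) -> \bar R) f : sublinear_norm N -> inX N f ->
  loc_int (fun x => Normc.normc (f x)).
Proof.
move=> sN [mf Nf]; have nf := nnmf_cabs mf.
by apply: (@nnmf_fine_loc_int (cabs f)) => // a b; exact: (sn_loc sN).
Qed.

Lemma sn_cloc_int (N : (R -> \bar R) -> \bar R) f : sublinear_norm N -> inX N f -> cloc_int f.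
Proof.
move=> sN fX; have hl := sn_loc_int sN fX; have [[mr mi] _] := fX; split.
  by apply: loc_int_le hl => // x; rewrite [leRHS]ger0_norm ?normc_ge0// ler_re_normc.
by apply: loc_int_le hl => // x; rewrite [leRHS]ger0_norm ?normc_ge0// ler_im_normc.
Qed.

(** [A1_low] makes the reciprocal locally bounded, hence the quotient of two such weights locally
    integrable. *)
Record A1_weight (K : R) (F : R -> \bar R) : Prop := {
  A1_nnmf : nnmf F;
  A1_loc : forall a b, (\int[mu]_(x in `[a, b]) F x < +oo)%E;
  A1_fin : {ae mu, forall x, F x \is a fin_num};
  A1_low : forall a l, exists2 c : R, 0 < c & forall x, a <= x <= a + l -> (c%:E <= F x)%E;
  A1_le : forall a b x, a < b -> a <= x <= b ->
    (\int[mu]_(y in `[a, b]) F y <= (K * (b - a))%:E * F x)%E }.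

Lemma A1_fine_bound K F a l : 0 < K -> A1_weight K F -> 0 < l -> 0 < Iab (fun x => fine (F x)) a l /\
  {ae mu, forall x, a <= x <= a + l -> Iab (fun x => fine (F x)) a l <= K * l * fine (F x)}.
Proof.
move=> K0 [nF hF Ffin Flow FK] l0; have [mF F0] := nF.
have lF := nnmf_fine_loc_int nF hF.
have IE : (Iab (fun x => fine (F x)) a l)%:E = (\int[mu]_(x in `[a, (a + l)%R]) F x)%E.
  rewrite /Iab /Rintegral fineK; last exact: integrable_fin_num (lF _ _).
  apply: ge0_ae_eq_integral => //.
  - exact: measurable_int (lF _ _).
  - exact: measurable_funS mF.
  - by move=> x _; rewrite lee_fin fine_ge0.
  - by apply: ae_imp Ffin => x fx _; rewrite fineK.
split.
  have [c c0 hc] := Flow a l.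
  apply: (@lt_le_trans _ _ (c * l)); first by rewrite mulr_gt0.
  rewrite -lee_fin IE -(Iab_cst c a (ltW l0)).
  have ic : loc_int (fun _ : R => c) by apply: loc_int_continuous => x; exact: cvg_cst.
  rewrite /Iab /Rintegral fineK; last exact: integrable_fin_num (ic _ _).
  apply: ge0_le_integral => //.
  - by move=> x _; rewrite lee_fin ltW.
  - exact: measurable_funS mF.
apply: ae_imp Ffin => x fx xal; rewrite -lee_fin IE EFinM fineK//.
have e : a + l - a = l by ring.
by have := FK a (a + l) x; rewrite ltrDl e; apply.
Qed.

(** On an interval [1 / G] is almost everywhere at most [K' l] over the integral of [G], so the
    integral of [F / G] is at most [K' l] times the quotient of the integrals. In the product with
    the symmetric bound the integrals cancel. This is the elementary direction of the factorization
    of A_2 weights. *)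
Lemma A1_pair K K' F G : 0 < K -> 0 < K' -> A1_weight K F -> A1_weight K' G ->
  A2_pair (K * K') (fun x => fine (F x) / fine (G x)) (fun x => fine (G x) / fine (F x)).
Proof.
move=> K0 K'0 wF wG.
have [nF hF Ffin Flow _] := wF; have [nG hG Gfin Glow _] := wG.
have [mF F0] := nF; have [mG G0] := nG.
have mfF : measurable_fun setT (fun x => fine (F x)) by exact: measurableT_comp.
have mfG : measurable_fun setT (fun x => fine (G x)) by exact: measurableT_comp.
have quot H H' : nnmf H -> nnmf H' -> (forall a b, (\int[mu]_(x in `[a, b]) H x < +oo)%E) ->
    (forall a l, exists2 c : R, 0 < c & forall x, a <= x <= a + l -> (c%:E <= H' x)%E) ->
    loc_int (fun x => fine (H x) / fine (H' x)).
  move=> nH nH' hH lowH' a b; have [mH H0] := nH; have [mH' H'0] := nH'.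
  have [c c0 hc] := lowH' a (b - a).
  have lH := loc_intZ c^-1 (nnmf_fine_loc_int nH hH).
  apply: le_integrable (lH a b) => //.
    apply/measurable_EFinP; apply: (@measurable_funS _ _ _ _ setT) => //.
    apply: measurable_funM; first exact: measurableT_comp.
    by apply: measurable_funV_ge0 => [|x]; [exact: measurableT_comp|rewrite fine_ge0].
  move=> x; rewrite /= in_itv/= => xab.
  have c'0 : 0 <= c^-1 by rewrite invr_ge0 ltW.
  have p1 : 0 <= fine (H x) / fine (H' x) by rewrite divr_ge0 ?fine_ge0.
  have p2 : 0 <= c^-1 * fine (H x) by rewrite mulr_ge0 ?fine_ge0.
  rewrite lee_fin (ger0_norm p1) (ger0_norm p2) mulrC; apply: ler_wpM2r; first exact: fine_ge0.
  have := hc x; rewrite subrKC => /(_ xab).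
  (* [fine +oo = 0] and [0^-1 = 0], so an infinite value of [H' x] is harmless. *)
  case: (H' x) => [r|_|//]; last by rewrite invr0 invr_ge0 ltW.
  by rewrite lee_fin => cr; rewrite lef_pV2// posrE//; exact: lt_le_trans cr.
have pos H : nnmf H -> {ae mu, forall x, H x \is a fin_num} ->
    (forall a l, exists2 c : R, 0 < c & forall x, a <= x <= a + l -> (c%:E <= H x)%E) ->
    {ae mu, forall x, 0 < fine (H x)}.
  move=> nH Hfin lowH; apply: ae_imp Hfin => x Hx.
  have [c c0 hc] := lowH x 0; rewrite (lt_le_trans c0)// -lee_fin fineK// hc//; lra.
split.
- exact: quot.
- exact: quot.
- by move=> x; rewrite divr_ge0 ?fine_ge0.
- by move=> x; rewrite divr_ge0 ?fine_ge0.
- apply: ae_imp2 (pos _ nF Ffin Flow) (pos _ nG Gfin Glow) => x p q.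
  by field; rewrite !gt_eqF.
- move=> a l l0.
  have [IF aeF] := A1_fine_bound a K0 wF l0.
  have [IG aeG] := A1_fine_bound a K'0 wG l0.
  have half H H' k : 0 < k -> nnmf H -> nnmf H' -> (forall a b, (\int[mu]_(x in `[a, b]) H x < +oo)%E) ->
      loc_int (fun x => fine (H x) / fine (H' x)) ->
      0 < Iab (fun x => fine (H' x)) a l ->
      {ae mu, forall x, 0 < fine (H' x)} ->
      {ae mu, forall x, a <= x <= a + l -> Iab (fun x => fine (H' x)) a l <= k * l * fine (H' x)} ->
      Iab (fun x => fine (H x) / fine (H' x)) a l <=
        k * l / Iab (fun x => fine (H' x)) a l * Iab (fun x => fine (H x)) a l.
    move=> k0 [mH H0] [mH' H'0] hH lq I0 H'p aeH.
    have lH := nnmf_fine_loc_int (conj mH H0) hH.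
    rewrite -IabZ//; apply: Iab_ae_le => //.
    + exact: loc_intZ.
    + by move=> x; rewrite divr_ge0 ?fine_ge0.
    + by move=> x; rewrite mulr_ge0 ?fine_ge0// divr_ge0 ?ltW// mulr_gt0.
    + apply: ae_imp2 aeH H'p => x h p /h{}h; rewrite mulrC; apply: ler_wpM2r; first exact: fine_ge0.
      by rewrite ler_pdivlMr// mulrC ler_pdivrMr.
  have h1 := half F G _ K'0 nF nG hF (quot _ _ nF nG hF Glow) IG (pos _ nG Gfin Glow) aeG.
  have h2 := half G F _ K0 nG nF hG (quot _ _ nG nF hG Flow) IF (pos _ nF Ffin Flow) aeF.
  apply: (le_trans (ler_pM _ _ h1 h2)).
  + by apply: Iab_ge0 => x; rewrite divr_ge0 ?fine_ge0.
  + by apply: Iab_ge0 => x; rewrite divr_ge0 ?fine_ge0.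
  + by rewrite le_eqVlt; apply/orP; left; apply/eqP; field; rewrite !gt_eqF.
Qed.

(** A lower bound on [[0, 1]] alone spreads over the line: the A_1 condition on an interval
    containing [[0, 1]] and [x] bounds [F x] from below. *)
Lemma A1_majorant (N : (R -> \bar R) -> \bar R) : sublinear_norm N -> maximal_bounded N ->
  exists2 K : R, 0 < K & forall f, nnmf f -> (N f < +oo)%E ->
   (exists2 c : R, 0 < c & forall x, 0 <= x <= 1 -> (c%:E <= f x)%E) ->
   exists F, [/\ A1_weight K F, forall x, (f x <= F x)%E & (N F <= 2%:E * N f)%E].
Proof.
move=> sN mN; have [K K0 hK] := maximal_bounded_nnmf sN mN.
exists (2 * K); first by rewrite mulr_gt0.
move=> f nf Nf [c c0 hc]; have [F [nF fF NF FK]] := rubio_de_francia sN K0 hK nf Nf.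
have NFfin : (N F < +oo)%E.
  apply: (le_lt_trans NF); have := sn_ge0 sN nf; move: Nf.
  by case: (N f) => // r _ _; rewrite -EFinM ltry.
exists F; split => //; split => //.
- by move=> a b; exact: (sn_loc sN).
- exact: (sn_finite_ae sN).
- move=> a l; pose a' := Num.min a 0; pose b' := Num.max (a + l) 1.
  have a'a : a' <= a by rewrite /a' ge_min lexx.
  have a'0 : a' <= 0 by rewrite /a' ge_min lexx orbT.
  have b'b : a + l <= b' by rewrite /b' le_max lexx.
  have b'1 : 1 <= b' by rewrite /b' le_max lexx orbT.
  have ab : a' < b' by lra.
  have D0 : 0 < 2 * K * (b' - a') by rewrite !mulr_gt0// subr_gt0.
  exists (c / (2 * K * (b' - a'))); first by rewrite divr_gt0.
  move=> x /andP[x1 x2]; rewrite mulrC EFinM lee_pdivrMl//.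
  have xab : a' <= x <= b' by lra.
  apply: le_trans (FK _ _ _ ab xab).
  have [mF F0] := nF.
  apply: (@le_trans _ _ (\int[mu]_(y in `[0%R, 1%R]) c%:E)%E).
    by rewrite integral_cst//= lebesgue_measure_itv/= lte01 oppr0 adde0 mule1.
  apply: (@le_trans _ _ (\int[mu]_(y in `[0%R, 1%R]) F y)%E).
    apply: ge0_le_integral => //.
    + by move=> y _; rewrite lee_fin ltW.
    + exact: measurable_funS mF.
    + by move=> y; rewrite /= in_itv/= => /hc/le_trans; apply; exact: fF.
  apply: ge0_subset_integral => //; first exact: measurable_funS mF.
  by apply: subset_itv; rewrite bnd_simp.
Qed.

(** The axioms know only series, so the two terms are padded with zeros. *)
Lemma sn_add (N : (R -> \bar R) -> \bar R) (f g : R -> \bar R) : sublinear_norm N -> nnmf f -> nnmf g ->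
  (N (fun x => f x + g x) <= N f + N g)%E.
Proof.
move=> sN nf ng; pose z (_ : R) := 0%E : \bar R.
have nz : nnmf z by split => //; exact: measurable_cst.
have Nz : N z = 0%E.
  apply/eqP; rewrite eq_le (sn_ge0 sN nz) andbT.
  have := sn_homog sN nz (lexx 0); rewrite mul0e; apply: le_trans.
  by rewrite (_ : (fun x => 0%:E * z x)%E = z)//; apply/funext => x; rewrite /z mule0.
pose fn n := if n is 0%N then f else if n is 1%N then g else z.
have nfn n : nnmf (fn n) by case: n => [|[|n]].
have sum2 (u : nat -> \bar R) : (forall n, (0 <= u n)%E) -> (forall n, u n.+2 = 0%E) ->
    (\sum_(n <oo) u n = u 0%N + u 1%N)%E.
  move=> u0 u2; rewrite (nneseries_split 0 2)// [X in (_ + X)%E]eseries0; last first.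
    by case=> [|[|n]].
  by rewrite adde0 add0n !big_nat_recl//= big_geq// adde0.
have := sn_series sN nfn; rewrite sum2//; last by move=> n; exact: (sn_ge0 sN).
by congr (_ <= _)%E; congr N; apply/funext => x; rewrite sum2// => n; case: (nfn n).
Qed.

Variable rho : (R -> \bar R) -> \bar R.
Hypothesis bfn : banach_function_norm rho.
Hypothesis mrho : maximal_bounded rho.
Hypothesis mrho' : maximal_bounded (assoc_norm rho).
Local Notation rho' := (assoc_norm rho).

Let chi : R -> \bar R := fun x => (\1_`[0, 1]%classic x)%:E.

Lemma assoc_indic_itv_finite (a b : R) : (rho' (fun x => (\1_`[a, b] x)%:E) < +oo)%E.
Proof.
have [||CE hCE] := bfn_loc bfn (E := `[a, b]%classic) => //.
  by rewrite lebesgue_measure_itv/=; case: ifP => _; rewrite ltry.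
apply: (@le_lt_trans _ _ (`|CE|%:E)); last by rewrite ltry.
apply: ge_ereal_sup => _ [f [nf rf] <-]; have [mf f0] := nf.
apply: (@le_trans _ _ (\int[mu]_(x in `[a, b]) f x)%E).
  rewrite [leRHS]integral_mkcond; apply: ge0_le_integral => //.
  - by move=> x _; rewrite mule_ge0// lee_fin.
  - apply: emeasurable_funM => //; exact/measurable_EFinP/measurable_indic.
  - by apply/(measurable_restrictT _ _).1 => //; exact: measurable_funS mf.
  - move=> x _; rewrite /patch indicE; case: ifP => _; first by rewrite mule1.
    by rewrite mule0.
apply: (le_trans (hCE f nf)); have r0 := bfn_ge0 bfn nf.
have rfin : rho f \is a fin_num by rewrite ge0_fin_numE// (le_lt_trans rf)// ltry.
rewrite -(fineK rfin) -EFinM lee_fin.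
have h1 : fine (rho f) <= 1 by rewrite -lee_fin fineK.
have h0 : 0 <= fine (rho f) by exact: fine_ge0.
apply: (@le_trans _ _ (`|CE| * fine (rho f))).
  by apply: ler_wpM2r => //; exact: ler_norm.
by rewrite ler_piMr.
Qed.

Lemma dominating_weights : exists Q : R, forall f g : R -> C, inX rho f -> inX rho' g ->
  forall e : R, 0 < e -> exists s w, [/\ A2_pair Q s w,
    mu.-integrable setT (EFin \o (fun x => Normc.normc (f x) ^+ 2 * w x)),
    mu.-integrable setT (EFin \o (fun x => Normc.normc (g x) ^+ 2 * s x)) &
    (\int[mu]_x (Normc.normc (f x) ^+ 2 * w x)%:E <= 4%:E * (rho (cabs f) + e%:E) * (rho' (cabs g) + e%:E)
    /\ \int[mu]_x (Normc.normc (g x) ^+ 2 * s x)%:E <= 4%:E * (rho (cabs f) + e%:E) * (rho' (cabs g) + e%:E))%E].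
Proof.
have sr := bfn_sublinear bfn; have sa := assoc_sublinear bfn.
have [K K0 hK] := A1_majorant sr mrho; have [K' K'0 hK'] := A1_majorant sa mrho'.
exists (K * K') => f g fX gX e e0.
have [mf rf] := fX; have [mg rg] := gX.
have nchi : nnmf chi by exact: nnmf_indic.
(* [h] may vanish on [[0, 1]]; a multiple of [chi] of norm at most [e] supplies the lower bound that
   [A1_majorant] asks for. *)
have boost N (h : R -> C) : sublinear_norm N -> (N chi < +oo)%E -> inX N h ->
  exists h0, [/\ nnmf h0, (N h0 <= N (cabs h) + e%:E)%E, (N h0 < +oo)%E,
   (forall x, (cabs h x <= h0 x)%E) &
   exists2 c : R, 0 < c & forall x, 0 <= x <= 1 -> (c%:E <= h0 x)%E].
  move=> sN Nchi [mh Nh].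
  have Nc0 := sn_ge0 sN nchi.
  have Nfin : N chi \is a fin_num by rewrite ge0_fin_numE.
  pose u := fine (N chi); have u0 : 0 <= u by exact: fine_ge0.
  pose c := e / (u + 1); have c0 : 0 < c by rewrite divr_gt0// ltr_wpDl.
  have ncabs := nnmf_cabs mh.
  have nc := nnmfZ nchi (ltW c0).
  have le1 : (N (fun x => cabs h x + c%:E * chi x) <= N (cabs h) + e%:E)%E.
    apply: (le_trans (sn_add sN ncabs nc)); apply: leeD => //.
    apply: (le_trans (sn_homog sN nchi (ltW c0))).
    rewrite -(fineK Nfin) -EFinM lee_fin /c mulrAC ler_pdivrMr ?ltr_wpDl//.
    by apply: ler_wpM2l; [exact: ltW|rewrite lerDl].
  exists (fun x => cabs h x + c%:E * chi x)%E; split.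
  - exact: nnmfD.
  - exact: le1.
  - by apply: (le_lt_trans le1); rewrite lte_add_pinfty// ltry.
  - by move=> x; rewrite leeDl//; case: nc.
  - exists c => // x x01; rewrite /chi indicE mem_set/= ?in_itv//= mule1 leeDr//.
    by case: ncabs.
have [f0 [nf0 rf0 rf0' ff0 lowf]] := boost _ _ sr (indic_itv_finite bfn 0 1) fX.
have [g0 [ng0 rg0 rg0' gg0 lowg]] := boost _ _ sa (assoc_indic_itv_finite 0 1) gX.
have [F [wF fF rF]] := hK f0 nf0 rf0' lowf.
have [G [wG gG rG]] := hK' g0 ng0 rg0' lowg.
have p := A1_pair K0 K'0 wF wG.
have [nF _ Ffin Flow _] := wF; have [nG _ Gfin Glow _] := wG.
have [mF F0] := nF; have [mG G0] := nG.
exists (fun x => fine (F x) / fine (G x)), (fun x => fine (G x) / fine (F x)).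
have bound : (\int[mu]_x (F x * G x) <= 4%:E * (rho (cabs f) + e%:E) * (rho' (cabs g) + e%:E))%E.
  apply: (le_trans (hoelder_assoc bfn nF nG _)).
    by apply: (le_lt_trans rF); exact: lte_mul_pinfty.
  have -> : (4%:E * (rho (cabs f) + e%:E) * (rho' (cabs g) + e%:E) =
     (2%:E * (rho (cabs f) + e%:E)) * (2%:E * (rho' (cabs g) + e%:E)))%E.
    rewrite [RHS]muleACA -EFinM muleA; congr (_%:E * _ * _)%E; ring.
  apply: lee_pmul.
  - exact: (bfn_ge0 bfn).
  - exact: assoc_norm_ge0.
  - by apply: (le_trans rF); rewrite lee_wpmul2l.
  - by apply: (le_trans rG); rewrite lee_wpmul2l.
have pos H : {ae mu, forall x, H x \is a fin_num} ->
    (forall a l, exists2 c : R, 0 < c & forall x, a <= x <= a + l -> (c%:E <= H x)%E) ->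
    {ae mu, forall x, 0 < fine (H x)}.
  move=> Hfin lowH; apply: ae_imp Hfin => x Hx.
  have [c c0 hc] := lowH x 0; rewrite (lt_le_trans c0)// -lee_fin fineK// hc//; lra.
have aeF : {ae mu, forall x, F x \is a fin_num /\ 0 < fine (F x)}.
  by apply: ae_imp2 Ffin (pos _ Ffin Flow) => x; split.
have aeG : {ae mu, forall x, G x \is a fin_num /\ 0 < fine (G x)}.
  by apply: ae_imp2 Gfin (pos _ Gfin Glow) => x; split.
have mw (h : R -> C) (w : R -> R) : cmeasurable h -> measurable_fun setT w ->
    measurable_fun setT (fun x => (Normc.normc (h x) ^+ 2 * w x)%:E).
  move=> mh mw; apply/measurable_EFinP; apply: measurable_funM => //.
  by apply: measurable_funX; exact: cabs_measurable.
(* Since [|h| <= H], the integrand [|h|^2 H' / H] is at most [H H']. *)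
have half (h : R -> C) (H H' : R -> \bar R) (w : R -> R) : cmeasurable h -> measurable_fun setT w ->
    (forall x, w x = fine (H' x) / fine (H x)) -> (forall x, (cabs h x <= H x)%E) ->
    (forall x, (0 <= H x)%E) -> (forall x, (0 <= H' x)%E) ->
    measurable_fun setT H -> measurable_fun setT H' ->
    {ae mu, forall x, H x \is a fin_num /\ 0 < fine (H x)} ->
    {ae mu, forall x, H' x \is a fin_num /\ 0 < fine (H' x)} ->
    (\int[mu]_x (Normc.normc (h x) ^+ 2 * w x)%:E <= \int[mu]_x (H x * H' x))%E.
  move=> mh mw' wE hH H0 H'0 mH mH' aeH aeH'; apply: ae_ge0_le_integral => //.
  - move=> x _; rewrite lee_fin wE; apply: mulr_ge0; first exact: sqr_ge0.
    by rewrite divr_ge0 ?fine_ge0.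
  - exact: mw.
  - by move=> x _; rewrite mule_ge0.
  - exact: emeasurable_funM.
  - apply: ae_imp2 aeH aeH' => x [Hx px] [H'x p'x] _.
    rewrite -(fineK Hx) -(fineK H'x) -EFinM lee_fin wE.
    have h1 : Normc.normc (h x) <= fine (H x) by rewrite -lee_fin fineK//; exact: hH.
    rewrite mulrCA [leRHS]mulrC; apply: ler_wpM2l; first exact: ltW.
    rewrite ler_pdivrMr// -expr2 ler_pXn2r ?nnegrE ?normc_ge0//; exact: ltW.
have I1 : (\int[mu]_x (Normc.normc (f x) ^+ 2 * (fine (G x) / fine (F x)))%:E <=
   4%:E * (rho (cabs f) + e%:E) * (rho' (cabs g) + e%:E))%E.
  apply: le_trans bound; apply: half => //; first exact: loc_int_measurable (A2_w p).
  by move=> x; exact: le_trans (ff0 x) (fF x).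
have I2 : (\int[mu]_x (Normc.normc (g x) ^+ 2 * (fine (F x) / fine (G x)))%:E <=
   4%:E * (rho (cabs f) + e%:E) * (rho' (cabs g) + e%:E))%E.
  apply: le_trans bound; rewrite (_ : (\int[mu]_x (F x * G x) = \int[mu]_x (G x * F x))%E).
    apply: half => //; first exact: loc_int_measurable (A2_s p).
    by move=> x; exact: le_trans (gg0 x) (gG x).
  by apply: eq_integral => x _; rewrite muleC.
have fin : (4%:E * (rho (cabs f) + e%:E) * (rho' (cabs g) + e%:E) < +oo)%E.
  have r0 := bfn_ge0 bfn (nnmf_cabs mf); have r'0 := assoc_norm_ge0 bfn (cabs g).
  move: rf rg r0 r'0; case: (rho _) => // r _; case: (rho' _) => // r' _ _ _.
  by rewrite -!EFinD -!EFinM ltry.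
split => //.
- apply/integrableP; split; first by apply: mw => //; exact: loc_int_measurable (A2_w p).
  apply: le_lt_trans fin; apply: le_trans I1; rewrite le_eqVlt; apply/orP; left; apply/eqP.
  apply: eq_integral => x _; rewrite /= ger0_norm//; apply: mulr_ge0; first exact: sqr_ge0.
  by rewrite divr_ge0 ?fine_ge0.
- apply/integrableP; split; first by apply: mw => //; exact: loc_int_measurable (A2_s p).
  apply: le_lt_trans fin; apply: le_trans I2; rewrite le_eqVlt; apply/orP; left; apply/eqP.
  apply: eq_integral => x _; rewrite /= ger0_norm//; apply: mulr_ge0; first exact: sqr_ge0.
  by rewrite divr_ge0 ?fine_ge0.
Qed.

(** Both energies are at most [4 (r + e) (r' + e)], whence the factor 8; then [e] tends to 0. *)
Lemma coefficient_bound (psi : R -> C) L A : 0 < A ->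
  bump L A (fun y => complex.Re (psi y)) -> bump L A (fun y => complex.Im (psi y)) ->
  exists2 K : R, 0 <= K & forall f g, inX rho f -> inX rho' g ->
    forall I : seq (int * int), uniq I ->
    \sum_(i <- I) Normc.normc (inner f (wav psi i.1 i.2)) * Normc.normc (inner g (wav psi i.1 i.2))
    <= K * fine (rho (cabs f)) * fine (rho' (cabs g)).
Proof.
move=> A0 bre bim; have [Q hQ] := dominating_weights.
have [K K0 hK] := wavelet_pairing_bound Q A0 bre bim.
exists (8 * K); first by rewrite mulr_ge0.
move=> f g fX gX I uI.
have sr := bfn_sublinear bfn; have sa := assoc_sublinear bfn.
have [mf rf] := fX; have [mg rg] := gX.
have r0 := bfn_ge0 bfn (nnmf_cabs mf); have r'0 := assoc_norm_ge0 bfn (cabs g).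
have rfin : rho (cabs f) \is a fin_num by rewrite ge0_fin_numE.
have r'fin : rho' (cabs g) \is a fin_num by rewrite ge0_fin_numE.
pose r := fine (rho (cabs f)); pose r' := fine (rho' (cabs g)).
have rp : 0 <= r by exact: fine_ge0.
have r'p : 0 <= r' by exact: fine_ge0.
rewrite -/r -/r'; set S := \sum_(i <- I) _.
have key e : 0 < e -> S <= 8 * K * ((r + e) * (r' + e)).
  move=> e0; have [s [w [sw If Ig [Bf Bg]]]] := hQ f g fX gX e e0.
  have loc h (w' : R -> R) : (forall x, 0 <= w' x) -> mu.-integrable setT (EFin \o (fun x => Normc.normc (h x) ^+ 2 * w' x)) ->
     (\int[mu]_x (Normc.normc (h x) ^+ 2 * w' x)%:E <= 4%:E * (rho (cabs f) + e%:E) * (rho' (cabs g) + e%:E))%E ->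
     loc_int (fun x => Normc.normc (h x) ^+ 2 * w' x) /\
     forall a l, 0 < l -> Iab (fun x => Normc.normc (h x) ^+ 2 * w' x) a l <= 4 * ((r + e) * (r' + e)).
    move=> w0 Ih Bh.
    have lh : loc_int (fun x => Normc.normc (h x) ^+ 2 * w' x).
      by move=> a b; exact: integrableS Ih.
    split => // a l l0; rewrite -lee_fin /Iab /Rintegral fineK; last exact: integrable_fin_num (lh _ _).
    have -> : (4 * ((r + e) * (r' + e)))%:E = (4%:E * (rho (cabs f) + e%:E) * (rho' (cabs g) + e%:E))%E.
      by rewrite -(fineK rfin) -(fineK r'fin) -!EFinD -!EFinM mulrA.
    apply: le_trans Bh; apply: ge0_subset_integral => //.
      exact: measurable_int Ih.
    by move=> x _; rewrite lee_fin mulr_ge0 ?sqr_ge0.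
  have [lf Ef] := loc f w (A2_w0 sw) If Bf; have [lg Eg] := loc g s (A2_s0 sw) Ig Bg.
  apply: (le_trans (hK s w sw f g _ _ (sn_cloc_int sr fX) (sn_cloc_int sa gX) lf lg Ef Eg I uI)).
  by rewrite le_eqVlt; apply/orP; left; apply/eqP; ring.
apply/ler_addgt0Pl => d d0.
have D0 : 0 < 8 * K * (r + r' + 1) + 1 by rewrite ltr_wpDl// mulr_ge0// ?mulr_ge0// !addr_ge0.
pose e := Num.min 1 (d / (8 * K * (r + r' + 1) + 1)).
have e0 : 0 < e by rewrite lt_min ltr01 divr_gt0.
have e1 : e <= 1 by rewrite ge_min lexx.
have ed : e * (8 * K * (r + r' + 1) + 1) <= d.
  by rewrite -ler_pdivlMr// ge_min lexx orbT.
apply: (le_trans (key e e0)).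
have -> : 8 * K * ((r + e) * (r' + e)) = 8 * K * r * r' + e * (8 * K * (r + r' + e)) by ring.
rewrite addrC lerD2r; apply: le_trans ed; apply: ler_wpM2l; first exact: ltW.
apply: (@le_trans _ _ (8 * K * (r + r' + 1))); last by rewrite lerDl.
by apply: ler_wpM2l; [rewrite mulr_ge0|rewrite lerD2l].
Qed.

End DominatingWeights.

(** * Hahn-Banach *)
Section HahnBanach.
Variables (R : realType) (V : zmodType) (sc : R -> V -> V) (X : V -> Prop).
Hypothesis scDl : forall a b x, sc (a + b) x = sc a x + sc b x.
Hypothesis scDr : forall a x y, sc a (x + y) = sc a x + sc a y.
Hypothesis scA : forall a b x, sc a (sc b x) = sc (a * b) x.
Hypothesis sc1 : forall x, sc 1 x = x.
Hypothesis XD : forall x y, X x -> X y -> X (x + y).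
Hypothesis XZ : forall a x, X x -> X (sc a x).
Implicit Types (p q l : V -> R).

Definition sublinear p := (forall x y, X x -> X y -> p (x + y) <= p x + p y) /\
  (forall t x, 0 < t -> X x -> p (sc t x) = t * p x).

Let sc0r a : sc a 0 = 0.
Proof. by apply: (@addrI _ (sc a 0)); rewrite -scDr !addr0. Qed.

Let sc0l x : sc 0 x = 0.
Proof. by apply: (@addrI _ (sc 0 x)); rewrite -scDl !addr0. Qed.

Let scN x : sc (-1) x = - x.
Proof. by apply: (@addrI _ x); rewrite subrr -{1}[x]sc1 -scDl subrr sc0l. Qed.

Let XN x : X x -> X (- x).
Proof. by move=> Xx; rewrite -scN; exact: XZ. Qed.

Let sublinear0 p : sublinear p -> X 0 -> p 0 = 0.
Proof.
move=> [_ h] X0; have := h 2 0 (ltr0n _ 2) X0; rewrite sc0r; lra.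
Qed.

Let sublinearZ p t x : sublinear p -> 0 <= t -> X x -> p (sc t x) = t * p x.
Proof.
move=> sp t0 Xx; have [->|t1] := eqVneq t 0.
  rewrite sc0l mul0r sublinear0//.
  by rewrite -(sc0l x); exact: XZ.
by apply: sp.2 => //; rewrite lt_def t1.
Qed.

(** A sublinear functional below [p] whose value at [- y] is at most [- p y]. A minimal sublinear
    functional cannot be lowered in this way, and that is its additivity. *)
Definition slide p y : V -> R := fun x => inf [set p (x + sc t y) - t * p y | t in [set t | 0 <= t]].

Let slide_lb p y x : sublinear p -> X x -> X y ->
  lbound [set p (x + sc t y) - t * p y | t in [set t | 0 <= t]] (- p (- x)).
Proof.
move=> sp Xx Xy _ [t /= t0 <-]; rewrite -sublinearZ//.
have := sp.1 (x + sc t y) (- x) (XD Xx (XZ t Xy)) (XN Xx).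
rewrite addrAC subrr add0r; lra.
Qed.

Let slide_le p y x t : sublinear p -> X x -> X y -> 0 <= t ->
  slide p y x <= p (x + sc t y) - t * p y.
Proof.
move=> sp Xx Xy t0; apply: ge_inf; last by exists t.
by exists (- p (- x)); exact: slide_lb.
Qed.

Let slide_adherent p y x e : sublinear p -> X x -> X y -> 0 < e ->
  exists2 t, 0 <= t & p (x + sc t y) - t * p y < slide p y x + e.
Proof.
move=> sp Xx Xy e0.
have [|_ [t /= t0 <-] h] := @inf_adherent _ [set p (x + sc t y) - t * p y | t in [set t | 0 <= t]] _ e0.
  split; first by exists (p (x + sc 0 y) - 0 * p y), 0 => /=.
  by exists (- p (- x)); exact: slide_lb.
by exists t.
Qed.

Lemma slide_sublinear p y : sublinear p -> X y -> sublinear (slide p y).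
Proof.
move=> sp Xy; split.
  move=> x1 x2 X1 X2; apply/ler_addgt0Pl => e e0.
  have e20 : 0 < e / 2 by rewrite divr_gt0.
  have [t1 t10 h1] := slide_adherent sp X1 Xy e20.
  have [t2 t20 h2] := slide_adherent sp X2 Xy e20.
  have := slide_le sp (XD X1 X2) Xy (addr_ge0 t10 t20).
  have := sp.1 _ _ (XD X1 (XZ t1 Xy)) (XD X2 (XZ t2 Xy)).
  rewrite scDl [x1 + x2 + _]addrACA; lra.
have half t x : 0 < t -> X x -> slide p y (sc t x) <= t * slide p y x.
  move=> t0 Xx; apply/ler_addgt0Pl => e e0.
  have et0 : 0 < e / t by rewrite divr_gt0.
  have [s s0 h] := slide_adherent sp Xx Xy et0.
  have ts0 : 0 <= t * s by rewrite mulr_ge0// ltW.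
  apply: (le_trans (slide_le sp (XZ t Xx) Xy ts0)).
  rewrite -scA -scDr sp.2//; last exact: XD Xx (XZ s Xy).
  have hE : t * (slide p y x + e / t) = t * slide p y x + e by field; rewrite gt_eqF.
  by have := h; rewrite -(ltr_pM2l t0) hE mulrBr mulrA; lra.
move=> t x t0 Xx; apply/eqP; rewrite eq_le half//=.
have := half t^-1 (sc t x); rewrite invr_gt0 => /(_ t0 (XZ t Xx)).
by rewrite scA mulVf ?gt_eqF// sc1 mulrC ler_pdivlMr// mulrC.
Qed.

Let slide_le_self p y x : sublinear p -> X x -> X y -> slide p y x <= p x.
Proof.
move=> sp Xx Xy; have := slide_le sp Xx Xy (lexx 0).
by rewrite sc0l addr0 mul0r subr0.
Qed.

(** Zorn's lemma for the reversed order; the pointwise infimum of a chain is finite, because every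
    member is at least [- p (- x)] at [x]. *)
Lemma minimal_sublinear p : sublinear p -> exists q, [/\ sublinear q,
  forall x, X x -> q x <= p x &
  forall q', sublinear q' -> (forall x, X x -> q' x <= q x) -> forall x, X x -> q x <= q' x].
Proof.
move=> sp; pose T := {q | sublinear q /\ forall x, X x -> q x <= p x}.
pose t0 : T := exist _ p (conj sp (fun x _ => lexx (p x))).
pose r : rel T := fun u v => `[< forall x, X x -> sval v x <= sval u x >].
have [||A totA|[q [sq qp]] qmin] := @ZL_preorder T t0 r.
- by move=> t; apply/asboolP.
- move=> q1 q2 q3 /asboolP h1 /asboolP h2; apply/asboolP => x Xx.
  exact: le_trans (h2 x Xx) (h1 x Xx).
- have [[q0 Aq0]|Aempty] := pselect (exists u, A u); last first.
    by exists t0 => s As; exfalso; apply: Aempty; exists s.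
  pose E x := [set sval u x | u in A].
  have lbE x : X x -> lbound (E x) (- p (- x)).
    move=> Xx _ [q Aq <-]; have [sq qp] := svalP q.
    have X0 : X 0 by rewrite -(subrr x); exact: XD Xx (XN Xx).
    have := sq.1 x (- x) Xx (XN Xx); rewrite subrr sublinear0//.
    have := qp (- x) (XN Xx); lra.
  have hinf x : X x -> has_inf (E x).
    move=> Xx; split; first by exists (sval q0 x), q0.
    by exists (- p (- x)); exact: lbE.
  pose m x := inf (E x).
  have mle x u : X x -> A u -> m x <= sval u x.
    by move=> Xx Au; apply: ge_inf; [case: (hinf x Xx)|exists u].
  have madh x e : X x -> 0 < e -> exists2 u, A u & sval u x < m x + e.
    by move=> Xx e0; have [_ [q Aq <-] h] := inf_adherent e0 (hinf x Xx); exists q.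
  have sm : sublinear m.
    split.
      move=> x y Xx Xy; apply/ler_addgt0Pl => e e0.
      have e20 : 0 < e / 2 by rewrite divr_gt0.
      have [q1 A1 h1] := madh x _ Xx e20; have [q2 A2 h2] := madh y _ Xy e20.
      (* The smaller of the two members of the chain is nearly minimal at both points, and its
         subadditivity passes to [m]. *)
      have [/asboolP h|/asboolP h] := totA _ _ A1 A2.
        have := mle _ _ (XD Xx Xy) A2; have := (svalP q2).1.1 x y Xx Xy.
        have := h x Xx; lra.
      have := mle _ _ (XD Xx Xy) A1; have := (svalP q1).1.1 x y Xx Xy.
      have := h y Xy; lra.
    have half t x : 0 < t -> X x -> m (sc t x) <= t * m x.
      move=> t0' Xx; apply/ler_addgt0Pl => e e0.
      have et0 : 0 < e / t by rewrite divr_gt0.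
      have [q Aq h] := madh x _ Xx et0.
      apply: (le_trans (mle _ _ (XZ t Xx) Aq)); rewrite (svalP q).1.2//.
      have hE : t * (m x + e / t) = t * m x + e by field; rewrite gt_eqF.
      by have := h; rewrite -(ltr_pM2l t0') hE; lra.
    move=> t x t0' Xx; apply/eqP; rewrite eq_le half//=.
    have := half t^-1 (sc t x); rewrite invr_gt0 => /(_ t0' (XZ t Xx)).
    by rewrite scA mulVf ?gt_eqF// sc1 mulrC ler_pdivlMr// mulrC.
  have mp x : X x -> m x <= p x.
    by move=> Xx; apply: (le_trans (mle _ _ Xx Aq0)); exact: (svalP q0).2.
  by exists (exist _ m (conj sm mp)) => s As; apply/asboolP => x Xx /=; exact: mle.
exists q; split => // q' sq' q'q x Xx.
have q'p y : X y -> q' y <= p y by move=> Xy; exact: le_trans (q'q y Xy) (qp y Xy).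
have := qmin (exist _ q' (conj sq' q'p)) _.
by move=> /(_ _)/asboolP; apply => //; apply/asboolP.
Qed.

(** Minimal sublinear functionals are linear: [q <= slide q y] at [t = 1] reads
    [q x + q y <= q (x + y)]. Minimizing below [slide p f] instead of [p] forces the value [p f] at
    [f]. The scaling is a parameter so that the theorem serves real functions in [step_norming] and
    complex ones, as a real space, in [separating_functional]. *)
Theorem hahn_banach_point p f : sublinear p -> X f -> exists l,
  [/\ forall x y, X x -> X y -> l (x + y) = l x + l y,
      forall t x, X x -> l (sc t x) = t * l x,
      forall x, X x -> l x <= p x & l f = p f].
Proof.
move=> sp Xf; have [q [sq qp qmin]] := minimal_sublinear (slide_sublinear sp Xf).
have slideq y x : X y -> X x -> q x <= slide q y x.
  move=> Xy; apply: qmin; first exact: slide_sublinear.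
  by move=> z Xz; exact: slide_le_self.
have qD x y : X x -> X y -> q (x + y) = q x + q y.
  move=> Xx Xy; apply/eqP; rewrite eq_le sq.1//=.
  have := le_trans (slideq y x Xy Xx) (slide_le sq Xx Xy ler01).
  by rewrite sc1 mul1r lerBrDr.
have X0 : X 0 by rewrite -(subrr f); exact: XD Xf (XN Xf).
have qN x : X x -> q (- x) = - q x.
  by move=> Xx; have := qD x (- x) Xx (XN Xx); rewrite subrr sublinear0//; lra.
exists q; split => //.
- move=> t x Xx; have [t0|t0] := lerP 0 t; first exact: sublinearZ.
  have -> : sc t x = - sc (- t) x by rewrite -scN scA mulN1r opprK.
  rewrite qN ?sq.2 ?oppr_gt0//; [by rewrite mulNr opprK|exact: XZ].
- by move=> x Xx; apply: le_trans (qp x Xx) (slide_le_self sp Xx Xf).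
- apply/eqP; rewrite eq_le; apply/andP; split.
    exact: le_trans (qp f Xf) (slide_le_self sp Xf Xf).
  have := le_trans (qp _ (XN Xf)) (slide_le sp (XN Xf) Xf ler01).
  by rewrite sc1 addNr mul1r sublinear0// sub0r qN// lerN2.
Qed.

End HahnBanach.

(** * Wavelets as bumps of mean zero *)
Section WaveletBumps.
Variable R : realType.
Local Notation C := (R[i]).
Local Notation mu := (@lebesgue_measure R).
Implicit Types (th h : R -> R) (psi : R -> C) (A L : R).

Lemma C1_supported_lipschitz h A : 0 < A -> C1_fun h -> (forall x, A < `|x| -> h x = 0) ->
  exists2 L, 0 <= L & lipschitz_with L h.
Proof.
move=> A0 [dh ch] h0; pose B := A + 1.
have [M [Mr hM]] := compact_bounded (continuous_compact
  (continuous_subspaceT ch) (@segment_compact _ (- B) B)).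
exists (`|M| + 1) => [|x y]; first by rewrite addr_ge0.
have dM x' : - B <= x' <= B -> `|derive1 h x'| <= `|M| + 1.
  move=> xB; apply: (hM (`|M| + 1)); first by rewrite (le_lt_trans (ler_norm M))// ltrDl.
  by exists x' => //=; rewrite in_itv/=.
have cont : continuous h.
  by move=> z; apply: differentiable_continuous; apply/derivable1_diffP; exact: dh.
have seg u v : - B <= u -> u <= v -> v <= B -> `|h v - h u| <= (`|M| + 1) * (v - u).
  move=> Bu uv vB.
  have [c cuv ->] := @MVT_segment R h (derive1 h) u v uv
    (fun z _ => eq_ind_r (fun d => is_derive z 1 h d) (derivableP (dh z)) (derive1E h z))
    (continuous_subspaceT cont).
  rewrite normrM [`|v - u|]ger0_norm ?subr_ge0//; apply: ler_wpM2r; first by rewrite subr_ge0.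
  by apply: dM; move: cuv; rewrite in_itv/= => /andP[c1 c2]; lra.
(* Clamping to [[- B, B]] does not change the values of [h], which vanishes from the end points on
   because [B > A]. The mean value theorem is then needed only on this segment. *)
pose cl (u : R) := Num.max (- B) (Num.min u B).
have clE u : h u = h (cl u).
  rewrite /cl; have [uB|Bu] := leP u B.
    have [//|uB'] := leP (- B) u; rewrite !h0//.
      by rewrite normrN ger0_norm /B; lra.
    by rewrite ltr0_norm; rewrite /B in uB'; lra.
  have [//|hB] := leP (- B) B; last by rewrite /B in hB; lra.
  rewrite !h0//; first by rewrite ger0_norm /B; lra.
  by rewrite gtr0_norm; rewrite /B in Bu; lra.
have cl1 u : - B <= cl u <= B.
  by rewrite /cl /B; have [] := leP (- (A + 1)) (Num.min u (A + 1)); have [] := leP u (A + 1); lra.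
have cl2 u v : u <= v -> 0 <= cl v - cl u <= v - u.
  rewrite /cl /B => uv; have [] := leP u (A + 1); have [] := leP v (A + 1) => *;
  by rewrite ?[Num.max _ u](maxEle) ?[Num.max _ v](maxEle) ?[Num.max _ (A + 1)]maxEle;
     repeat case: ifPn; rewrite -?ltNge; lra.
have main u v : u <= v -> `|h v - h u| <= (`|M| + 1) * (v - u).
  move=> uv; rewrite (clE u) (clE v); have /andP[k1 k2] := cl2 _ _ uv.
  have /andP[k3 _] := cl1 u; have /andP[_ k4] := cl1 v.
  apply: (le_trans (seg _ _ k3 _ k4)); first by rewrite -subr_ge0.
  by apply: ler_wpM2l => //; rewrite addr_ge0.
have [xy|yx] := leP x y.
  by rewrite distrC [`|x - y|]distrC [`|y - x|]ger0_norm ?subr_ge0// main.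
by rewrite [`|x - y|]ger0_norm ?subr_ge0 ?(ltW yx)// main// ltW.
Qed.

Lemma Iab_dilate th (i : int * int) A : 0 < A -> continuous th ->
  Iab (fun x => th (2 ^ i.1 * x - i.2%:~R)) ((i.2%:~R - A) / 2 ^ i.1) (2 * A / 2 ^ i.1) =
  (2 ^ i.1)^-1 * Iab th (- A) (2 * A).
Proof.
move=> A0 cth; set p := (2 : R) ^ i.1; set k := (i.2%:~R : R).
have p0 : 0 < p by rewrite exprz_gt0.
pose F x := p * x - k.
have cF : continuous F.
  by move=> x; apply: cvgB; [apply: cvgM; [exact: cvg_cst|exact: cvg_id]|exact: cvg_cst].
have dF (x : R) : is_derive x 1 F p.
  have -> : F = p \*: (@id R) - cst k by apply/funext => y.
  by apply: is_derive_eq; rewrite subr0 [LHS]mulr1.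
have F'E : derive1 F = (fun=> p).
  by apply/funext => x; rewrite derive1E; have [] := dF x.
pose a := (k - A) / p; pose b := (k + A) / p.
have ab : a <= b by rewrite ler_pM2r ?invr_gt0//; lra.
have Fa : F a = - A by rewrite /F /a mulrC divfK ?gt_eqF//; ring.
have Fb : F b = A by rewrite /F /b mulrC divfK ?gt_eqF//; ring.
have := @integration_by_substitution_increasing R F th a b ab.
rewrite F'E Fa Fb => sub.
have lE : a + 2 * A / p = b by rewrite /a /b; field; rewrite gt_eqF.
have AE : - A + 2 * A = A by ring.
rewrite /Iab -/a lE AE /Rintegral.
have -> : (\int[mu]_(x in `[(- A)%R, A]) (th x)%:E)%E =
  (\int[mu]_(x in `[a, b]) (p * th (F x))%:E)%E.
  rewrite sub//.
  - by apply: eq_integral => x _ /=; rewrite /= mulrC.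
  - by move=> x y _ _ xy; rewrite /F ltrD2r ltr_pM2l.
  - by move=> x _; exact: cvg_cst.
  - exact: is_cvg_cst.
  - exact: is_cvg_cst.
  - split.
    + by move=> x _; have [] := dF x.
    + by apply: cvg_at_right_filter; exact: cF.
    + by apply: cvg_at_left_filter; exact: cF.
  - exact: continuous_subspaceT.
have ith : loc_int (fun x => th (F x)).
  by apply: loc_int_continuous => x; apply: continuous_comp; [exact: cF|exact: cth].
have := RintegralZl p _ (ith a b); rewrite /Rintegral => -> //.
by rewrite mulrA mulVf ?mul1r// gt_eqF.
Qed.

Lemma Iab_dil th (i : int * int) A a l : 0 < A -> continuous th ->
  (forall x, A < `|x| -> th x = 0) ->
  (forall x, `|2 ^ i.1 * x - i.2%:~R| <= A -> a <= x <= a + l) ->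
  Iab (dil th i) a l = Num.sqrt 2 ^ i.1 * ((2 ^ i.1)^-1 * Iab th (- A) (2 * A)).
Proof.
move=> A0 cth th0 sup; have p0 : 0 < (2 : R) ^ i.1 by rewrite exprz_gt0.
have zero x : A < `|2 ^ i.1 * x - i.2%:~R| -> dil th i x = 0.
  by move=> xA; rewrite /dil th0 ?mulr0.
rewrite -Rintegral_supported; last first.
  by move=> x xal; apply: zero; rewrite ltNge; apply/negP => /sup.
rewrite (@Rintegral_supported _ _ ((i.2%:~R - A) / 2 ^ i.1) (2 * A / 2 ^ i.1)); last first.
  move=> x xal; apply: zero; rewrite ltNge; apply/negP; rewrite ler_norml => /andP[x1 x2].
  apply: xal; rewrite -mulrDl ler_pdivrMr// ler_pdivlMr//; lra.
rewrite -Iab_dilate// -IabZ//.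
apply: loc_int_continuous => x; apply: continuous_comp; last exact: cth.
by apply: cvgB; [apply: cvgM; [exact: cvg_cst|exact: cvg_id]|exact: cvg_cst].
Qed.

(* At a fine scale [dil th i] sees only the value of [h] at the centre of its support. *)
Lemma Iab_dil_approx th h (i : int * int) A L : 0 < A -> 0 <= L -> continuous th ->
  (forall x, A < `|x| -> th x = 0) -> lipschitz_with L h ->
  `|Iab (fun x => h x * dil th i x) ((i.2%:~R - A) / 2 ^ i.1) (2 * A / 2 ^ i.1) - h (i.2%:~R / 2 ^ i.1) * (Num.sqrt 2 ^ i.1 * ((2 ^ i.1)^-1 * Iab th (- A) (2 * A)))|
  <= L * (A / 2 ^ i.1) * (Num.sqrt 2 ^ i.1 * ((2 ^ i.1)^-1 * Iab (fun x => `|th x|) (- A) (2 * A))).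
Proof.
move=> A0 L0 cth th0 hL; pose x0 : R := i.2%:~R / 2 ^ i.1; rewrite -/x0; have p0 : 0 < (2 : R) ^ i.1 by rewrite exprz_gt0.
set a := (i.2%:~R - A) / 2 ^ i.1; set l := 2 * A / 2 ^ i.1.
have supp x : `|2 ^ i.1 * x - i.2%:~R| <= A -> a <= x <= a + l.
  rewrite ler_norml => /andP[x1 x2].
  by rewrite /a /l -mulrDl ler_pdivrMr// ler_pdivlMr//; lra.
have ch := lipschitz_continuous hL.
have cth' : continuous (fun x => `|th x|).
  by move=> x; apply: continuous_comp; [exact: cth|exact: norm_continuous].
have th0' x : A < `|x| -> `|th x| = 0 by move=> /th0 ->; rewrite normr0.
rewrite -(Iab_dil A0 cth th0 supp) -(Iab_dil A0 cth' th0' supp).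
have idil : loc_int (dil th i) by apply: loc_int_continuous; exact: dil_continuous.
have idil' : loc_int (dil (fun x => `|th x|) i) by apply: loc_int_continuous; exact: dil_continuous.
have ihd : loc_int (fun x => h x * dil th i x).
  by apply: loc_int_mul_continuous; [exact: loc_int_continuous|exact: dil_continuous].
have idil2 : loc_int (fun x => - h x0 * dil th i x) by exact: loc_intZ.
have isum : loc_int (fun x => h x * dil th i x + - h x0 * dil th i x) by exact: loc_intD.
have E1 : Iab (fun x => h x * dil th i x + - h x0 * dil th i x) a l =
    Iab (fun x => h x * dil th i x) a l - h x0 * Iab (dil th i) a l.
  by rewrite IabD// IabZ// mulNr.
rewrite -E1 -(IabZ _ _ _ idil'); apply: (le_trans (Iab_norm _ _ isum)).
apply: Iab_le; [exact: loc_int_norm|exact: loc_intZ|].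
move=> x xal; rewrite -mulrDl normrM.
have -> : `|dil th i x| = dil (fun x => `|th x|) i x.
  by rewrite /dil normrM ger0_norm// exprz_ge0// sqrtr_ge0.
apply: ler_wpM2r; first by rewrite /dil mulr_ge0// exprz_ge0// sqrtr_ge0.
apply: (le_trans (hL _ _)); apply: ler_wpM2l => //.
have -> : x - x0 = (2 ^ i.1 * x - i.2%:~R) / 2 ^ i.1.
  by rewrite /x0; field; rewrite gt_eqF.
rewrite normrM normfV [`|2 ^ i.1|]gtr0_norm// ler_pM2r ?invr_gt0//.
move: xal; rewrite /a /l -mulrDl ler_pdivrMr// ler_pdivlMr// => /andP[x1 x2].
rewrite ler_norml; lra.
Qed.


Lemma small_eq0 (c d : R) (n0 : nat) : (forall n, (n0 <= n)%N -> `|c| <= d / 2 ^+ n) -> c = 0.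
Proof.
move=> h; apply/eqP; rewrite -normr_eq0 eq_le normr_ge0 andbT.
apply/ler_addgt0Pl => e e0; rewrite addr0.
pose n := maxn n0 (Num.truncn (`|d| / e)).+1.
apply: (le_trans (h n _)); first by rewrite leq_max leqnn.
rewrite ler_pdivrMr ?exprn_gt0// mulrC -ler_pdivrMr//.
apply: (@le_trans _ _ (`|d| / e)); first by rewrite ler_pM2r ?invr_gt0// ler_norm.
apply: ltW; apply: (lt_le_trans (truncnS_gt _)).
apply: (@le_trans _ _ n%:R); first by rewrite ler_nat leq_max leqnn orbT.
by rewrite -natrX ler_nat ltnW// ltn_expl.
Qed.

Lemma dyadic_dense h L : lipschitz_with L h -> 0 <= L ->
  (forall (k : int) (n : nat), h (k%:~R / 2 ^+ n) = 0) -> forall x, h x = 0.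
Proof.
move=> hL L0 h0 x; apply: (@small_eq0 _ L 0%N) => n _.
have p0 : 0 < (2 : R) ^+ n by rewrite exprn_gt0.
pose k := Num.floor (x * 2 ^+ n).
have := hL x (k%:~R / 2 ^+ n); rewrite h0 subr0 => /le_trans; apply.
apply: ler_wpM2l => //; have /andP[k1 k2] := floor_itv (x * 2 ^+ n).
have -> : x - k%:~R / 2 ^+ n = (x * 2 ^+ n - k%:~R) / 2 ^+ n by field; rewrite gt_eqF.
rewrite normrM normfV [`|2 ^+ n|]gtr0_norm// ler_pdivrMr// mulVf ?gt_eqF//.
by move: k2; rewrite intrD -/k => k2; rewrite ler_norml; lra.
Qed.

(* Testing [psi] against its own fine-scale copies at a dyadic point [x] gives
   [psi x * conj (\int psi) = 0]. *)
Lemma wavelet_bumps psi : orthonormal_wavelet psi -> C1 psi -> compact_support psi ->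
  exists A L, [/\ 0 < A, bump L A (fun y => complex.Re (psi y)) & bump L A (fun y => complex.Im (psi y))].
Proof.
move=> [_ [orth _]] [C1r C1i] csupp.
have [A A0 psi0] : exists2 A, 0 < A & forall x, A < `|x| -> psi x = 0.
  have [M [Mr hM]] := compact_bounded csupp.
  exists (`|M| + 1) => [|x xM]; first by rewrite ltr_wpDl.
  apply/eqP; apply: contraTT xM => px; rewrite -leNgt.
  apply: (hM (`|M| + 1)); first by rewrite (le_lt_trans (ler_norm M))// ltrDl.
  by apply: subset_closure.
pose r x := complex.Re (psi x); pose u x := complex.Im (psi x).
have r0 x : A < `|x| -> r x = 0 by rewrite /r => /psi0 ->.
have u0 x : A < `|x| -> u x = 0 by rewrite /u => /psi0 ->.
have [Lr Lr0 hLr] := C1_supported_lipschitz A0 C1r r0.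
have [Lu Lu0 hLu] := C1_supported_lipschitz A0 C1i u0.
pose L := Lr + Lu; have L0 : 0 <= L by rewrite addr_ge0.
have lr : lipschitz_with L r.
  by move=> x y; apply: (le_trans (hLr x y)); rewrite ler_wpM2r// lerDl.
have lu : lipschitz_with L u.
  by move=> x y; apply: (le_trans (hLu x y)); rewrite ler_wpM2r// lerDr.
have cr := lipschitz_continuous lr; have cu := lipschitz_continuous lu.
have cl : cloc_int psi by split; exact: loc_int_continuous.
pose P := Iab r (- A) (2 * A); pose Q := Iab u (- A) (2 * A).
pose d := L * A * (Iab (fun x => `|r x|) (- A) (2 * A) + Iab (fun x => `|u x|) (- A) (2 * A)).
have wav00 : wav psi 0 0 = psi.
  by apply/funext => x; rewrite /wav !expr0z mul1r subr0 mul1r.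
(* For [n > 0] the copy at [(n, k)] differs from [psi], the copy at [(0, 0)], and is orthogonal to
   it. Divided by the size factor [s], the pairing is [psi (k / 2^n)] times the conjugate of the
   integral of [psi], up to [d / 2^n]; the two inequalities are its real and imaginary parts. *)
have fine_scale (k : int) (n : nat) : (0 < n)%N ->
    `|r (k%:~R / 2 ^+ n) * P + u (k%:~R / 2 ^+ n) * Q| <= d / 2 ^+ n /\
    `|u (k%:~R / 2 ^+ n) * P - r (k%:~R / 2 ^+ n) * Q| <= d / 2 ^+ n.
  move=> n0; pose i : int * int := (n%:Z, k).
  have p0 : 0 < (2 : R) ^+ n by rewrite exprn_gt0.
  pose s : R := Num.sqrt 2 ^+ n * (2 ^+ n)^-1.
  have s0 : 0 < s by rewrite mulr_gt0 ?invr_gt0// exprn_gt0// sqrtr_gt0.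
  have supp x : `|2 ^ i.1 * x - i.2%:~R| <= A ->
      (i.2%:~R - A) / 2 ^ i.1 <= x <= (i.2%:~R - A) / 2 ^ i.1 + 2 * A / 2 ^ i.1.
    rewrite ler_norml => /andP[x1 x2].
    by rewrite -mulrDl ler_pdivrMr// ler_pdivlMr//; lra.
  have o0 : inner psi (wav psi i.1 i.2) = 0.
    rewrite -{1}wav00 orth; case: eqP => //=; rewrite /i /= => e.
    by case: e n0 => <-.
  have eR := re_inner_wav cr cu r0 u0 supp cl.
  have eI := im_inner_wav cr cu r0 u0 supp cl.
  rewrite o0 /= in eR eI.
  have a1 := Iab_dil_approx i A0 L0 cr r0 lr.
  have a2 := Iab_dil_approx i A0 L0 cu u0 lu.
  have a3 := Iab_dil_approx i A0 L0 cr r0 lu.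
  have a4 := Iab_dil_approx i A0 L0 cu u0 lr.
  rewrite -/r -/u in eR eI.
  move: eR eI a1 a2 a3 a4; rewrite /= -!exprnP -/P -/Q !(mulrA (_ ^+ n)) -/s.
  set p1 := Iab _ _ _ ; set q1 := Iab _ _ _; move=> eR; set p2 := Iab _ _ _; set q2 := Iab _ _ _ => eI.
  move=> a1 a2 a3 a4.
  have scale c e : `|c * s| <= e * s -> `|c| <= e.
    by rewrite normrM (gtr0_norm s0) ler_pM2r.
  have dE : d / 2 ^+ n * s = L * (A / 2 ^+ n) * (s * Iab (fun x => `|r x|) (- A) (2 * A)) +
     L * (A / 2 ^+ n) * (s * Iab (fun x => `|u x|) (- A) (2 * A)).
    by rewrite /d; field; rewrite gt_eqF.
  split; apply: scale; rewrite dE.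
    have -> : (r (k%:~R / 2 ^+ n) * P + u (k%:~R / 2 ^+ n) * Q) * s =
      - ((p1 - r (k%:~R / 2 ^+ n) * (s * P)) + (q1 - u (k%:~R / 2 ^+ n) * (s * Q))).
      have -> : q1 = - p1 by apply/eqP; rewrite -addr_eq0 addrC -eR.
      by move: (r _) (u _) (P) (Q) (s) (p1) => *; ring.
    by rewrite normrN; apply: (le_trans (ler_normD _ _)); exact: lerD.
  have -> : (u (k%:~R / 2 ^+ n) * P - r (k%:~R / 2 ^+ n) * Q) * s =
      (q2 - r (k%:~R / 2 ^+ n) * (s * Q)) - (p2 - u (k%:~R / 2 ^+ n) * (s * P)).
    have -> : p2 = q2 by apply/eqP; rewrite -subr_eq0 -eI.
    by move: (r _) (u _) (P) (Q) (s) (q2) => *; ring.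
  by apply: (le_trans (ler_normB _ _)); rewrite [leRHS]addrC; apply: lerD.
(* A dyadic point is also [k 2^(m - n) / 2^m] for all [m > n], so the error at this point can be
   made arbitrarily small. *)
have zero (k : int) (n : nat) : r (k%:~R / 2 ^+ n) * P + u (k%:~R / 2 ^+ n) * Q = 0 /\
    u (k%:~R / 2 ^+ n) * P - r (k%:~R / 2 ^+ n) * Q = 0.
  have same m : (n.+1 <= m)%N -> (k%:~R : R) / 2 ^+ n = (k * (2 ^ (m - n))%:Z)%:~R / 2 ^+ m.
    move=> nm; have -> : m = ((m - n) + n)%N by rewrite subnK// ltnW.
    rewrite addnK intrM -pmulrn natrX exprD; field.
    by rewrite !expf_neq0.
  split; apply: (@small_eq0 _ d n.+1) => m nm; rewrite (same m nm).
    by have [] := fine_scale (k * (2 ^ (m - n))%:Z) m (leq_ltn_trans (leq0n n) nm).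
  by have [] := fine_scale (k * (2 ^ (m - n))%:Z) m (leq_ltn_trans (leq0n n) nm).
(* Otherwise [psi] vanishes at all dyadic points, hence everywhere, against its pairing 1 with
   itself. *)
have PQ0 : P = 0 /\ Q = 0.
  have [PQ|PQ] := eqVneq (P ^+ 2 + Q ^+ 2) 0.
    by move/eqP: PQ; rewrite paddr_eq0 ?sqr_ge0// !sqrf_eq0 => /andP[/eqP -> /eqP ->].
  exfalso.
  have rz x : r x = 0.
    apply: (dyadic_dense lr L0) => k n; have [e1 e2] := zero k n.
    apply: (mulIf PQ); rewrite mul0r; move: (r _) (u _) e1 e2 => p q e1 e2.
    have -> : p * (P ^+ 2 + Q ^+ 2) = (p * P + q * Q) * P - (q * P - p * Q) * Q by ring.
    by rewrite e1 e2 !mul0r subr0.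
  have uz x : u x = 0.
    apply: (dyadic_dense lu L0) => k n; have [e1 e2] := zero k n.
    apply: (mulIf PQ); rewrite mul0r; move: (r _) (u _) e1 e2 => p q e1 e2.
    have -> : q * (P ^+ 2 + Q ^+ 2) = (p * P + q * Q) * Q + (q * P - p * Q) * P by ring.
    by rewrite e1 e2 !mul0r addr0.
  have := orth 0 0 0 0; rewrite wav00 !eqxx /= => /(congr1 (@complex.Re R)).
  rewrite /inner /= /Rintegral integral0_eq => [/esym/eqP|x _]; first by rewrite oner_eq0.
  by rewrite re_mul_conj -/(r x) -/(u x) rz uz !mul0r addr0.
have [PE QE] := PQ0.
by exists A, L; split => //; split => // i a l sup; rewrite (Iab_dil A0 _ _ sup)// ?[X in _ * (_ * X)]PE ?[X in _ * (_ * X)]QE !mulr0.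
Qed.

End WaveletBumps.

(** * Norming functionals *)
Section StepDuality.
Variable R : realType.
Local Notation mu := (@lebesgue_measure R).
Variable rho : (R -> \bar R) -> \bar R.
Hypothesis bfn : banach_function_norm rho.
Hypothesis mrho : maximal_bounded rho.
Local Notation rho' := (assoc_norm rho).

Section Steps.
Variables (B : R) (n : nat).
Hypotheses (B0 : 0 < B) (n0 : (0 < n)%N).

Definition mesh : R := 2 * B / n%:R.
(** Half-open, so that the cells partition [[- B, B)]. *)
Definition cell (i : nat) : set R := `[- B + i%:R * mesh, - B + i.+1%:R * mesh[%classic.
Definition step (c : nat -> R) (x : R) : R := \sum_(i < n) c i * \1_(cell i) x.

Lemma mesh_gt0 : 0 < mesh.
Proof. by rewrite divr_gt0 ?mulr_gt0// ltr0n. Qed.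

Lemma cell_measurable i : measurable (cell i).
Proof. exact: measurable_itv. Qed.

Lemma step_in x : - B <= x < B -> exists k, [/\ (k < n)%N, cell k x & forall c, step c x = c k].
Proof.
move=> /andP[Bx xB]; have d0 := mesh_gt0.
have u0 : 0 <= (x + B) / mesh by rewrite divr_ge0 ?(ltW d0)//; lra.
have /andP[k1 k2] := truncn_itv u0; set k := Num.truncn _ in k1 k2.
rewrite ler_pdivlMr// in k1; rewrite ltr_pdivrMr// in k2.
have nE : n%:R * mesh = 2 * B by rewrite /mesh mulrC divfK// pnatr_eq0 -lt0n.
have kn : (k < n)%N by rewrite -(ltr_nat R) -(ltr_pM2r d0) nE; lra.
have xk : cell k x by rewrite /cell /= in_itv/=; apply/andP; split; lra.
exists k; split => // c; rewrite /step (bigD1 (Ordinal kn))//= indicE mem_set// mulr1.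
rewrite big1 ?addr0// => i ik; rewrite indicE memNset ?mulr0//.
rewrite /cell /= in_itv/= => /andP[i1 i2].
have ik1 : (i < k.+1)%N by rewrite -(ltr_nat R) -(ltr_pM2r d0); lra.
have ki1 : (k < i.+1)%N by rewrite -(ltr_nat R) -(ltr_pM2r d0); lra.
by move/eqP: ik; apply; apply/val_inj => /=; apply/eqP; rewrite eqn_leq -ltnS ik1 -ltnS ki1.
Qed.

Lemma step_out c x : ~ (- B <= x < B) -> step c x = 0.
Proof.
move=> xB; have d0 := mesh_gt0.
have nE : n%:R * mesh = 2 * B by rewrite /mesh mulrC divfK// pnatr_eq0 -lt0n.
rewrite /step big1// => i _; rewrite indicE memNset ?mulr0//.
rewrite /cell /= in_itv/= => /andP[i1 i2]; apply: xB.
have : i%:R * mesh >= 0 by rewrite mulr_ge0// ltW.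
have : i.+1%:R * mesh <= n%:R * mesh by rewrite ler_pM2r// ler_nat.
by rewrite nE => h1 h2; apply/andP; split; lra.
Qed.

Lemma step_norm c x : `|step c x| = step (fun i => `|c i|) x.
Proof.
have [/step_in[k [_ _ h]]|h] := pselect (- B <= x < B); first by rewrite !h.
by rewrite !step_out// normr0.
Qed.

Lemma step_ge0 c x : (forall i, 0 <= c i) -> 0 <= step c x.
Proof. by move=> c0; apply: sumr_ge0 => i _; rewrite mulr_ge0// indicE. Qed.

Lemma step_measurable c : measurable_fun setT (step c).
Proof.
apply: measurable_sum => i; apply: measurable_funM => //.
exact: measurable_indic (cell_measurable i).
Qed.

Lemma nnmf_step c : (forall i, 0 <= c i) -> nnmf (fun x => (step c x)%:E).
Proof.
move=> c0; split; last by move=> x; rewrite lee_fin step_ge0.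
by apply/measurable_EFinP; exact: step_measurable.
Qed.

Lemma integral_step c (f : R -> \bar R) : nnmf f -> (forall i, 0 <= c i) ->
  (\int[mu]_x (f x * (step c x)%:E) = \sum_(i < n) (c i)%:E * \int[mu]_(x in cell i) f x)%E.
Proof.
move=> [mf f0] c0.
rewrite (_ : (fun x => f x * (step c x)%:E)%E =
   (fun x => \sum_(i < n) (c i)%:E * (f x * (\1_(cell i) x)%:E))%E); last first.
  apply/funext => x; rewrite /step -sumEFin ge0_sume_distrr; last first.
    by move=> i _; rewrite lee_fin mulr_ge0// indicE.
  by apply: eq_bigr => i _; rewrite EFinM muleCA.
have mi (i : 'I_n) : measurable_fun setT (fun x => f x * (\1_(cell i) x)%:E)%E.
  apply: emeasurable_funM => //; apply/measurable_EFinP.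
  exact: measurable_indic (cell_measurable i).
rewrite ge0_integral_sum//; last 2 first.
- by move=> i; apply: measurable_funeM; exact: mi.
- by move=> i x _; rewrite !mule_ge0// lee_fin.
apply: eq_bigr => i _; rewrite ge0_integralZl ?lee_fin//; last 2 first.
- exact: mi.
- by move=> x _; rewrite mule_ge0// lee_fin.
congr (_ * _)%E; rewrite [RHS]integral_mkcond; apply: eq_integral => x _.
by rewrite /patch indicE; case: ifP => _; rewrite ?mule1 ?mule0.
Qed.

Let X (f : R -> R) := measurable_fun setT f /\
  exists M : R, 0 <= M /\ forall x, `|f x| <= M * \1_`[- B, B] x.

Let p (f : R -> R) := fine (rho (fun x => `|f x|%:E)).

Let nnmf_norm (f : R -> R) : measurable_fun setT f -> nnmf (fun x => `|f x|%:E).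
Proof.
move=> mf; split; last by move=> x; rewrite lee_fin.
by apply/measurable_EFinP; exact: measurableT_comp.
Qed.

Let X_fin f : X f -> rho (fun x => `|f x|%:E) \is a fin_num.
Proof.
move=> [mf [M [M0 fM]]]; rewrite ge0_fin_numE; last exact: (bfn_ge0 bfn (nnmf_norm mf)).
have ni := nnmf_indic (E := `[- B, B]%classic) (measurable_itv _).
apply: (@le_lt_trans _ _ (M%:E * rho (fun x => (\1_`[(- B)%R, B] x)%:E))%E).
  rewrite -(bfn_homog bfn ni M0); apply: (bfn_lattice bfn) => //.
  - exact: nnmfZ.
  - exact: nnmf_norm.
  - by apply: ae_all => x; rewrite -EFinM lee_fin.
apply: lte_mul_pinfty => //; exact: (indic_itv_finite bfn).
Qed.

Let p_sublinear : sublinear (fun a (f : R -> R) x => a * f x) X p.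
Proof.
split.
  move=> f g Xf Xg; have [mf _] := Xf; have [mg _] := Xg.
  have nf := nnmf_norm mf; have ng := nnmf_norm mg.
  have mfg : measurable_fun setT (f + g) by exact: measurable_funD.
  rewrite /p -fineD ?X_fin//; apply: fine_le.
  - apply: X_fin; split => //.
    have [_ [M [M0 fM]]] := Xf; have [_ [M' [M'0 gM']]] := Xg.
    exists (M + M'); split; first exact: addr_ge0.
    by move=> x; apply: (le_trans (ler_normD _ _)); rewrite mulrDl lerD.
  - by rewrite fin_numD !X_fin.
  - apply: le_trans (bfn_subadd bfn nf ng); apply: (bfn_lattice bfn).
    + exact: nnmfD.
    + exact: nnmf_norm.
    + by apply: ae_all => x; rewrite -EFinD lee_fin; exact: ler_normD.
move=> t f t0 [mf _]; rewrite /p.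
rewrite (_ : (fun x => `|t * f x|%:E) = (fun x => t%:E * `|f x|%:E)%E); last first.
  by apply/funext => x; rewrite normrM gtr0_norm.
rewrite (bfn_homog bfn (nnmf_norm mf) (ltW t0)).
have [M|M] := boolP (rho (fun x => `|f x|%:E) \is a fin_num); first by rewrite fineM.
have -> : rho (fun x => `|f x|%:E) = +oo%E.
  have := bfn_ge0 bfn (nnmf_norm mf); move: M; rewrite fin_numE negb_and !negbK.
  by case/orP => /eqP ->.
by rewrite gt0_muley//= mulr0.
Qed.

Let X_indic i : X (\1_(cell i)) \/ ~~ (i < n)%N.
Proof.
have [iN|] := boolP (i < n)%N; [left|by right].
have d0 := mesh_gt0.
have nE : n%:R * mesh = 2 * B by rewrite /mesh mulrC divfK// pnatr_eq0 -lt0n.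
split; first exact: measurable_indic (cell_measurable i).
exists 1; split => // x; rewrite mul1r !indicE.
have [xi|] := boolP (x \in cell i); last by rewrite normr0 ler0n.
rewrite normr1; have : cell i x by rewrite inE in xi.
rewrite /cell /= in_itv/= => /andP[i1 i2].
have h1 : i%:R * mesh >= 0 by rewrite mulr_ge0// ltW.
have h2 : i.+1%:R * mesh <= n%:R * mesh by rewrite ler_pM2r// ler_nat.
by rewrite mem_set//= in_itv/=; apply/andP; split; lra.
Qed.

(* A functional attaining the norm of a step function is integration against a step
   function, whose associate norm is controlled because averaging over the cells is
   dominated by the maximal operator. *)
Lemma step_norming (K : R) (v : nat -> R) : 0 < K ->
  (forall f, nnmf f -> (rho f < +oo)%E -> (rho (maximal_fun f) <= K%:E * rho f)%E) ->
  (forall i, 0 <= v i) ->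
  exists c : nat -> R, [/\ forall i, 0 <= c i,
    (rho' (fun x => (step c x)%:E) <= K%:E)%E &
    (rho (fun x => (step v x)%:E) <= \int[mu]_x ((step v x)%:E * (step c x)%:E))%E].
Proof.
move=> K0 hK v0.
pose sc (a : R) (f : R -> R) : R -> R := fun x => a * f x.
have XD f g : X f -> X g -> X (f + g).
  move=> [mf [M [M0 fM]]] [mg [M' [M'0 gM']]]; split; first exact: measurable_funD.
  exists (M + M'); split; first exact: addr_ge0.
  by move=> x; apply: (le_trans (ler_normD _ _)); rewrite mulrDl lerD.
have XZ a f : X f -> X (sc a f).
  move=> [mf [M [M0 fM]]]; split; first exact: measurable_funM.
  exists (`|a| * M); split; first exact: mulr_ge0.
  by move=> x; rewrite /sc normrM -mulrA ler_wpM2l.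
have X0 : X 0.
  split; first exact: measurable_cst.
  by exists 0; split => // x; rewrite normr0 mul0r.
have Xcell (i : 'I_n) : X (\1_(cell i)) by have [//|] := X_indic i; rewrite ltn_ord.
have stepE c : step c = \sum_(i < n) sc (c i) (\1_(cell i)).
  by apply/funext => x; rewrite /step fct_sumE.
have Xstep c : X (step c).
  by rewrite stepE; elim/big_ind : _ => // i _; exact: XZ.
have [||||l [lD lZ lp lv]] := @hahn_banach_point R (R -> R)%type sc X _ _ _ _ XD XZ p (step v)
   p_sublinear (Xstep v).
- by move=> a b f; apply/funext => x; rewrite /sc mulrDl.
- by move=> a f g; apply/funext => x; rewrite /sc mulrDr.
- by move=> a b f; apply/funext => x; rewrite /sc mulrA.
- by move=> f; apply/funext => x; rewrite /sc mul1r.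
have l0 : l 0 = 0 by have := lD 0 0 X0 X0; rewrite addr0 => h; lra.
have lstep c : l (step c) = \sum_(i < n) c i * l (\1_(cell i)).
  rewrite stepE.
  have [_ ->] : X (\sum_(i < n) sc (c i) (\1_(cell i))) /\
     l (\sum_(i < n) sc (c i) (\1_(cell i))) = \sum_(i < n) l (sc (c i) (\1_(cell i))).
    elim/big_rec2 : _ => [//|i y f _ [Xf <-]]; split; first by apply: XD => //; exact: XZ.
    by rewrite lD//; exact: XZ.
  by apply: eq_bigr => i _; rewrite lZ.
pose b i := l (\1_(cell i)).
have d0 := mesh_gt0.
(* Division by the mesh turns the value of [l] on a cell into a density. Taking moduli is harmless:
   the signs go into the test function [sg] below, and [v] is nonnegative. *)
pose c i := `|b i| / mesh.
have c0 i : 0 <= c i by rewrite divr_ge0// ltW.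
have cell_mu i : (\int[mu]_(x in cell i) 1 = mesh%:E)%E.
  rewrite integral_cst/=; last exact: cell_measurable.
  rewrite mul1e /cell lebesgue_measure_itv/= lte_fin ltrD2l ltr_pM2r// ltr_nat ltnS leqnn.
  by rewrite -EFinD; congr (_%:E); rewrite -natr1; ring.
exists c; split => //.
- apply: ge_ereal_sup => _ [f [nf rf] <-].
  have [mf f0] := nf.
  have rfin : (rho f < +oo)%E by rewrite (le_lt_trans rf)// ltry.
  rewrite integral_step//.
  have If (i : nat) : (\int[mu]_(x in cell i) f x)%E \is a fin_num.
    rewrite ge0_fin_numE; last exact: integral_ge0.
    apply: le_lt_trans (sn_loc (bfn_sublinear bfn) (- B + i%:R * mesh) (- B + i.+1%:R * mesh) nf rfin).
    apply: ge0_subset_integral => //; first exact: cell_measurable.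
      exact: measurable_funS mf.
    by apply: subset_itvl; rewrite bnd_simp.
  pose m i := fine (\int[mu]_(x in cell i) f x)%E / mesh.
  have m0 i : 0 <= m i by rewrite divr_ge0 ?(ltW d0)// fine_ge0// integral_ge0.
  (* Up to signs this is the mean of [f] on each cell, hence at most [maximal_fun f] in modulus. *)
  pose sg i := Num.sg (b i) * m i.
  have lE : l (step sg) = \sum_(i < n) c i * fine (\int[mu]_(x in cell i) f x)%E.
    rewrite lstep; apply: eq_bigr => i _; rewrite /sg /c /m -/(b i).
    have := numEsg (b i); have := normrEsg (b i) => h1 h2.
    by rewrite h1; field; rewrite gt_eqF.
  have -> : (\sum_(i < n) (c i)%:E * \int[mu]_(x in cell i) f x =
     (l (step sg))%:E)%E.
    rewrite lE -sumEFin; apply: eq_bigr => i _.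
    by rewrite -{1}(fineK (If i)) -EFinM.
  apply: (@le_trans _ _ (p (step sg))%:E); first by rewrite lee_fin lp.
  rewrite /p fineK; last exact: X_fin.
  apply: (@le_trans _ _ (rho (maximal_fun f))).
    apply: (bfn_lattice bfn).
    + exact: nnmf_maximal.
    + by apply: nnmf_norm; exact: step_measurable.
    + apply: ae_all => x; rewrite step_norm.
      have [/step_in[k [kn xk h]]|h] := pselect (- B <= x < B); last first.
        by rewrite step_out//; case: (nnmf_maximal nf).
      rewrite h normrM.
      apply: (@le_trans _ _ (m k)%:E).
        rewrite lee_fin [`|m k|]ger0_norm// ler_piMl//.
        by rewrite normr_sg; case: (b k != 0).
      move: xk; rewrite /cell /= in_itv/= => /andP[k1 k2].
      have kk : - B + k%:R * mesh < - B + k.+1%:R * mesh.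
        by rewrite ltrD2l ltr_pM2r// ltr_nat.
      have xkk : - B + k%:R * mesh <= x <= - B + k.+1%:R * mesh by rewrite k1 ltW.
      have := maximal_fun_ge f kk xkk.
      have -> : - B + k.+1%:R * mesh - (- B + k%:R * mesh) = mesh by rewrite -natr1; ring.
      move=> h3; rewrite /m mulrC EFinM fineK// lee_pdivrMl//; apply: le_trans h3.
      apply: ge0_subset_integral => //; first exact: cell_measurable.
        exact: measurable_funS mf.
      by apply: subset_itvl; rewrite bnd_simp.
  apply: (le_trans (hK f nf rfin)).
  by rewrite -[leRHS]mule1 lee_wpmul2l// lee_fin ltW.
- have nv := nnmf_step v0.
  rewrite integral_step//.
  have -> : rho (fun x => (step v x)%:E) = (l (step v))%:E.
    rewrite lv /p fineK; last exact: X_fin.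
    by congr rho; apply/funext => x; rewrite ger0_norm// step_ge0.
  rewrite lstep -sumEFin; apply: lee_sum => i _.
  have -> : (\int[mu]_(x in cell i) (step v x)%:E = (v i * mesh)%:E)%E.
    rewrite EFinM -(cell_mu i) -ge0_integralZl//; last 2 first.
    + exact: cell_measurable.
    + by rewrite lee_fin.
    apply: eq_integral => x; rewrite inE => xi; rewrite mule1; congr (_%:E).
    rewrite /step (bigD1 i)//= indicE mem_set// mulr1 big1 ?addr0// => j ji.
    rewrite indicE memNset ?mulr0//.
    move: xi; rewrite /cell /= !in_itv/= => /andP[i1 i2] /andP[j1 j2].
    have ik1 : (i < j.+1)%N by rewrite -(ltr_nat R) -(ltr_pM2r d0); lra.
    have ki1 : (j < i.+1)%N by rewrite -(ltr_nat R) -(ltr_pM2r d0); lra.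
    by move/eqP: ji; apply; apply/val_inj => /=; apply/eqP; rewrite eqn_leq -ltnS ki1 -ltnS ik1.
  rewrite -EFinM lee_fin /c.
  have -> : `|b i| / mesh * (v i * mesh) = v i * `|b i| by field; rewrite gt_eqF.
  by rewrite ler_wpM2l// ler_norm.
Qed.

End Steps.
End StepDuality.

(** * Norms of Lipschitz functions by duality *)

Section DualBound.
Variable R : realType.
Local Notation C := (R[i]).
Local Notation mu := (@lebesgue_measure R).
Variable rho : (R -> \bar R) -> \bar R.
Hypothesis bfn : banach_function_norm rho.
Hypothesis mrho : maximal_bounded rho.
Local Notation rho' := (assoc_norm rho).

(** A form of the duality [rho'' = rho] of Lorentz and Luxemburg, with a constant [K] from the bound
    for the maximal operator. Sampling [h] on [n] cells makes an error of at most [L * mesh] on the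
    support, which is small both in norm and in the pairing; [step_norming] treats the samples, and
    [n] tends to infinity. *)
Lemma dual_bound : exists2 K : R, 0 < K & forall (h : R -> R) (L B C0 : R),
  0 < B -> 0 <= L -> 0 <= C0 -> lipschitz_with L h -> (forall x, 0 <= h x) ->
  (forall x, ~ (- B <= x < B) -> h x = 0) ->
  (forall g : R -> R, measurable_fun setT g -> (forall x, 0 <= g x) ->
     (rho' (fun x => (g x)%:E) <= 1)%E -> Iab (fun x => h x * g x) (- B) (2 * B) <= C0) ->
  (rho (fun x => (h x)%:E) <= (K * C0)%:E)%E.
Proof.
have sr := bfn_sublinear bfn; have sa := assoc_sublinear bfn.
have [K K0 hK] := maximal_bounded_nnmf sr mrho.
exists K => // h L B C0 B0 L0 C00 hL h0 hB hC.
have ch := lipschitz_continuous hL.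
pose chi x : \bar R := (\1_`[- B, B]%classic x)%:E.
have nchi : nnmf chi by exact: nnmf_indic.
have rchi : rho chi \is a fin_num.
  by rewrite ge0_fin_numE ?(bfn_ge0 bfn)//; exact: (indic_itv_finite bfn).
pose u := fine (rho chi); have u0 : 0 <= u by rewrite fine_ge0// (bfn_ge0 bfn).
have nh : nnmf (fun x => (h x)%:E).
  split; last by move=> x; rewrite lee_fin.
  by apply/measurable_EFinP; exact: continuous_measurable_fun.
have step_n n : (0 < n)%N ->
    (rho (fun x => (h x)%:E) <= (K * C0 + L * mesh B n * (u * (K + 1)))%:E)%E.
  move=> n0; have d0 := mesh_gt0 B0 n0.
  have Ld0 : 0 <= L * mesh B n by rewrite mulr_ge0// ltW.
  pose v i := h (- B + i%:R * mesh B n).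
  have v0 i : 0 <= v i by exact: h0.
  have [c [c0 rc rv]] := step_norming bfn B0 n0 K0 hK v0.
  have near_step x : `|h x - step B n v x| <= L * mesh B n * \1_`[- B, B]%classic x.
    have [xB|xB] := pselect (- B <= x < B); last first.
      by rewrite (step_out B0 n0 _ xB) hB// subr0 normr0 mulr_ge0// indicE.
    have [k [kn xk ->]] := step_in B0 n0 xB.
    have -> : \1_`[- B, B]%classic x = 1 :> R.
      by rewrite indicE mem_set//= in_itv/=; case/andP: xB => -> /ltW ->.
    rewrite mulr1; apply: (le_trans (hL _ _)); apply: ler_wpM2l => //.
    move: xk; rewrite /cell /= in_itv/= -natr1 => /andP[k1 k2].
    by rewrite ler_norml; lra.
  have nsv := nnmf_step B n v0; have nsc := nnmf_step B n c0.
  pose g x := step B n c x / K.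
  have mg : measurable_fun setT g.
    by apply: measurable_funM => //; exact: step_measurable.
  have g0 x : 0 <= g x by rewrite divr_ge0 ?(ltW K0)// step_ge0.
  have rg : (rho' (fun x => (g x)%:E) <= 1)%E.
    have Ki0 : 0 <= K^-1 by rewrite invr_ge0 ltW.
    have := sn_homog sa nsc Ki0; rewrite (_ : (fun x => K^-1%:E * (step B n c x)%:E)%E = (fun x => (g x)%:E)).
      move=> /le_trans; apply; apply: (@le_trans _ _ (K^-1%:E * K%:E)%E).
        by rewrite lee_wpmul2l.
      by rewrite -EFinM mulVf// gt_eqF.
    by apply/funext => x; rewrite -EFinM mulrC.
  have hg := hC g mg g0 rg.
  have ng : nnmf (fun x => (g x)%:E).
    by split; [exact/measurable_EFinP|move=> x; rewrite lee_fin].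
  have lg : loc_int g.
    apply: (nnmf_fine_loc_int ng) => a b; apply: (sn_loc sa) => //.
    by apply: (le_lt_trans rg); rewrite ltry.
  have lhg : loc_int (fun x => h x * g x).
    have := loc_int_mul_continuous lg ch.
    by congr loc_int; apply/funext => x; rewrite mulrC.
  have Ihg : (\int[mu]_x ((h x)%:E * (g x)%:E) <= C0%:E)%E.
    apply: (@le_trans _ _ (Iab (fun x => h x * g x) (- B) (2 * B))%:E); last by rewrite lee_fin.
    have AE : - B + 2 * B = B by ring.
    rewrite /Iab AE /Rintegral fineK; last exact: integrable_fin_num (lhg _ _).
    rewrite [leRHS]integral_mkcond le_eqVlt; apply/orP; left; apply/eqP.
    apply: eq_integral => x _; rewrite /patch; case: ifPn => //.
    rewrite notin_setE/= in_itv/= => xB; rewrite hB ?mul0e// => /andP[x1 x2].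
    by apply: xB; rewrite x1 ltW.
  have Ichi : (\int[mu]_x (chi x * (g x)%:E) <= u%:E)%E.
    apply: (le_trans (hoelder_assoc bfn nchi ng _)).
      by rewrite -ge0_fin_numE// (bfn_ge0 bfn).
    rewrite -(fineK rchi) -[leRHS]mule1 lee_wpmul2l// lee_fin; exact: u0.
  have nLchi : nnmf (fun x => (L * mesh B n)%:E * chi x)%E by exact: nnmfZ.
  have rs : (rho (fun x => (step B n v x)%:E) <= K%:E * (C0%:E + (L * mesh B n)%:E * u%:E))%E.
    apply: (le_trans rv).
    have -> : (\int[mu]_x ((step B n v x)%:E * (step B n c x)%:E) =
       K%:E * \int[mu]_x ((step B n v x)%:E * (g x)%:E))%E.
      rewrite -ge0_integralZl//; last 3 first.
      - by apply: emeasurable_funM; [case: nsv|case: ng].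
      - by move=> x _; rewrite mule_ge0// lee_fin// step_ge0.
      - by rewrite lee_fin ltW.
      apply: eq_integral => x _; rewrite -!EFinM; congr (_%:E); rewrite /g; field.
      by rewrite gt_eqF.
    apply: lee_wpmul2l; first by rewrite lee_fin ltW.
    apply: (@le_trans _ _ (\int[mu]_x ((h x)%:E * (g x)%:E + (L * mesh B n)%:E * (chi x * (g x)%:E)))%E).
      apply: ge0_le_integral => //.
      - by move=> x _; rewrite mule_ge0// lee_fin// step_ge0.
      - by apply: emeasurable_funM; [case: nsv|case: ng].
      - apply: emeasurable_funD; first by apply: emeasurable_funM; [case: nh|case: ng].
        by apply: measurable_funeM; apply: emeasurable_funM; [case: nchi|case: ng].
      - move=> x _; rewrite /chi -!EFinM -EFinD lee_fin mulrA -mulrDl ler_wpM2r//.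
        by have := near_step x; rewrite ler_norml => /andP[h1 h2]; lra.
    have m1 : measurable_fun setT (fun x => (h x)%:E * (g x)%:E)%E.
      by apply: emeasurable_funM; [case: nh|case: ng].
    have m2 : measurable_fun setT (fun x => chi x * (g x)%:E)%E.
      by apply: emeasurable_funM; [case: nchi|case: ng].
    have m3 : measurable_fun setT (fun x => (L * mesh B n)%:E * (chi x * (g x)%:E))%E.
      exact: measurable_funeM.
    have p2 x : (0 <= chi x * (g x)%:E)%E by rewrite mule_ge0 ?lee_fin//; case: nchi.
    have p1 x : (0 <= (h x)%:E * (g x)%:E)%E by apply: mule_ge0; rewrite lee_fin.
    have p3 x : (0 <= (L * mesh B n)%:E * (chi x * (g x)%:E))%E.
      by apply: mule_ge0 => //; rewrite lee_fin.
    rewrite ge0_integralD//.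
    apply: leeD => //; rewrite ge0_integralZl ?lee_fin//.
    by rewrite lee_wpmul2l// lee_fin.
  apply: (@le_trans _ _ (rho (fun x => (step B n v x)%:E + (L * mesh B n)%:E * chi x))%E).
    apply: (bfn_lattice bfn) => //; first exact: nnmfD.
    apply: ae_all => x; rewrite /chi -EFinM -EFinD lee_fin.
    by have := near_step x; rewrite ler_norml => /andP[h1 h2]; lra.
  apply: (le_trans (bfn_subadd bfn nsv nLchi)); rewrite (bfn_homog bfn nchi Ld0).
  apply: (le_trans (leeD rs (lexx _))); rewrite -(fineK rchi) -/u.
  rewrite -?EFinM -?EFinD -?EFinM -?EFinD lee_fin.
  by rewrite le_eqVlt; apply/orP; left; apply/eqP; ring.
have r0 := bfn_ge0 bfn nh.
have rfin : rho (fun x => (h x)%:E) \is a fin_num.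
  by rewrite ge0_fin_numE// (le_lt_trans (step_n 1%N isT))// ltry.
rewrite -(fineK rfin) lee_fin; apply/ler_addgt0Pl => e e0.
pose D := L * (2 * B) * (u * (K + 1)).
have D0 : 0 <= D by rewrite !mulr_ge0 ?addr_ge0// ltW.
pose n := (Num.truncn (D / e)).+1.
have := step_n n isT; rewrite -(fineK rfin) lee_fin => /le_trans; apply.
rewrite addrC lerD2r /mesh.
have -> : L * (2 * B / n%:R) * (u * (K + 1)) = D / n%:R by rewrite /D; field; rewrite pnatr_eq0.
rewrite ler_pdivrMr ?ltr0n// mulrC -ler_pdivrMr//.
by apply: ltW; exact: truncnS_gt.
Qed.

End DualBound.

(** * Uniformly bounded expansion operators *)
Section OperatorBound.
Variable R : realType.
Local Notation C := (R[i]).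
Local Notation mu := (@lebesgue_measure R).

Lemma re_sum (I : Type) (s : seq I) (F : I -> C) :
  complex.Re (\sum_(i <- s) F i) = \sum_(i <- s) complex.Re (F i).
Proof. by apply: (big_morph (@complex.Re R)) => // -[a b] [c d]. Qed.

Lemma im_sum (I : Type) (s : seq I) (F : I -> C) :
  complex.Im (\sum_(i <- s) F i) = \sum_(i <- s) complex.Im (F i).
Proof. by apply: (big_morph (@complex.Im R)) => // -[a b] [c d]. Qed.

Lemma loc_int_sum (I : Type) (s : seq I) (F : I -> R -> R) : (forall i, loc_int (F i)) ->
  loc_int (fun x => \sum_(i <- s) F i x).
Proof.
move=> hF; elim: s => [|i s IH].
  have -> : (fun x : R => \sum_(i <- [::]) F i x) = (fun=> 0) by apply/funext => x; rewrite big_nil.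
  by apply: loc_int_continuous => x; exact: cvg_cst.
have -> : (fun x => \sum_(j <- i :: s) F j x) = (fun x => F i x + \sum_(j <- s) F j x).
  by apply/funext => x; rewrite big_cons.
exact: loc_intD.
Qed.

Lemma Iab_sum (I : Type) (s : seq I) (F : I -> R -> R) a l : (forall i, loc_int (F i)) ->
  Iab (fun x => \sum_(i <- s) F i x) a l = \sum_(i <- s) Iab (F i) a l.
Proof.
move=> hF; elim: s => [|i s IH].
  rewrite big_nil (_ : (fun x : R => \sum_(i <- [::]) F i x) = (fun=> 0)).
    by rewrite /Iab /Rintegral integral0_eq.
  by apply/funext => x; rewrite big_nil.
rewrite big_cons -IH -IabD//; last exact: loc_int_sum.
by congr Iab; apply/funext => x; rewrite big_cons.
Qed.

Lemma lipschitz_sum (I : Type) (s : seq I) (F : I -> R -> R) (M : I -> R) :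
  (forall i, 0 <= M i) -> (forall i, lipschitz_with (M i) (F i)) ->
  lipschitz_with (\sum_(i <- s) M i) (fun x => \sum_(i <- s) F i x).
Proof.
move=> M0 hF x y; rewrite -sumrB mulr_suml; apply: (le_trans (ler_norm_sum _ _ _)).
by apply: ler_sum => i _; exact: hF.
Qed.

Lemma lipschitz_norm M (h : R -> R) : lipschitz_with M h -> lipschitz_with M (fun x => `|h x|).
Proof. by move=> hM x y; apply: le_trans (hM x y); exact: ler_dist_dist. Qed.

Lemma lipschitz_comb M M' (h h' : R -> R) a b : lipschitz_with M h -> lipschitz_with M' h' ->
  lipschitz_with (`|a| * M + `|b| * M') (fun x => a * h x + b * h' x).
Proof.
move=> hM hM' x y.
have -> : a * h x + b * h' x - (a * h y + b * h' y) = a * (h x - h y) + b * (h' x - h' y) by ring.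
apply: (le_trans (ler_normD _ _)); rewrite !normrM mulrDl -!mulrA.
by apply: lerD; apply: ler_wpM2l.
Qed.

(** The interval is half-open to match the cells behind [dual_bound]. *)
Lemma common_support A (s : seq (int * int)) : exists2 B : R, 0 < B &
  forall i, i \in s -> forall x, `|2 ^ i.1 * x - i.2%:~R| <= A -> - B <= x < B.
Proof.
elim: s => [|i s [B B0 hB]]; first by exists 1.
pose B' := `|(`|i.2%:~R| + A) / 2 ^ i.1| + 1.
have p0 : 0 < (2 : R) ^ i.1 by rewrite exprz_gt0.
exists (B + B'); first by rewrite addr_gt0// ltr_wpDl.
move=> j; rewrite inE => /predU1P[->|js] x xA; last first.
  have /andP[h1 h2] := hB j js x xA; have : 0 <= B' by rewrite addr_ge0.
  by move=> ?; apply/andP; split; lra.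
have h : `|x| <= (`|i.2%:~R| + A) / 2 ^ i.1.
  rewrite ler_pdivlMr// mulrC -[2 ^ i.1 in X in X <= _]gtr0_norm// -normrM.
  have -> : 2 ^ i.1 * x = i.2%:~R + (2 ^ i.1 * x - i.2%:~R) by ring.
  by apply: (le_trans (ler_normD _ _)); rewrite lerD2l.
have := le_trans h (ler_norm _); rewrite ler_norml /B'; move: `|_| => z /andP[h1 h2].
by apply/andP; split; lra.
Qed.

Lemma cauchy_schwarz2 (p q r t : R) :
  `|p * r + q * t| <= Num.sqrt (p ^+ 2 + q ^+ 2) * Num.sqrt (r ^+ 2 + t ^+ 2).
Proof.
rewrite -sqrtrM ?addr_ge0 ?sqr_ge0// -sqrtr_sqr ler_wsqrtr//.
have := sqr_ge0 (p * t - q * r); lra.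
Qed.

Lemma normcE (z : C) : Normc.normc z = Num.sqrt (complex.Re z ^+ 2 + complex.Im z ^+ 2).
Proof. by case: z. Qed.

Variables (psi : R -> C) (L A : R).
Hypothesis A0 : 0 < A.
Hypothesis bre : bump L A (fun y => complex.Re (psi y)).
Hypothesis bim : bump L A (fun y => complex.Im (psi y)).
Local Notation thr := (fun y => complex.Re (psi y)).
Local Notation thi := (fun y => complex.Im (psi y)).
Local Notation wv i := (wav psi i.1 i.2).

Let L0 : 0 <= L. Proof. by case: bre. Qed.
Let lr : lipschitz_with L thr. Proof. by case: bre. Qed.
Let li : lipschitz_with L thi. Proof. by case: bim. Qed.
Let zr x : A < `|x| -> thr x = 0. Proof. by case: bre => _ _ + _; exact. Qed.
Let zi x : A < `|x| -> thi x = 0. Proof. by case: bim => _ _ + _; exact. Qed.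
Let cr : continuous thr := lipschitz_continuous lr.
Let ci : continuous thi := lipschitz_continuous li.

Definition wave_sum (s : seq (int * int)) (a : int * int -> C) (x : R) : C :=
  \sum_(i <- s) a i * wv i x.

Lemma re_wave_sum s a x : complex.Re (wave_sum s a x) =
  \sum_(i <- s) (complex.Re (a i) * dil thr i x + - complex.Im (a i) * dil thi i x).
Proof.
rewrite /wave_sum re_sum; apply: eq_bigr => i _; rewrite -re_wav -im_wav mulNr.
by case: (a i) (wv i x) => [? ?] [? ?].
Qed.

Lemma im_wave_sum s a x : complex.Im (wave_sum s a x) =
  \sum_(i <- s) (complex.Im (a i) * dil thr i x + complex.Re (a i) * dil thi i x).
Proof.
rewrite /wave_sum im_sum; apply: eq_bigr => i _; rewrite -re_wav -im_wav.
by case: (a i) (wv i x) => [? ?] [? ?] /=; rewrite addrC.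
Qed.

Let dL (i : int * int) : R := Num.sqrt 2 ^ i.1 * 2 ^ i.1 * L.
Let dL0 i : 0 <= dL i. Proof. by rewrite mulr_ge0// mulr_ge0// exprz_ge0// sqrtr_ge0. Qed.

Lemma wave_sum_lipschitz s a : exists2 M, 0 <= M &
  lipschitz_with M (fun x => complex.Re (wave_sum s a x)) /\
  lipschitz_with M (fun x => complex.Im (wave_sum s a x)).
Proof.
pose M i := `|complex.Re (a i)| * dL i + `|complex.Im (a i)| * dL i.
have M0 i : 0 <= M i by apply: addr_ge0; exact: mulr_ge0 (dL0 i).
exists (\sum_(i <- s) M i); first exact: sumr_ge0.
split.
  have -> : (fun x => complex.Re (wave_sum s a x)) =
    (fun x => \sum_(i <- s) (complex.Re (a i) * dil thr i x + - complex.Im (a i) * dil thi i x)).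
    by apply/funext => x; rewrite re_wave_sum.
  apply: lipschitz_sum => // i; rewrite /M -[`|complex.Im _|]normrN.
  by apply: lipschitz_comb; exact: dil_lipschitz.
have -> : (fun x => complex.Im (wave_sum s a x)) =
  (fun x => \sum_(i <- s) (complex.Im (a i) * dil thr i x + complex.Re (a i) * dil thi i x)).
  by apply/funext => x; rewrite im_wave_sum.
apply: lipschitz_sum => // i; rewrite /M addrC.
by apply: lipschitz_comb; exact: dil_lipschitz.
Qed.

Lemma wave_sum_supported s a B : (forall i, i \in s -> forall x, `|2 ^ i.1 * x - i.2%:~R| <= A -> - B <= x < B) ->
  forall x, ~ (- B <= x < B) -> wave_sum s a x = 0.
Proof.
move=> hB x xB; rewrite /wave_sum big_seq big1// => i is_.
have h : A < `|2 ^ i.1 * x - i.2%:~R| by rewrite ltNge; apply/negP => /(hB i is_).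
have e1 : complex.Re (psi (2 ^ i.1 * x - i.2%:~R)) = 0 by exact: zr.
have e2 : complex.Im (psi (2 ^ i.1 * x - i.2%:~R)) = 0 by exact: zi.
have e3 : psi (2 ^ i.1 * x - i.2%:~R) = 0 by apply/eqP; rewrite eq_complex e1 e2 !eqxx.
by rewrite /wav e3 !mulr0.
Qed.

Definition rc (g : R -> R) (x : R) : C := Complex (g x) 0.

(** Real and imaginary parts will be normed separately, so real test functions suffice; termwise the
    bound is the Cauchy-Schwarz inequality in the plane. *)
Lemma pairing_wave_sum s a B (g : R -> R) : loc_int g ->
  (forall i, i \in s -> forall x, `|2 ^ i.1 * x - i.2%:~R| <= A -> - B <= x < B) ->
  `|Iab (fun x => complex.Re (wave_sum s a x) * g x) (- B) (2 * B)| <=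
    \sum_(i <- s) Normc.normc (a i) * Normc.normc (inner (rc g) (wv i)) /\
  `|Iab (fun x => complex.Im (wave_sum s a x) * g x) (- B) (2 * B)| <=
    \sum_(i <- s) Normc.normc (a i) * Normc.normc (inner (rc g) (wv i)).
Proof.
move=> lg hB.
have crc : cloc_int (rc g) by split => //=; apply: loc_int_continuous => x; exact: cvg_cst.
have AE : - B + 2 * B = B by ring.
have cdr i : continuous (dil thr i) by exact: dil_continuous.
have cdi i : continuous (dil thi i) by exact: dil_continuous.
have lgr i : loc_int (fun x => g x * dil thr i x) by exact: loc_int_mul_continuous.
have lgi i : loc_int (fun x => g x * dil thi i x) by exact: loc_int_mul_continuous.
have Iab0 (h : R -> R) : Iab (fun x => 0 * h x) (- B) (2 * B) = 0.
  by rewrite /Iab /Rintegral integral0_eq// => x _; rewrite mul0r.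
have eR i : i \in s -> complex.Re (inner (rc g) (wv i)) = Iab (fun x => g x * dil thr i x) (- B) (2 * B).
  move=> is_; rewrite (re_inner_wav cr ci zr zi _ crc (a := - B) (l := 2 * B)).
    by rewrite /= Iab0 addr0.
  by move=> x /(hB i is_) /andP[h1 h2]; rewrite AE h1 ltW.
have eI i : i \in s -> complex.Im (inner (rc g) (wv i)) = - Iab (fun x => g x * dil thi i x) (- B) (2 * B).
  move=> is_; rewrite (im_inner_wav cr ci zr zi _ crc (a := - B) (l := 2 * B)).
    by rewrite /= Iab0 sub0r.
  by move=> x /(hB i is_) /andP[h1 h2]; rewrite AE h1 ltW.
have comb (b c : int * int -> R) :
  Iab (fun x => (\sum_(i <- s) (b i * dil thr i x + c i * dil thi i x)) * g x) (- B) (2 * B) =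
  \sum_(i <- s) (b i * complex.Re (inner (rc g) (wv i)) - c i * complex.Im (inner (rc g) (wv i))).
  have -> : (fun x => (\sum_(i <- s) (b i * dil thr i x + c i * dil thi i x)) * g x) =
    (fun x => \sum_(i <- s) (b i * (g x * dil thr i x) + c i * (g x * dil thi i x))).
    by apply/funext => x; rewrite mulr_suml; apply: eq_bigr => i _; ring.
  rewrite Iab_sum; last by move=> i; apply: loc_intD; exact: loc_intZ.
  rewrite big_seq [RHS]big_seq; apply: eq_bigr => i is_.
  rewrite IabD; [|exact: loc_intZ..].
  by rewrite !IabZ// eR// eI// mulrN opprK.
split.
  have -> : (fun x => complex.Re (wave_sum s a x) * g x) =
    (fun x => (\sum_(i <- s) (complex.Re (a i) * dil thr i x + - complex.Im (a i) * dil thi i x)) * g x).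
    by apply/funext => x; rewrite re_wave_sum.
  rewrite comb; apply: (le_trans (ler_norm_sum _ _ _)); apply: ler_sum => i _.
  by rewrite mulNr opprK !normcE cauchy_schwarz2.
have -> : (fun x => complex.Im (wave_sum s a x) * g x) =
  (fun x => (\sum_(i <- s) (complex.Im (a i) * dil thr i x + complex.Re (a i) * dil thi i x)) * g x).
  by apply/funext => x; rewrite im_wave_sum.
rewrite comb; apply: (le_trans (ler_norm_sum _ _ _)); apply: ler_sum => i _.
rewrite addrC -mulrN !normcE; have := cauchy_schwarz2 (complex.Re (a i)) (complex.Im (a i))
  (- complex.Im (inner (rc g) (wv i))) (complex.Re (inner (rc g) (wv i))).
by rewrite sqrrN [X in _ * Num.sqrt X]addrC.
Qed.

Variable rho : (R -> \bar R) -> \bar R.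
Hypothesis bfn : banach_function_norm rho.
Hypothesis mrho : maximal_bounded rho.
Hypothesis mrho' : maximal_bounded (assoc_norm rho).
Local Notation rho' := (assoc_norm rho).

Lemma cmeasurable_continuous (h : R -> C) : continuous (fun x => complex.Re (h x)) ->
  continuous (fun x => complex.Im (h x)) -> cmeasurable h.
Proof. by move=> h1 h2; split; exact: continuous_measurable_fun. Qed.

Lemma cmeasurable_wave_sum s a : cmeasurable (wave_sum s a).
Proof.
have [M M0 [h1 h2]] := wave_sum_lipschitz s a.
by apply: cmeasurable_continuous; [exact: lipschitz_continuous h1|exact: lipschitz_continuous h2].
Qed.

(** The multipliers cost nothing, because [coefficient_bound] already has the moduli inside the sum.
    The factor 2 accounts for real and imaginary parts. *)
Lemma operator_bound : exists2 K : R, 0 <= K & forall f, inX rho f ->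
  forall s : seq (int * int), uniq s -> forall th : int * int -> C,
  (forall i, Normc.normc (th i) <= 1) ->
  (rho (cabs (wave_sum s (fun i => th i * inner f (wv i))%R)) <= (K * fine (rho (cabs f)))%:E)%E.
Proof.
have [K1 K10 hK1] := dual_bound bfn mrho.
have [K2 K20 hK2] := coefficient_bound bfn mrho mrho' A0 bre bim.
exists (2 * (K1 * K2)) => [|f fX s us th th1]; first by rewrite !mulr_ge0// ltW.
set a := fun i => th i * inner f (wv i); set r := fine (rho (cabs f)).
have r0 : 0 <= r by rewrite fine_ge0// (bfn_ge0 bfn (nnmf_cabs fX.1)).
have [B B0 hB] := common_support A s.
have [M M0 [lR lI]] := wave_sum_lipschitz s a.
have part_bound (part : R -> R) : lipschitz_with M part ->
    (forall x, ~ (- B <= x < B) -> part x = 0) ->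
    (forall g, loc_int g -> `|Iab (fun x => part x * g x) (- B) (2 * B)| <=
       \sum_(i <- s) Normc.normc (a i) * Normc.normc (inner (rc g) (wv i))) ->
    (rho (fun x => `|part x|%:E) <= (K1 * (K2 * r))%:E)%E.
  move=> lpart zpart hpart.
  apply: (hK1 _ M B) => //; first by rewrite mulr_ge0.
  - exact: lipschitz_norm.
  - by move=> x /zpart ->; rewrite normr0.
  move=> g mg g0 rg.
  have mpart : measurable_fun setT part.
    by apply: continuous_measurable_fun; exact: lipschitz_continuous lpart.
  pose E := [set x | 0 <= part x].
  have mE : measurable E.
    have := mpart measurableT `[0, +oo[%classic (measurable_itv _).
    by rewrite setTI; congr measurable; apply/seteqP; split => x /=; rewrite in_itv/= andbT.
  (* The pairings are controlled for [part], not for its modulus, so the sign of [part] moves into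
     the test function; [|g1| = g] preserves the norm. *)
  pose g1 x := g x * (2 * \1_E x - 1).
  have mg1 : measurable_fun setT g1.
    apply: measurable_funM => //; apply: measurable_funB => //.
    by apply: measurable_funM => //; exact: measurable_indic.
  have sgn x : part x * (2 * \1_E x - 1) = `|part x|.
    rewrite indicE; have [xE|xE] := boolP (x \in E).
      by rewrite inE /E /= in xE; rewrite ger0_norm//=; ring.
    rewrite notin_setE /E /= in xE; rewrite ltr0_norm ?ltNge; last exact/negP.
    by rewrite /=; ring.
  have g1abs x : `|g1 x| = g x.
    rewrite /g1 normrM ger0_norm// indicE; case: (x \in E) => /=.
      by rewrite mulr1 (_ : 2 - 1 = 1 :> R) ?normr1 ?mulr1//; ring.
    by rewrite mulr0 sub0r normrN normr1 mulr1.
  have cabsE : cabs (rc g1) = (fun x => (g x)%:E).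
    apply/funext => x; rewrite /cabs /rc /= expr0n/= addr0 sqrtr_sqr; congr (_%:E); exact: g1abs.
  have g1X : inX rho' (rc g1).
    split; last by rewrite cabsE (le_lt_trans rg)// ltry.
    by split => //=; exact: measurable_cst.
  have lg1 : loc_int g1 by have [h _] := sn_cloc_int (assoc_sublinear bfn) g1X.
  have -> : (fun x => `|part x| * g x) = (fun x => part x * g1 x).
    by apply/funext => x; rewrite /g1 mulrCA sgn mulrC.
  apply: (le_trans (ler_norm _)); apply: (le_trans (hpart g1 lg1)).
  apply: (@le_trans _ _ (\sum_(i <- s) Normc.normc (inner f (wv i)) * Normc.normc (inner (rc g1) (wv i)))).
    apply: ler_sum => i _; apply: ler_wpM2r; first exact: normc_ge0.
    by rewrite /a Normc.normcM ler_piMl// normc_ge0.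
  apply: (le_trans (hK2 f (rc g1) fX g1X s us)); rewrite -/r -[leRHS]mulr1.
  apply: ler_wpM2l; first by rewrite mulr_ge0.
  have rfin : rho' (cabs (rc g1)) \is a fin_num.
    by rewrite ge0_fin_numE; [case: g1X|exact: assoc_norm_ge0].
  by rewrite -lee_fin fineK// cabsE.
have zero x : ~ (- B <= x < B) -> wave_sum s a x = 0 by exact: wave_sum_supported.
have b1 := part_bound _ lR (fun x h => congr1 (@complex.Re R) (zero x h)) (fun g lg => (pairing_wave_sum a lg hB).1).
have b2 := part_bound _ lI (fun x h => congr1 (@complex.Im R) (zero x h)) (fun g lg => (pairing_wave_sum a lg hB).2).
have [mr mi] := cmeasurable_wave_sum s a.
have nr : nnmf (fun x => `|complex.Re (wave_sum s a x)|%:E).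
  by split; [apply/measurable_EFinP; exact: measurableT_comp|move=> x; rewrite lee_fin].
have ni : nnmf (fun x => `|complex.Im (wave_sum s a x)|%:E).
  by split; [apply/measurable_EFinP; exact: measurableT_comp|move=> x; rewrite lee_fin].
apply: (@le_trans _ _ (rho (fun x => `|complex.Re (wave_sum s a x)|%:E + `|complex.Im (wave_sum s a x)|%:E))%E).
  apply: (bfn_lattice bfn); [exact: nnmfD|exact: nnmf_cabs|].
  apply: ae_all => x; rewrite /cabs -EFinD lee_fin normcE.
  set p := complex.Re _; set q := complex.Im _.
  have pq0 : 0 <= `|p| + `|q| by rewrite addr_ge0.
  rewrite -[leRHS](ger0_norm pq0) -sqrtr_sqr ler_wsqrtr// -(real_normK (num_real p)) -(real_normK (num_real q)).
  have : 0 <= `|p| * `|q| by rewrite mulr_ge0.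
  lra.
apply: (le_trans (bfn_subadd bfn nr ni)); apply: (le_trans (leeD b1 b2)).
by rewrite -EFinD lee_fin le_eqVlt; apply/orP; left; apply/eqP; ring.
Qed.

End OperatorBound.

(** * Expansions in L^2 *)
Section Pairing.
Variable R : realType.
Local Notation C := (R[i]).
Local Notation mu := (@lebesgue_measure R).
Implicit Types f g h u v : R -> C.

Lemma cmeasurable_comb (a b : C) f g : cmeasurable f -> cmeasurable g ->
  cmeasurable (fun x => a * f x + b * g x).
Proof.
move=> [fr fi] [gr gi]; case: a b => [a a'] [b b']; split.
  rewrite (_ : (fun x => _) = (fun x => (a * complex.Re (f x) - a' * complex.Im (f x)) +
    (b * complex.Re (g x) - b' * complex.Im (g x)))); last first.
    by apply/funext => x; case: (f x) (g x) => [? ?] [? ?].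
  by apply: measurable_funD; apply: measurable_funB; apply: measurable_funM => //; exact: measurable_cst.
rewrite (_ : (fun x => _) = (fun x => (a * complex.Im (f x) + a' * complex.Re (f x)) +
    (b * complex.Im (g x) + b' * complex.Re (g x)))); last first.
  by apply/funext => x; case: (f x) (g x) => [? ?] [? ?].
by apply: measurable_funD; apply: measurable_funD; apply: measurable_funM => //; exact: measurable_cst.
Qed.

Lemma cmeasurableB f g : cmeasurable f -> cmeasurable g -> cmeasurable (fun x => f x - g x).
Proof.
move=> hf hg; have := cmeasurable_comb 1 (-1) hf hg.
by congr cmeasurable; apply/funext => x; rewrite mul1r mulN1r.
Qed.

Lemma normcD (z u : C) : Normc.normc (z + u) <= Normc.normc z + Normc.normc u.
Proof. exact: le_normcD. Qed.

Lemma normcB (z u : C) : Normc.normc (z - u) = Normc.normc (u - z).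
Proof. by rewrite -opprB normcN. Qed.

Lemma normc_conj (z : C) : Normc.normc (Num.conj z) = Normc.normc z.
Proof. by case: z => a b /=; rewrite sqrrN. Qed.

Lemma normc_le_parts (z : C) : Normc.normc z <= `|complex.Re z| + `|complex.Im z|.
Proof.
rewrite -(@ler_pXn2r _ 2) ?nnegrE ?normc_ge0 ?addr_ge0// normc_sqr sqrrD !real_normK ?num_real//.
by rewrite -addrA lerD2l lerDr; apply: mulrn_wge0; exact: mulr_ge0.
Qed.

(** One notion for both dualities, [L^2] with itself and [X] with [X']. The total function [inner]
    behaves sesquilinearly under this condition. *)
Definition pairable f g := [/\ cmeasurable f, cmeasurable g &
  mu.-integrable setT (EFin \o (fun x => Normc.normc (f x) * Normc.normc (g x)))].

Lemma pairable_comb a b f g h : pairable f h -> pairable g h ->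
  pairable (fun x => a * f x + b * g x) h.
Proof.
move=> [mf mh fh] [mg _ gh]; have mfg := cmeasurable_comb a b mf mg; split=> //.
have i1 := integrableD measurableT (integrableZl measurableT (Normc.normc a) fh)
  (integrableZl measurableT (Normc.normc b) gh).
apply: le_integrable i1 => //.
  by apply/measurable_EFinP; apply: measurable_funM; exact: cabs_measurable.
move=> x _ /=; rewrite lee_fin ger0_norm ?mulr_ge0 ?normc_ge0//.
rewrite ger0_norm ?addr_ge0 ?mulr_ge0 ?normc_ge0// !mulrA -mulrDl.
apply: ler_wpM2r; first exact: normc_ge0.
by rewrite -!Normc.normcM; exact: normcD.
Qed.

Lemma pairable_re f g : pairable f g ->
  mu.-integrable setT (EFin \o (fun x => complex.Re (f x * Num.conj (g x)))).
Proof.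
move=> [[fr fi] [gr gi] h]; apply: le_integrable h => //.
  apply/measurable_EFinP; under eq_fun do rewrite re_mul_conj.
  by apply: measurable_funD; exact: measurable_funM.
move=> x _ /=; rewrite lee_fin [leRHS]ger0_norm ?mulr_ge0 ?normc_ge0//.
by rewrite -(normc_conj (g x)) -Normc.normcM ler_re_normc.
Qed.

Lemma pairable_im f g : pairable f g ->
  mu.-integrable setT (EFin \o (fun x => complex.Im (f x * Num.conj (g x)))).
Proof.
move=> [[fr fi] [gr gi] h]; apply: le_integrable h => //.
  apply/measurable_EFinP; under eq_fun do rewrite im_mul_conj.
  by apply: measurable_funB; exact: measurable_funM.
move=> x _ /=; rewrite lee_fin [leRHS]ger0_norm ?mulr_ge0 ?normc_ge0//.
by rewrite -(normc_conj (g x)) -Normc.normcM ler_im_normc.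
Qed.

Lemma inner_comb a b f g h : pairable f h -> pairable g h ->
  inner (fun x => a * f x + b * g x) h = a * inner f h + b * inner g h.
Proof.
move=> fh gh; have r1 := pairable_re fh; have r2 := pairable_re gh.
have i1 := pairable_im fh; have i2 := pairable_im gh.
have Zl c F : mu.-integrable setT (EFin \o F) -> mu.-integrable setT (EFin \o (fun x => c * F x)).
  by move=> hF; apply: eq_integrable (integrableZl measurableT c hF) => // x _.
have Dl (F G : R -> R) : mu.-integrable setT (EFin \o F) -> mu.-integrable setT (EFin \o G) ->
  mu.-integrable setT (EFin \o (fun x => F x + G x)).
  by move=> hF hG; apply: eq_integrable (integrableD measurableT hF hG) => // x _.
case: a b => [a a'] [b b']; rewrite /inner; apply/eqP; rewrite eq_complex /=; apply/andP; split; apply/eqP.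
  transitivity (\int[mu]_x ((a * complex.Re (f x * Num.conj (h x)) + - a' * complex.Im (f x * Num.conj (h x))) +
     (b * complex.Re (g x * Num.conj (h x)) + - b' * complex.Im (g x * Num.conj (h x))))).
    congr Rintegral; apply/funext => x; case: (f x) (g x) (h x) => [? ?] [? ?] [? ?] /=; ring.
  rewrite !RintegralD ?RintegralZl//; try by do ?[apply: Dl|apply: Zl].
  by rewrite !mulNr.
transitivity (\int[mu]_x ((a * complex.Im (f x * Num.conj (h x)) + a' * complex.Re (f x * Num.conj (h x))) +
     (b * complex.Im (g x * Num.conj (h x)) + b' * complex.Re (g x * Num.conj (h x))))).
  congr Rintegral; apply/funext => x; case: (f x) (g x) (h x) => [? ?] [? ?] [? ?] /=; ring.
by rewrite !RintegralD ?RintegralZl//; try by do ?[apply: Dl|apply: Zl].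
Qed.

Lemma inner_conj f g : pairable f g -> inner g f = Num.conj (inner f g).
Proof.
move=> fg; have i1 := pairable_im fg; rewrite /inner; apply/eqP; rewrite eq_complex /=.
apply/andP; split; apply/eqP.
  congr Rintegral; apply/funext => x; case: (f x) (g x) => [? ?] [? ?] /=; ring.
rewrite -mulN1r -RintegralZl//; congr Rintegral; apply/funext => x.
case: (f x) (g x) => [? ?] [? ?] /=; ring.
Qed.

Lemma inner_le f g : pairable f g ->
  Normc.normc (inner f g) <= 2 * \int[mu]_x (Normc.normc (f x) * Normc.normc (g x)).
Proof.
move=> fg; have r1 := pairable_re fg; have i1 := pairable_im fg; have [_ _ h] := fg.
apply: (le_trans (normc_le_parts _)); rewrite /inner /= [leRHS]mulrDl !mul1r.
have e F : mu.-integrable setT (EFin \o F) -> (forall x, `|F x| <= Normc.normc (f x) * Normc.normc (g x)) ->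
  `|\int[mu]_x F x| <= \int[mu]_x (Normc.normc (f x) * Normc.normc (g x)).
  move=> hF Fle; apply: le_trans (le_normr_Rintegral _ hF) _ => //.
  apply: le_Rintegral => //; apply: eq_integrable (integrable_abse hF) => // x _.
by apply: lerD; apply: e => // x; rewrite -(normc_conj (g x)) -Normc.normcM ?ler_re_normc ?ler_im_normc.
Qed.

Lemma inner_ae_eq f g h : pairable f h -> pairable g h -> {ae mu, forall x, f x = g x} ->
  inner f h = inner g h.
Proof.
move=> fh gh fg; rewrite /inner /Rintegral; congr Complex; congr fine; apply: ae_eq_integral => //.
- by have /measurable_int := pairable_re fh.
- by have /measurable_int := pairable_re gh.
- by apply: ae_imp fg => x /= ->.
- by have /measurable_int := pairable_im fh.
- by have /measurable_int := pairable_im gh.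
- by apply: ae_imp fg => x /= ->.
Qed.

End Pairing.

(** * Weak limits of rapidly converging sequences in L^2 *)

Section SquareIntegrable.
Variable R : realType.
Local Notation C := (R[i]).
Local Notation mu := (@lebesgue_measure R).
Implicit Types f g h u v : R -> C.

Definition sqnorm f : R := \int[mu]_x (Normc.normc (f x) ^+ 2).

Lemma Rdominated_cvg (h : nat -> R -> R) (h0 G : R -> R) :
  (forall n, measurable_fun setT (h n)) -> measurable_fun setT h0 ->
  {ae mu, forall x, (fun n => h n x) @ \oo --> h0 x} ->
  mu.-integrable setT (EFin \o G) -> {ae mu, forall x, forall n, `|h n x| <= G x} ->
  (fun n => \int[mu]_x h n x) @ \oo --> \int[mu]_x h0 x.
Proof.
move=> mh mh0 hh0 iG hG.
have [] := @dominated_convergence _ _ R mu setT measurableT (fun n => EFin \o h n) (EFin \o h0) (EFin \o G).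
- by move=> n; apply/measurable_EFinP; exact: mh.
- by apply/measurable_EFinP; exact: mh0.
- by apply: ae_imp hh0 => x hx _; apply: cvg_EFin => //; near=> n.
- exact: iG.
- by apply: ae_imp hG => x hx n _ /=; rewrite lee_fin.
move=> i0 _ h1; have fin := integrable_fin_num measurableT i0.
by rewrite /Rintegral; apply: fine_cvg; rewrite fineK.
Unshelve. all: by end_near.
Qed.

Lemma cmeasurable_sqr f : cmeasurable f -> measurable_fun setT (fun x => Normc.normc (f x) ^+ 2).
Proof. by move=> mf; apply: measurable_funX; exact: cabs_measurable. Qed.

Lemma inL2_integrable f : inL2 f -> mu.-integrable setT (EFin \o (fun x => Normc.normc (f x) ^+ 2)).
Proof.
move=> [mf hf]; apply/integrableP; split; first by apply/measurable_EFinP; exact: cmeasurable_sqr.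
apply: le_lt_trans hf; rewrite le_eqVlt; apply/orP; left; apply/eqP.
by apply: eq_integral => x _ /=; rewrite ger0_norm ?sqr_ge0.
Qed.

Lemma integrable_inL2 f : cmeasurable f ->
  mu.-integrable setT (EFin \o (fun x => Normc.normc (f x) ^+ 2)) -> inL2 f.
Proof. by move=> mf hf; split=> //; exact: integrable_lty hf. Qed.

Lemma inL2_pairable f g : inL2 f -> inL2 g -> pairable f g.
Proof.
move=> hf hg; have [[mf _] [mg _]] := (hf, hg); split => //.
have hfg := integrableD measurableT (inL2_integrable hf) (inL2_integrable hg).
apply: le_integrable hfg => //.
  by apply/measurable_EFinP; apply: measurable_funM; exact: cabs_measurable.
move=> x _ /=; rewrite lee_fin !ger0_norm ?mulr_ge0 ?addr_ge0 ?sqr_ge0 ?normc_ge0//.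
have := normc_ge0 (f x); have := normc_ge0 (g x).
have := sqr_ge0 (Normc.normc (f x) - Normc.normc (g x)).
move: (Normc.normc (f x)) (Normc.normc (g x)) => p q; nra.
Qed.

Lemma inL2_comb a b f g : inL2 f -> inL2 g -> inL2 (fun x => a * f x + b * g x).
Proof.
move=> hf hg; have [[mf _] [mg _]] := (hf, hg).
have mfg := cmeasurable_comb a b mf mg; apply: integrable_inL2 => //.
have i1 := integrableD measurableT
  (integrableZl measurableT (2 * Normc.normc a ^+ 2) (inL2_integrable hf))
  (integrableZl measurableT (2 * Normc.normc b ^+ 2) (inL2_integrable hg)).
apply: le_integrable i1 => //; first by apply/measurable_EFinP; exact: cmeasurable_sqr.
move=> x _ /=; rewrite lee_fin [leLHS]ger0_norm ?sqr_ge0//.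
apply: le_trans (ler_norm _); have := normcD (a * f x) (b * g x); rewrite !Normc.normcM.
have := normc_ge0 (a * f x + b * g x).
move: (Normc.normc _) (Normc.normc a) (Normc.normc b) (Normc.normc (f x)) (Normc.normc (g x)) => z a' b' p q.
move=> z0 zle; have := sqr_ge0 (a' * p - b' * q).
have : z ^+ 2 <= (a' * p + b' * q) ^+ 2 by rewrite ler_pXn2r// nnegrE// (le_trans z0).
nra.
Qed.

Lemma inL2B f g : inL2 f -> inL2 g -> inL2 (fun x => f x - g x).
Proof.
move=> hf hg; have := inL2_comb 1 (-1) hf hg.
by congr inL2; apply/funext => x; rewrite mul1r mulN1r.
Qed.

Lemma innerB f g h : pairable f h -> pairable g h ->
  inner (fun x => f x - g x) h = inner f h - inner g h.
Proof.
move=> fh gh; rewrite -[RHS]/(_ + - _) -[inner f h]mul1r -[- _]mulN1r -inner_comb//.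
by congr inner; apply/funext => x; rewrite mul1r mulN1r.
Qed.

Lemma inL2_0 : inL2 (fun=> 0 : C).
Proof.
split; first by split; exact: measurable_cst.
by rewrite integral0_eq ?ltry// => x _; rewrite Normc.normc0 expr0n.
Qed.

Lemma inner_self f : inner f f = real_complex R (sqnorm f).
Proof.
rewrite /inner /sqnorm; apply/eqP; rewrite eq_complex /=; apply/andP; split; apply/eqP.
  by congr Rintegral; apply/funext => x; rewrite re_mul_conj normc_sqr -!expr2.
rewrite /Rintegral integral0_eq// => x _; rewrite im_mul_conj mulrC subrr//.
Qed.

Lemma sqnorm_ge0 f : 0 <= sqnorm f.
Proof. by apply: Rintegral_ge0 => x _; exact: sqr_ge0. Qed.

Section LimitL2.
Variables (S : nat -> R -> C) (c : R).
Hypothesis S2 : forall n, inL2 (S n).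
Hypothesis S0 : forall x, S 0%N x = 0.
Hypothesis Sc : forall n, sqnorm (fun x => S n.+1 x - S n x) <= c / 16 ^+ n.

Lemma geometric_increments (u : nat -> R) M : u 0%N = 0 ->
  (forall n, `|u n.+1 - u n| <= M / 2 ^+ n) -> cvgn u /\ forall n, `|u n| <= 2 * M.
Proof.
move=> u0 du; have M0 : 0 <= M by have := le_trans (normr_ge0 _) (du 0%N); rewrite expr0 divr1.
have ut n : u n = series (telescope u) n by rewrite telescopeK /= u0 subr0.
have tle n : `|telescope u n| <= M / 2 ^+ n by exact: du.
split.
  have -> : u = series (telescope u) by apply/funext.
  apply: normed_cvg; apply: (@series_le_cvg _ _ (fun n => M / 2 ^+ n)).
  - by move=> n /=; exact: normr_ge0.
  - by move=> n /=; apply: divr_ge0 => //; exact: exprn_ge0.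
  - exact: tle.
  have := @is_cvg_geometric_series R M 2^-1; rewrite ger0_norm// invf_lt1// ltr1n => /(_ isT).
  by congr (cvgn (series _)); apply/funext => n; rewrite /geometric /= exprVn.
move=> n; suff : `|u n| <= 2 * M - 2 * M / 2 ^+ n.
  by move=> h; apply: (le_trans h); rewrite lerBlDr lerDl; apply: divr_ge0; [exact: mulr_ge0|exact: exprn_ge0].
elim: n => [|n IH]; first by rewrite u0 normr0 expr0 divr1 subrr.
rewrite -(subrK (u n) (u n.+1)); apply: (le_trans (ler_normD _ _)).
apply: (le_trans (lerD (du n) IH)); rewrite exprS invfM.
have : 0 <= M * 2 ^- n by rewrite mulr_ge0// invr_ge0 exprn_ge0.
move: (2 ^- n) => t ?; lra.
Qed.

Let g n x : R := Normc.normc (S n.+1 x - S n x) ^+ 2.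
Let D n : inL2 (fun x => S n.+1 x - S n x) := inL2B (S2 n.+1) (S2 n).

Let mg n : measurable_fun setT (fun x => ((4 ^+ n)%:E * (g n x)%:E)%E).
Proof.
apply: emeasurable_funM; first exact: measurable_cst.
by apply/measurable_EFinP; apply: cmeasurable_sqr; case: (D n).
Qed.

Let g0 n x : (0 <= (4 ^+ n)%:E * (g n x)%:E)%E.
Proof.
apply: mule_ge0; rewrite lee_fin; first by apply: exprn_ge0; exact: ler0n.
exact: sqr_ge0.
Qed.

(* [S n x] converges where [G x] is finite, and is bounded there by a multiple of [sqrt (G x)]. *)
Let G x : \bar R := (\sum_(0 <= n <oo) (4 ^+ n)%:E * (g n x)%:E)%E.

Let mG : measurable_fun setT G.
Proof.
apply: ge0_emeasurable_sum.
  by move=> n x _ _; exact: g0.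
by move=> n _; exact: mg.
Qed.

Let G0 x : (0 <= G x)%E. Proof. by apply: nneseries_ge0 => n _ _; exact: g0. Qed.

Let Gint : (\int[mu]_x G x < +oo)%E.
Proof.
have c0 : 0 <= c by have := le_trans (sqnorm_ge0 _) (Sc 0%N); rewrite expr0 divr1.
rewrite /G integral_nneseries//.
have ig n : (\int[mu]_x ((4 ^+ n)%:E * (g n x)%:E) <= (c * 2 / (2 ^ n.+1)%:R)%:E)%E.
  have mgn : measurable_fun setT (fun x => (g n x)%:E).
    by apply/measurable_EFinP; apply: cmeasurable_sqr; case: (D n).
  have gx0 x : setT x -> (0 <= (g n x)%:E)%E by move=> _; rewrite lee_fin sqr_ge0.
  have p4 : (0 : R) <= 4 ^+ n by apply: exprn_ge0; exact: ler0n.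
  rewrite ge0_integralZl_EFin//.
  have := Sc n; rewrite /sqnorm /Rintegral -lee_fin fineK; last first.
    by have := integrable_fin_num measurableT (inL2_integrable (D n)).
  move=> h; apply: (@le_trans _ _ ((4 ^+ n)%:E * (c / 16 ^+ n)%:E)%E).
    by apply: lee_pmul => //; rewrite ?lee_fin//; exact: integral_ge0.
  rewrite -EFinM lee_fin natrX.
  have -> : (16 : R) = 4 * 4 by rewrite -natrM.
  rewrite exprMn invfM exprS invfM !mulrA (mulrAC _ c) divff ?mul1r; last by rewrite expf_neq0.
  rewrite mulrAC [c * 2 * _]mulrAC -mulrA -mulrA ler_wpM2l//.
  rewrite divff// mulr1 lef_pV2 ?posrE ?exprn_gt0//.
  by rewrite lerXn2r// ?nnegrE// ler_nat.
apply: (@le_lt_trans _ _ (\sum_(0 <= n <oo) (c * 2 / (2 ^ n.+1)%:R)%:E)%E).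
  by apply: lee_nneseries => [n *|n *]; [apply: integral_ge0 => x _; exact: g0|exact: ig].
have e0 n : 0 <= c * 2 / (2 ^ n.+1)%:R by rewrite divr_ge0 ?mulr_ge0.
apply: (@le_lt_trans _ _ (c * 2)%:E); last by rewrite ltry.
exact: epsilon_trick0 xpredT (mulr_ge0 c0 (ler0n R 2)).
Qed.

Let fG x : R := fine (G x).

Let DG : set R := [set x | (G x < +oo)%E].
Let mDG : measurable DG.
Proof. by rewrite -[DG]setTI; exact: emeasurable_fun_infty_o. Qed.

Let increments x : DG x -> forall n, Normc.normc (S n.+1 x - S n x) <= Num.sqrt (fG x) / 2 ^+ n.
Proof.
move=> xD n; have fin : G x \is a fin_num by rewrite ge0_fin_numE.
have h : 4 ^+ n * g n x <= fG x.
  rewrite -lee_fin fineK// EFinM; apply: le_trans (nneseries_lim_ge n.+1 _); last by move=> *; exact: g0.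
  by rewrite big_nat_recr//= leeDr// sume_ge0.
rewrite ler_pdivlMr ?exprn_gt0// -(@ler_pXn2r _ 2) ?nnegrE ?mulr_ge0 ?normc_ge0 ?exprn_ge0 ?sqrtr_ge0//.
rewrite sqr_sqrtr ?fine_ge0// exprMn -exprM mulnC exprM mulrC.
by rewrite (_ : (2 : R) ^+ 2 = 4) // expr2 -natrM.
Qed.

(** Riesz-Fischer for rapidly decreasing increments. Of the factor [16^n] in [Sc], one [4^n] is
    absorbed by the weights in [G], whose square root is the [2^n] of [increments]; the other makes
    [G] integrable. Pairings converge by dominated convergence, since [|S n|] is at most a multiple
    of the square root of [G]. *)
Lemma L2_limit : exists2 s, inL2 s & forall f, inL2 f ->
  (fun n => complex.Re (inner (S n) f)) @ \oo --> complex.Re (inner s f) /\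
  (fun n => complex.Im (inner (S n) f)) @ \oo --> complex.Im (inner s f).
Proof.
(* Set to zero where [G] is infinite, so that the limit exists everywhere and is measurable. *)
pose cut (P : C -> R) n x := P (S n x) * \1_DG x.
have cutE (P : C -> R) n x : DG x -> cut P n x = P (S n x).
  by move=> xD; rewrite /cut indicE mem_set// mulr1.
have cutN (P : C -> R) n x : ~ DG x -> cut P n x = 0.
  by move=> xD; rewrite /cut indicE memNset// mulr0.
have lip (P : C -> R) : P 0 = 0 -> (forall z t, `|P z - P t| <= Normc.normc (z - t)) ->
  forall x, DG x -> cvgn (fun n => P (S n x)) /\ forall n, `|P (S n x)| <= 2 * Num.sqrt (fG x).
  move=> P0 PL x xD; apply: geometric_increments; first by rewrite S0.
  by move=> n; apply: (le_trans (PL _ _)); exact: increments.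
have rl (z t : C) : `|complex.Re z - complex.Re t| <= Normc.normc (z - t).
  by have := ler_re_normc (z - t); case: z t => [? ?] [? ?].
have il (z t : C) : `|complex.Im z - complex.Im t| <= Normc.normc (z - t).
  by have := ler_im_normc (z - t); case: z t => [? ?] [? ?].
have lr := lip (@complex.Re R) erefl rl; have li := lip (@complex.Im R) erefl il.
have cv (P : C -> R) : (forall x, DG x -> cvgn (fun n => P (S n x)) /\ forall n, `|P (S n x)| <= 2 * Num.sqrt (fG x)) ->
  forall x, cvgn (fun n => cut P n x).
  move=> h x; have [xD|xD] := pselect (DG x).
    by have [] := h x xD; under eq_fun do rewrite -(cutE P _ x)//.
  by under eq_fun do rewrite (cutN P _ x)//; exact: is_cvg_cst.
have cr := cv _ lr; have ci := cv _ li.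
pose lm (P : C -> R) x := limn (fun n => cut P n x).
have mlm (P : C -> R) : (forall n, measurable_fun setT (fun x => P (S n x))) ->
  (forall x, cvgn (fun n => cut P n x)) -> measurable_fun setT (lm P).
  move=> mP cP; apply: (@measurable_fun_cvg _ _ _ _ (cut P)) => [n|x _]; last exact: cP.
  by apply: measurable_funM => //; exact: measurable_indic.
pose s x : C := Complex (lm (@complex.Re R) x) (lm (@complex.Im R) x).
have ms : cmeasurable s by split; apply: mlm => // n; case: (S2 n) => -[].
have G' : mu.-integrable setT G.
  by apply/integrableP; split => //; under eq_integral do rewrite gee0_abs//.
have iG : mu.-integrable setT (EFin \o fG).
  apply: (le_integrable _ _ _ G') => //.
    by apply/measurable_EFinP; apply: measurableT_comp.
  by move=> x _; rewrite /= /fG; case: (G x) (G0 x) => [r r0|_|//] /=; [exact: lexx|rewrite leey].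
have ble (P : C -> R) : (forall x, DG x -> cvgn (fun n => P (S n x)) /\ forall n, `|P (S n x)| <= 2 * Num.sqrt (fG x)) ->
  (forall x, cvgn (fun n => cut P n x)) -> forall x, `|lm P x| <= 2 * Num.sqrt (fG x).
  move=> h cP x; have cl : forall n, `|cut P n x| <= 2 * Num.sqrt (fG x).
    move=> n; have [xD|xD] := pselect (DG x); first by rewrite cutE//; case: (h x xD).
    by rewrite cutN// normr0 mulr_ge0// sqrtr_ge0.
  rewrite ler_norml; apply/andP; split.
    by apply: limr_ge; [exact: cP|near=> n; have := cl n; rewrite ler_norml => /andP[]].
  by apply: limr_le; [exact: cP|near=> n; have := cl n; rewrite ler_norml => /andP[]].
have br := ble _ lr cr; have bi := ble _ li ci.
have sq x : Num.sqrt (fG x) ^+ 2 = fG x by rewrite sqr_sqrtr// fine_ge0.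
have sle x : Normc.normc (s x) ^+ 2 <= 8 * fG x.
  rewrite normc_sqr /= -sq.
  move: (br x) (bi x); rewrite -[X in X + _]real_normK ?num_real// -[X in _ + X]real_normK ?num_real//.
  have := sqrtr_ge0 (fG x).
  move: (Num.sqrt _) `|lm _ x| `|lm _ x| (normr_ge0 (lm (@complex.Re R) x)) (normr_ge0 (lm (@complex.Im R) x)).
  move=> r p q p0 q0 r0 pr qr; have := ler_pM p0 p0 pr pr; have := ler_pM q0 q0 qr qr; lra.
have s2 : inL2 s.
  apply: integrable_inL2 => //; apply: le_integrable (integrableZl measurableT 8 iG) => //.
    by apply/measurable_EFinP; exact: cmeasurable_sqr.
  move=> x _; change ((`|Normc.normc (s x) ^+ 2|%:E <= `|8 * fG x|%:E)%E).
  by rewrite lee_fin ger0_norm ?sqr_ge0//; apply: le_trans (sle x) _; exact: ler_norm.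
exists s => // f f2.
have aeDG : {ae mu, forall x, DG x}.
  by apply: ae_imp (integrable_ae measurableT G') => x /(_ I) h; rewrite /DG /= ltey_eq h.
have cvp (P : C -> R) : (forall x, cvgn (fun n => cut P n x)) ->
    forall x, DG x -> (fun n => P (S n x)) @ \oo --> lm P x.
  by move=> h x xD; under eq_fun do rewrite -(cutE P _ x)//; exact: h.
have domi : mu.-integrable setT (EFin \o (fun x => 2 * fG x + 2 * Normc.normc (f x) ^+ 2)).
  have := integrableD measurableT (integrableZl measurableT 2 iG)
    (integrableZl measurableT 2 (inL2_integrable f2)).
  by apply: eq_integrable.
have dom x : DG x -> forall n, Normc.normc (S n x * Num.conj (f x)) <= 2 * fG x + 2 * Normc.normc (f x) ^+ 2.
  move=> xD n; rewrite Normc.normcM normc_conj -sq.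
  have h := normc_le_parts (S n x); have [_ /(_ n) h1] := lr x xD; have [_ /(_ n) h2] := li x xD.
  have p0 := normc_ge0 (f x); have r0 := sqrtr_ge0 (fG x).
  apply: (@le_trans _ _ ((4 * Num.sqrt (fG x)) * Normc.normc (f x))).
    by apply: ler_wpM2r => //; lra.
  have := sqr_ge0 (Num.sqrt (fG x) - Normc.normc (f x)); lra.
have [mfr mfi] := f2.1.
rewrite /inner /=; split.
  apply: Rdominated_cvg domi _ => [n|||].
  - by have /measurable_int/measurable_EFinP := pairable_re (inL2_pairable (S2 n) f2).
  - by have /measurable_int/measurable_EFinP := pairable_re (inL2_pairable s2 f2).
  - apply: ae_imp aeDG => x xD; under eq_fun do rewrite re_mul_conj; rewrite re_mul_conj.
    by apply: cvgD; apply: cvgM; try exact: cvg_cst; exact: cvp.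
  - by apply: ae_imp aeDG => x xD n; apply: le_trans (ler_re_normc _) _; exact: dom.
apply: Rdominated_cvg domi _ => [n|||].
- by have /measurable_int/measurable_EFinP := pairable_im (inL2_pairable (S2 n) f2).
- by have /measurable_int/measurable_EFinP := pairable_im (inL2_pairable s2 f2).
- apply: ae_imp aeDG => x xD; under eq_fun do rewrite im_mul_conj; rewrite im_mul_conj.
  by apply: cvgB; apply: cvgM; try exact: cvg_cst; exact: cvp.
- by apply: ae_imp aeDG => x xD n; apply: le_trans (ler_im_normc _) _; exact: dom.
Unshelve. all: by end_near.
Qed.

End LimitL2.
End SquareIntegrable.

Lemma int_pair_enumeration : exists e : nat -> int * int, bijective e.
Proof.
have inf : infinite_set [set: int * int].
  move=> fin; apply: infinite_nat; pose f (n : nat) : int * int := (n%:Z, 0).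
  by apply: (sub_finite_set _ (finite_preimage (f := f) _ fin)) => // n m _ _ [].
have /card_set_bijP[f] := eq_card_nat (countableP _) inf.
by rewrite setTT_bijective => -[e fe ef]; exists e; exists f.
Qed.

(** * Bessel's and Parseval's inequalities *)

Section Parseval.
Variable R : realType.
Local Notation C := (R[i]).
Local Notation mu := (@lebesgue_measure R).
Implicit Types (f g h u v : R -> C) (s : seq (int * int)) (a : int * int -> C).
Variable psi : R -> C.
Local Notation wv i := (wav psi i.1 i.2).

Lemma pairable_wave_sum s a g : cmeasurable g -> (forall i, pairable (wv i) g) ->
  pairable (wave_sum psi s a) g.
Proof.
move=> mg hg; elim: s => [|i s IH].
  have /= := pairable_comb 0 0 (hg (0, 0)) (hg (0, 0)).
  by congr pairable; apply/funext => x; rewrite /wave_sum big_nil !mul0r addr0.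
have := pairable_comb (a i) 1 (hg i) IH.
by congr pairable; apply/funext => x; rewrite /wave_sum big_cons mul1r.
Qed.

Lemma inner_wave_sum s a g : cmeasurable g -> (forall i, pairable (wv i) g) ->
  inner (wave_sum psi s a) g = \sum_(i <- s) a i * inner (wv i) g.
Proof.
move=> mg hg; elim: s => [|i s IH].
  have /= := inner_comb 0 0 (hg (0, 0)) (hg (0, 0)).
  rewrite big_nil !mul0r addr0 => <-.
  by congr inner; apply/funext => x; rewrite /wave_sum big_nil !mul0r addr0.
rewrite big_cons -IH -[inner (wave_sum _ _ _) _ in RHS]mul1r -inner_comb//; last exact: pairable_wave_sum.
by congr inner; apply/funext => x; rewrite /wave_sum big_cons mul1r.
Qed.

Hypothesis ow : orthonormal_wavelet psi.
Hypothesis mw : forall i, cmeasurable (wv i).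

Lemma inner_wav (i j : int * int) : inner (wv i) (wv j) = (i == j)%:R.
Proof.
have [_ [h _]] := ow; rewrite h; case: i j => [i i'] [j j'] /=.
by rewrite xpair_eqE; case: ifP.
Qed.

Lemma wav_inL2 i : inL2 (wv i).
Proof.
(* [fine +oo = 0]: with an infinite integral the pairing of the wavelet with itself would be 0
   instead of 1. *)
split => //; rewrite ltNge leye_eq; apply/negP => /eqP h.
have := inner_wav i i; rewrite eqxx inner_self /sqnorm /Rintegral h /= => /eqP.
by rewrite eq_complex /= eq_sym oner_eq0.
Qed.

Lemma wave_sum_inL2 s a : inL2 (wave_sum psi s a).
Proof.
elim: s => [|i s IH].
  by have := inL2_0 R; congr inL2; apply/funext => x; rewrite /wave_sum big_nil.
have := inL2_comb (a i) 1 (wav_inL2 i) IH.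
by congr inL2; apply/funext => x; rewrite /wave_sum big_cons mul1r.
Qed.

Let pw i g : inL2 g -> pairable (wv i) g. Proof. by move=> ?; apply: inL2_pairable => //; exact: wav_inL2. Qed.

Lemma inner_wave_sum_wav s a j : uniq s ->
  inner (wave_sum psi s a) (wv j) = if j \in s then a j else 0.
Proof.
move=> us; rewrite inner_wave_sum => [|//|i]; last by apply: pw; exact: wav_inL2.
under eq_bigr do rewrite inner_wav.
case: ifPn => js.
  by rewrite (bigD1_seq j)//= eqxx mulr1 big1 ?addr0// => i /negbTE ->; rewrite mulr0.
rewrite big_seq big1// => i is_; case: eqVneq => [ij|_]; last by rewrite mulr0.
by rewrite -ij is_ in js.
Qed.

Lemma inner_wav_r s a j : uniq s ->
  inner (wv j) (wave_sum psi s a) = if j \in s then Num.conj (a j) else 0.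
Proof.
move=> us; rewrite (inner_conj (inL2_pairable (wave_sum_inL2 s a) (wav_inL2 j))) inner_wave_sum_wav//.
by case: ifP; rewrite // rmorph0.
Qed.

Lemma Re_mul_conj_self (z : C) : complex.Re (z * Num.conj z) = Normc.normc z ^+ 2.
Proof. by rewrite re_mul_conj normc_sqr -!expr2. Qed.

Lemma sqnormE f : sqnorm f = complex.Re (inner f f).
Proof. by rewrite inner_self. Qed.

Lemma sqnorm_wave_sum s a : uniq s -> sqnorm (wave_sum psi s a) = \sum_(i <- s) Normc.normc (a i) ^+ 2.
Proof.
move=> us; have h2 := wave_sum_inL2 s a.
rewrite sqnormE inner_wave_sum; [|exact: h2.1|by move=> i; exact: pw].
rewrite re_sum big_seq [RHS]big_seq; apply: eq_bigr => i is_.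
by rewrite inner_wav_r// is_ Re_mul_conj_self.
Qed.

Lemma bessel v s : inL2 v -> uniq s -> \sum_(i <- s) Normc.normc (inner v (wv i)) ^+ 2 <= sqnorm v.
Proof.
move=> v2 us; set c := fun i => inner v (wv i).
pose S := wave_sum psi s c; have S2 : inL2 S := wave_sum_inL2 s c.
have D2 := inL2B v2 S2.
have e : inner S (fun x => v x - S x) = 0.
  rewrite inner_wave_sum; [|exact: D2.1|by move=> i; exact: pw].
  rewrite big_seq big1// => i is_.
  rewrite (inner_conj (inL2_pairable D2 (wav_inL2 i))) innerB; try exact: inL2_pairable (wav_inL2 _).
  by rewrite inner_wave_sum_wav// is_ subrr rmorph0 mulr0.
have e2 : inner v (fun x => v x - S x) = inner v v - inner v S.
  rewrite (inner_conj (inL2_pairable D2 v2)) innerB; try exact: inL2_pairable.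
  by rewrite rmorphB/= -!inner_conj//; exact: inL2_pairable.
have e3 : inner v S = Num.conj (inner S v) by apply: inner_conj; exact: inL2_pairable.
have := sqnorm_ge0 (fun x => v x - S x); rewrite sqnormE innerB; try exact: inL2_pairable.
rewrite e subr0 e2 e3 inner_wave_sum; [|exact: v2.1|by move=> i; exact: pw].
have -> (z w : C) : complex.Re (z - Num.conj w) = complex.Re z - complex.Re w by case: z w => [? ?] [? ?].
rewrite -sqnormE subr_ge0 re_sum; congr (_ <= _); apply: eq_bigr => i _.
by rewrite (inner_conj (inL2_pairable v2 (wav_inL2 i))) Re_mul_conj_self.
Qed.

(** The partial sums of [v] satisfy the bound termwise. A subsequence converges weakly to some [s]
    with the coefficients of [v], and completeness in [L^2] identifies [s] with [v]. *)
Lemma parseval_le u v M : inL2 u -> inL2 v ->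
  (forall s, uniq s -> \sum_(i <- s) Normc.normc (inner u (wv i)) * Normc.normc (inner v (wv i)) <= M) ->
  Normc.normc (inner v u) <= M.
Proof.
move=> u2 v2 hM; have [e be] := int_pair_enumeration.
have ei : injective e := bij_inj be.
pose c i := inner v (wv i).
pose sq n := [seq e i | i <- iota 0 n].
have usq n : uniq (sq n) by rewrite map_inj_uniq ?iota_uniq.
pose S n := wave_sum psi (sq n) c.
pose q n : R := \sum_(i <- sq n) Normc.normc (c i) ^+ 2.
have Sdiff n m : (n <= m)%N -> sqnorm (fun x => S m x - S n x) = q m - q n.
  move=> nm; have e1 : sq m = sq n ++ [seq e i | i <- iota n (m - n)].
    by rewrite /sq -map_cat -{2}[n]add0n -iotaD subnKC.
  rewrite /q e1 big_cat/= addrAC subrr add0r -(@sqnorm_wave_sum _ c); last by rewrite map_inj_uniq ?iota_uniq.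
  by congr sqnorm; apply/funext => x; rewrite /S /wave_sum e1 big_cat/= addrAC subrr add0r.
have q_mono : {homo q : n m / (n <= m)%N >-> n <= m}.
  by move=> n m nm; rewrite -subr_ge0 -Sdiff// sqnorm_ge0.
have qb n : q n <= sqnorm v by exact: bessel.
have qc : cvgn q.
  by apply: nondecreasing_is_cvgn => //; exists (sqnorm v) => _ [n _ <-].
(* By Bessel the squared coefficients are summable, so their tails fall below [16^-J] from some
   index on. The indices [N J] need not increase with [J]; hence the two cases for the increments of
   [T]. *)
have pick (J : nat) : {n | (J < n)%N /\ forall m, (n <= m)%N -> q m - q n <= 1 / 16 ^+ J}.
  apply: cid; have p0 : 0 < 1 / (16 : R) ^+ J / 2 by rewrite divr_gt0// divr_gt0// exprn_gt0.
  move/cvgrPdist_le : (qc) => /(_ _ p0) [N _ hN].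
  exists (maxn N J.+1); split; first exact: leq_maxr.
  move=> m hm; have h1 := hN m (leq_trans (leq_maxl _ _) hm); have h2 := hN (maxn N J.+1) (leq_maxl _ _).
  move: h1 h2; rewrite !ler_norml => /andP[a1 a2] /andP[b1 b2].
  have : limn q - q m >= 0 by rewrite subr_ge0; exact: nondecreasing_cvgn_le.
  move: (1 / _) (limn q) a1 a2 b1 b2 => t l; lra.
pose N J := sval (pick J).
have NJ J : (J < N J)%N by have [] := svalP (pick J).
have Nt J m : (N J <= m)%N -> q m - q (N J) <= 1 / 16 ^+ J by have [_] := svalP (pick J); exact.
pose T J : R -> C := if J is J'.+1 then S (N J') else fun=> 0.
have T2 J : inL2 (T J) by case: J => [|J]; [exact: inL2_0|exact: wave_sum_inL2].
have sn_sym f g : sqnorm (fun x => f x - g x) = sqnorm (fun x => g x - f x).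
  by congr Rintegral; apply/funext => x; rewrite normcB.
have v0 := sqnorm_ge0 v.
have [s s2 hs] : exists2 s, inL2 s & forall f, inL2 f ->
  (fun n => complex.Re (inner (T n) f)) @ \oo --> complex.Re (inner s f) /\
  (fun n => complex.Im (inner (T n) f)) @ \oo --> complex.Im (inner s f).
  (* The first increment has square norm at most [sqnorm v], by Bessel; a later one has at most
     [16^-J = 16 / 16^(J + 1)]. *)
  apply: (@L2_limit _ _ (sqnorm v + 16)) => // -[|J].
    rewrite expr0 divr1 (_ : sqnorm _ = q (N 0%N)).
      by apply: (le_trans (qb _)); rewrite lerDl.
    rewrite -[RHS]subr0 -(_ : q 0%N = 0); last by rewrite /q big_nil.
    rewrite -Sdiff//; congr sqnorm; apply/funext => x.
    by rewrite /T /S /wave_sum /sq /= big_nil.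
  have p0 : 0 < (16 : R) ^+ J by rewrite exprn_gt0.
  apply: (@le_trans _ _ (1 / 16 ^+ J)).
    rewrite /T; case/orP: (leq_total (N J) (N J.+1)) => h; first by rewrite Sdiff//; exact: Nt.
    rewrite sn_sym Sdiff//; apply: (le_trans (Nt J.+1 _ h)).
    by rewrite exprS invfM mulrA ler_wpM2r// ?invr_ge0 ?ltW//; lra.
  by rewrite exprS invfM mulrA ler_wpM2r ?invr_ge0 ?(ltW p0)//; lra.
have cs j : inner s (wv j) = c j.
  have [d ed de] := be.
  have ev' n : (d j < n)%N -> inner (T n) (wv j) = c j.
    case: n => // n dn; rewrite /T /S inner_wave_sum_wav//.
    rewrite ifT//; apply/mapP; exists (d j); last by rewrite de.
    by rewrite mem_iota/= add0n; apply: leq_ltn_trans (NJ n).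
  have ev : \forall n \near \oo, inner (T n) (wv j) = c j.
    by near=> n; apply: ev'; near: n; exact: nbhs_infty_gt.
  have [h1 h2] := hs _ (wav_inL2 j).
  apply/eqP; rewrite eq_complex; apply/andP; split; apply/eqP.
    apply: (@cvg_unique _ _ _ _ _ _ h1) => //; apply: cvg_near_cst; near=> n; congr complex.Re.
    by near: n; exact: ev.
  apply: (@cvg_unique _ _ _ _ _ _ h2) => //; apply: cvg_near_cst; near=> n; congr complex.Im.
  by near: n; exact: ev.
have vs : {ae mu, forall x, v x = s x}.
  have [_ [_ comp]] := ow.
  have := comp _ (inL2B v2 s2); have h : forall j k, inner (fun x => v x - s x) (wav psi j k) = 0.
    move=> j k; rewrite innerB; try exact: inL2_pairable (wav_inL2 (j, k)).
    by have := cs (j, k) => /= ->; rewrite /c subrr.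
  by move=> /(_ h); apply: ae_imp => x /eqP; rewrite subr_eq0 => /eqP.
rewrite (@inner_ae_eq _ v s u); try exact: inL2_pairable; last exact: vs.
have M0 : 0 <= M by have := hM [::] isT; rewrite big_nil.
have bT n : Normc.normc (inner (T n) u) <= M.
  case: n => [|n].
    rewrite (_ : inner _ _ = 0) ?Normc.normc0//.
    rewrite -[0](subrr (inner v u)) -innerB; try exact: inL2_pairable.
    by congr inner; apply/funext => x; rewrite subrr.
  rewrite /T /S inner_wave_sum; [|exact: u2.1|by move=> i; exact: pw].
  apply: le_trans (hM _ (usq (N n))); elim: (sq (N n)) => [|i l IH].
    by rewrite !big_nil Normc.normc0.
  rewrite !big_cons; apply: (le_trans (normcD _ _)); apply: lerD IH.
  by rewrite Normc.normcM (inner_conj (inL2_pairable u2 (wav_inL2 i))) normc_conj mulrC.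
have [h1 h2] := hs _ u2.
rewrite -(@ler_pXn2r _ 2) ?nnegrE ?normc_ge0// normc_sqr.
have hc : (fun n => complex.Re (inner (T n) u) ^+ 2 + complex.Im (inner (T n) u) ^+ 2) @ \oo -->
  complex.Re (inner s u) ^+ 2 + complex.Im (inner s u) ^+ 2.
  by apply: cvgD; rewrite !expr2; apply: cvgM.
rewrite -(cvg_lim _ hc)//; apply: limr_le; first by apply/cvg_ex; eexists; exact: hc.
by near=> n; rewrite -normc_sqr ler_pXn2r ?nnegrE ?normc_ge0.
Unshelve. all: by end_near.
Qed.

End Parseval.

(** * Completeness of the wavelets in X *)
Section Completeness.
Variable R : realType.
Local Notation C := (R[i]).
Local Notation mu := (@lebesgue_measure R).
Implicit Types (f g h u v : R -> C).

(** The A_2 constant is invariant under scaling, which leaves a free parameter to shift the balance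
    between the two energies in [inner_vanishes]. *)
Lemma A2_pair_scale Q (s w : R -> R) (t : R) : 0 < t -> A2_pair Q s w ->
  A2_pair Q (fun x => t^-1 * s x) (fun x => t * w x).
Proof.
move=> t0 [h1 h2 h3 h4 h5 h6]; split.
- exact: loc_intZ.
- exact: loc_intZ.
- by move=> x; apply: mulr_ge0 => //; rewrite invr_ge0 ltW.
- by move=> x; apply: mulr_ge0 => //; rewrite ltW.
- by apply: ae_imp h5 => x; rewrite mulrACA divff ?mul1r// gt_eqF.
- by move=> a l l0; rewrite !IabZ// mulrACA mulVf ?mul1r ?h6// gt_eqF.
Qed.

Lemma indic_itv_normc_le (h : R -> C) B M x : (forall x, Normc.normc (h x) <= M) ->
  (forall x, ~ (- B <= x <= B) -> h x = 0) -> Normc.normc (h x) <= M * \1_`[- B, B] x.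
Proof.
move=> hM h0; rewrite indicE; case: (boolP (x \in _)) => xB; first by rewrite mulr1.
rewrite h0 ?Normc.normc0 ?mulr0//; move: xB; rewrite notin_setE/= in_itv/=; exact.
Qed.

Lemma inX_bounded_supported (N : (R -> \bar R) -> \bar R) B M h : sublinear_norm N ->
  (N (fun x => (\1_`[- B, B] x)%:E) < +oo)%E -> cmeasurable h ->
  (forall x, Normc.normc (h x) <= M) -> (forall x, ~ (- B <= x <= B) -> h x = 0) -> inX N h.
Proof.
move=> sN NB mh hM h0; split => //.
have M0 : 0 <= M by exact: le_trans (normc_ge0 (h 0)) _.
have nB : nnmf (fun x => (\1_`[- B, B] x)%:E) by exact: nnmf_indic.
have nMB : nnmf (fun x => (M%:E * (\1_`[- B, B] x)%:E)%E).
  split; last by move=> x; apply: mule_ge0; [rewrite lee_fin|case: nB].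
  by apply: emeasurable_funM; [exact: measurable_cst|case: nB].
apply: (@le_lt_trans _ _ (N (fun x => (M%:E * (\1_`[- B, B] x)%:E)%E))).
  apply: (sn_le sN) => //; first exact: nnmf_cabs.
  by apply: ae_all => x; rewrite -EFinM lee_fin; exact: indic_itv_normc_le.
apply: (le_lt_trans (sn_homog sN nB M0)); have := sn_ge0 sN nB.
by move: NB; case: (N _) => // r _ _; rewrite -EFinM ltry.
Qed.

Lemma inL2_bounded_supported B M h : cmeasurable h ->
  (forall x, Normc.normc (h x) <= M) -> (forall x, ~ (- B <= x <= B) -> h x = 0) -> inL2 h.
Proof.
move=> mh hM h0; apply: integrable_inL2 => //.
have iB : mu.-integrable setT (EFin \o (fun x => M ^+ 2 * \1_`[- B, B] x)).
  have h1 : mu.-integrable setT (EFin \o \1_`[- B, B]) by exact: (integrable_indic_itv (- B) B true false).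
  by have := integrableZl measurableT (M ^+ 2) h1; apply: eq_integrable.
apply: le_integrable iB => //; first by apply/measurable_EFinP; exact: cmeasurable_sqr.
move=> x _ /=; rewrite lee_fin ger0_norm ?sqr_ge0//; apply: le_trans (ler_norm _).
have := indic_itv_normc_le x hM h0; have := normc_ge0 (h x); have := le_trans (normc_ge0 (h 0)) (hM 0).
rewrite indicE; case: (_ \in _) => /=; rewrite ?mulr1 ?mulr0 => M0 n0 nM.
  by rewrite ler_pXn2r// nnegrE.
by rewrite (_ : Normc.normc (h x) = 0) ?expr0n//; apply/eqP; rewrite eq_le nM.
Qed.

Lemma Iab_le_Rintegral (F : R -> R) a l : (forall x, 0 <= F x) -> mu.-integrable setT (EFin \o F) ->
  Iab F a l <= \int[mu]_x F x.
Proof.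
move=> F0 iF; have iab : mu.-integrable `[a, (a + l)%R] (EFin \o F) by exact: integrableS iF.
rewrite /Iab /Rintegral fine_le//.
- exact: (integrable_fin_num _ iab).
- exact: (integrable_fin_num _ iF).
apply: ge0_subset_integral => //; first exact: measurable_int iF.
by move=> x _; rewrite lee_fin.
Qed.

Lemma inX_le (N : (R -> \bar R) -> \bar R) f g : sublinear_norm N -> inX N f -> cmeasurable g ->
  (forall x, Normc.normc (g x) <= Normc.normc (f x)) -> inX N g.
Proof.
move=> sN [mf Nf] mg gf; split => //; apply: le_lt_trans Nf.
apply: (sn_le sN); try exact: nnmf_cabs.
by apply: ae_all => x; rewrite lee_fin.
Qed.

(** Cut in height and in space, so that every measurable function lands in [L^2]. *)
Definition truncate (n : nat) h x : C :=
  if (Normc.normc (h x) <= n%:R) && (`|x| <= n%:R) then h x else 0.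

Lemma cmeasurable_truncate n h : cmeasurable h -> cmeasurable (truncate n h).
Proof.
move=> mh; have [mr mi] := mh.
have mb : measurable_fun setT (fun x => (Normc.normc (h x) <= n%:R) && (`|x| <= n%:R)).
  apply: measurable_and; apply: measurable_fun_ler => //.
  exact: cabs_measurable.
split.
  rewrite (_ : (fun x => _) = (fun x => if (Normc.normc (h x) <= n%:R) && (`|x| <= n%:R) then complex.Re (h x) else 0)).
    by apply: measurable_fun_ifT.
  by apply/funext => x; rewrite /truncate; case: ifP.
rewrite (_ : (fun x => _) = (fun x => if (Normc.normc (h x) <= n%:R) && (`|x| <= n%:R) then complex.Im (h x) else 0)).
  by apply: measurable_fun_ifT.
by apply/funext => x; rewrite /truncate; case: ifP.
Qed.

Lemma truncate_inL2 n h : cmeasurable h -> inL2 (truncate n h).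
Proof.
move=> mh; apply: (@inL2_bounded_supported n%:R n%:R); first exact: cmeasurable_truncate.
  by move=> x; rewrite /truncate; case: ifP => [/andP[]|] //; rewrite Normc.normc0 ler0n.
by move=> x xn; rewrite /truncate; case: ifP => // /andP[_]; rewrite ler_norml.
Qed.

(** Used twice: for [p = 1] with the weight [w], and for [p = 0] with [k = |g|]. *)
Lemma truncate_cvg h (k : R -> R) p : cmeasurable h -> measurable_fun setT k -> (forall x, 0 <= k x) ->
  mu.-integrable setT (EFin \o (fun x => Normc.normc (h x) ^+ p.+1 * k x)) ->
  (forall n, mu.-integrable setT (EFin \o (fun x => Normc.normc (truncate n h x - h x) ^+ p.+1 * k x))) /\
  (fun n => \int[mu]_x (Normc.normc (truncate n h x - h x) ^+ p.+1 * k x)) @ \oo --> (0 : R).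
Proof.
move=> mh mk k0 ih.
have me n : measurable_fun setT (fun x => Normc.normc (truncate n h x - h x) ^+ p.+1 * k x).
  apply: measurable_funM => //; apply: measurable_funX; apply: cabs_measurable.
  by apply: cmeasurableB => //; exact: cmeasurable_truncate.
have le n x : `|Normc.normc (truncate n h x - h x) ^+ p.+1 * k x| <= Normc.normc (h x) ^+ p.+1 * k x.
  rewrite ger0_norm; last by apply: mulr_ge0 => //; apply: exprn_ge0; exact: normc_ge0.
  apply: ler_wpM2r => //; rewrite /truncate; case: ifP => _; last by rewrite sub0r normcN.
  by rewrite subrr Normc.normc0 expr0n /=; apply: exprn_ge0; exact: normc_ge0.
split.
  move=> n; apply: le_integrable ih => //; first by apply/measurable_EFinP; exact: me.
  by move=> x _ /=; rewrite lee_fin; apply: le_trans (le n x) (ler_norm _).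
have -> : 0 = \int[mu]_x (0 : R) by rewrite /Rintegral integral0.
apply: Rdominated_cvg ih _ => //; last by apply: ae_all => x n; exact: le.
apply: ae_all => x; apply: cvg_near_cst; near=> n.
have h1 : Normc.normc (h x) <= n%:R.
  apply: ltW; apply: lt_le_trans (truncnS_gt _) _; rewrite ler_nat; near: n; exact: nbhs_infty_ge.
have h2 : `|x| <= n%:R.
  apply: ltW; apply: lt_le_trans (truncnS_gt _) _; rewrite ler_nat; near: n; exact: nbhs_infty_ge.
by rewrite /truncate h1 h2 subrr Normc.normc0 expr0n mul0r.
Unshelve. all: by end_near.
Qed.

Variable rho : (R -> \bar R) -> \bar R.
Hypothesis bfn : banach_function_norm rho.
Hypothesis mrho : maximal_bounded rho.
Hypothesis mrho' : maximal_bounded (assoc_norm rho).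
Local Notation rho' := (assoc_norm rho).

Lemma inX_pairable f g : inX rho f -> inX rho' g -> pairable f g.
Proof.
move=> [mf rf] [mg rg]; split => //; apply/integrableP; split.
  by apply/measurable_EFinP; apply: measurable_funM; exact: cabs_measurable.
have nf := nnmf_cabs mf; have ng := nnmf_cabs mg.
rewrite (_ : (\int[mu]_x _ = \int[mu]_x (cabs f x * cabs g x))%E); last first.
  by apply: eq_integral => x _; rewrite /= ger0_norm// mulr_ge0 ?normc_ge0.
apply: (le_lt_trans (hoelder_assoc bfn nf ng rf)).
have r0 := bfn_ge0 bfn nf; have r'0 := assoc_norm_ge0 bfn (cabs g).
by move: rf rg r0 r'0; case: (rho _) => // a; case: (rho' _) => // b *; rewrite -EFinM ltry.
Qed.

Variables (psi : R -> C) (L A : R).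
Hypothesis A0 : 0 < A.
Hypothesis bre : bump L A (fun y => complex.Re (psi y)).
Hypothesis bim : bump L A (fun y => complex.Im (psi y)).
Hypothesis ow : orthonormal_wavelet psi.
Local Notation wv i := (wav psi i.1 i.2).

Lemma wave_sum_bounded s a : exists B M, (forall x, Normc.normc (wave_sum psi s a x) <= M) /\
  (forall x, ~ (- B <= x <= B) -> wave_sum psi s a x = 0).
Proof.
have [B B0 hB] := common_support A s; have [M M0 [lR lI]] := wave_sum_lipschitz bre bim s a.
have z := wave_sum_supported bre bim a hB; exists B, (2 * (M * (2 * B))).
have zB : forall x, ~ (- B <= x <= B) -> wave_sum psi s a x = 0.
  by move=> x hx; apply: z => /andP[h1 h2]; apply: hx; rewrite h1 ltW.
split => // x; have [xB|xB] := boolP (- B <= x <= B); last first.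
  rewrite zB ?Normc.normc0; last exact/negP.
  by apply: mulr_ge0 => //; apply: mulr_ge0 => //; apply: mulr_ge0 => //; exact: ltW.
(* The supports lie in the half-open [[- B, B)], so the sum vanishes at [B], and the Lipschitz bound
   measured from there gives [M * (2 * B)] for each part. *)
have z0 : wave_sum psi s a B = 0 by apply: z; rewrite ltxx andbF.
have d : `|x - B| <= 2 * B by rewrite ler_norml; move: xB => /andP[? ?]; apply/andP; split; lra.
apply: (le_trans (normc_le_parts _)); have := lR x B; have := lI x B; rewrite z0 /= !subr0 => h1 h2.
have h3 : M * `|x - B| <= M * (2 * B) by exact: ler_wpM2l.
by move: h1 h2 h3; lra.
Qed.

Lemma wav_sum1 i : wv i = wave_sum psi [:: i] (fun=> 1).
Proof. by apply/funext => x; rewrite /wave_sum big_seq1 mul1r. Qed.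

Lemma wave_sum_inX s a : inX rho (wave_sum psi s a).
Proof.
have [B [M [hM h0]]] := wave_sum_bounded s a.
apply: inX_bounded_supported hM h0; [exact: bfn_sublinear|exact: indic_itv_finite|].
exact: (cmeasurable_wave_sum bre bim).
Qed.

Lemma wave_sum_inX' s a : inX rho' (wave_sum psi s a).
Proof.
have [B [M [hM h0]]] := wave_sum_bounded s a.
apply: inX_bounded_supported hM h0; [exact: assoc_sublinear|exact: assoc_indic_itv_finite|].
exact: (cmeasurable_wave_sum bre bim).
Qed.

Lemma wav_cmeasurable i : cmeasurable (wv i).
Proof. by rewrite wav_sum1; exact: (cmeasurable_wave_sum bre bim). Qed.

Lemma inX_pairable_wav f i : inX rho f -> pairable f (wv i).
Proof. by move=> fX; apply: inX_pairable => //; rewrite wav_sum1; exact: wave_sum_inX'. Qed.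

(** [h] need not lie in [L^2], where completeness is available, and its truncations are in general
    no longer orthogonal to the wavelets. *)
Lemma inner_vanishes h g B M : inX rho h -> (forall i, inner h (wv i) = 0) ->
  cmeasurable g -> (forall x, Normc.normc (g x) <= M) -> (forall x, ~ (- B <= x <= B) -> g x = 0) ->
  inner h g = 0.
Proof.
move=> hX hz mg gM g0; have sr := bfn_sublinear bfn; have sa := assoc_sublinear bfn.
have gX : inX rho' g by apply: inX_bounded_supported gM g0 => //; exact: assoc_indic_itv_finite.
have g2 : inL2 g by exact: inL2_bounded_supported gM g0.
have [mh _] := hX; have hg := inX_pairable hX gX.
have [Q hQ] := dominating_weights bfn mrho mrho'; have [K K0 hK] := wavelet_pairing_bound Q A0 bre bim.
have [s [w [sw iw is_ _]]] := hQ h g hX gX 1 ltr01.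
have [ie ce] := truncate_cvg (p := 1) mh (loc_int_measurable (A2_w sw)) (A2_w0 sw) iw.
have [_ _ ihg] := hg.
have [id cd] := truncate_cvg (p := 0) (k := fun x => Normc.normc (g x)) mh (cabs_measurable mg)
  (fun x => normc_ge0 (g x)) ihg.
set e := fun n => _ in ce; set d := fun n => _ in cd.
pose E' := \int[mu]_x (Normc.normc (g x) ^+ 2 * s x).
have F0 (f : R -> C) (v : R -> R) : (forall x, 0 <= v x) -> forall x, 0 <= Normc.normc (f x) ^+ 2 * v x.
  by move=> v0 x; apply: mulr_ge0 => //; exact: sqr_ge0.
(* Parseval for the truncations, and the weighted estimate with the weights [s / t] and [t w]
   for the truncation error; the error tends to [0] with [n], and then [t] to infinity. *)
have claim (t : R) n : 0 < t -> Normc.normc (inner h g) <= 2 * d n + K * (t * e n + t^-1 * E').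
  move=> t0; pose hn := truncate n h; pose D x := hn x - h x.
  have hn2 : inL2 hn by exact: truncate_inL2.
  have mD : cmeasurable D by apply: cmeasurableB => //; exact: cmeasurable_truncate.
  have Dle x : Normc.normc (D x) <= Normc.normc (h x).
    by rewrite /D /hn /truncate; case: ifP => _; rewrite ?subrr ?Normc.normc0 ?normc_ge0// sub0r normcN.
  have DX : inX rho D by exact: inX_le hX _ _.
  have Dg := inX_pairable DX gX.
  have -> : inner h g = inner hn g - inner D g.
    rewrite -innerB//; last exact: inL2_pairable.
    by congr inner; apply/funext => x; rewrite /D opprB addrCA subrr addr0.
  apply: (le_trans (normcD _ _)); rewrite normcN addrC; apply: lerD.
    apply: (le_trans (inner_le Dg)); rewrite le_eqVlt; apply/orP; left; apply/eqP; congr (2 * _).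
  apply: (parseval_le ow wav_cmeasurable g2 hn2) => I uI.
  have sw' := A2_pair_scale t0 sw.
  have iw' : mu.-integrable setT (EFin \o (fun x => Normc.normc (D x) ^+ 2 * (t * w x))).
    have := integrableZl measurableT t (ie n); apply: eq_integrable => // x _ /=.
    by rewrite -EFinM mulrCA.
  have is' : mu.-integrable setT (EFin \o (fun x => Normc.normc (g x) ^+ 2 * (t^-1 * s x))).
    have := integrableZl measurableT t^-1 is_; apply: eq_integrable => // x _ /=.
    by rewrite -EFinM mulrCA.

  have hb : \int[mu]_x (Normc.normc (D x) ^+ 2 * (t * w x)) = t * e n.
    rewrite /e -(@RintegralZl _ _ _ mu _ _ t measurableT (ie n)).
    by apply: eq_Rintegral => x _; rewrite mulrCA.
  have gb : \int[mu]_x (Normc.normc (g x) ^+ 2 * (t^-1 * s x)) = t^-1 * E'.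
    rewrite /E' -(@RintegralZl _ _ _ mu _ _ t^-1 measurableT is_).
    by apply: eq_Rintegral => x _; rewrite mulrCA.
  have := hK _ _ sw' D g (t * e n) (t^-1 * E') (sn_cloc_int sr DX) (sn_cloc_int sa gX).
  move=> /(_ _ _ _ _ I uI) h1; apply: le_trans (h1 _ _ _ _).
  - rewrite le_eqVlt; apply/orP; left; apply/eqP; apply: eq_bigr => i _; rewrite mulrC; congr (Normc.normc _ * _).
    (* As the coefficients of [h] vanish, the truncation and the error [D] have the same
       coefficients. *)
    rewrite innerB ?hz ?subr0//; last exact: inX_pairable_wav.
    by apply: inL2_pairable => //; exact: (wav_inL2 ow wav_cmeasurable).
  - by move=> a b; exact: integrableS iw'.
  - by move=> a b; exact: integrableS is'.
  - by move=> a l _; rewrite -hb; apply: Iab_le_Rintegral => //; apply: F0; exact: A2_w0 sw'.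
  - by move=> a l _; rewrite -gb; apply: Iab_le_Rintegral => //; apply: F0; exact: A2_s0 sw'.
have bt (t : R) : 0 < t -> t * Normc.normc (inner h g) <= K * E'.
  move=> t0; rewrite mulrC -ler_pdivlMr//.
  have lim : (fun n => 2 * d n + K * (t * e n + t^-1 * E')) @ \oo --> 2 * 0 + K * (t * 0 + t^-1 * E').
    apply: cvgD; first by apply: cvgM => //; exact: cvg_cst.
    apply: cvgM; first exact: cvg_cst.
    by apply: cvgD; [apply: cvgM => //; exact: cvg_cst|exact: cvg_cst].
  have -> : K * E' / t = 2 * 0 + K * (t * 0 + t^-1 * E') by rewrite !mulr0 !add0r mulrA mulrAC.
  rewrite -(cvg_lim _ lim)//; apply: limr_ge; first by apply/cvg_ex; eexists; exact: lim.
  by near=> n; exact: claim.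
have z := normc_ge0 (inner h g); apply: Normc.eq0_normc; apply/eqP; rewrite eq_le z andbT leNgt.
apply/negP => n0; have E0 : 0 <= E'.
  by apply: Rintegral_ge0 => x _; exact: (F0 _ _ (A2_s0 sw)).
have := bt ((K * E' + 1) / Normc.normc (inner h g)).
rewrite divfK ?gt_eqF//.
have p0 : 0 < (K * E' + 1) / Normc.normc (inner h g) by rewrite divr_gt0// ltr_wpDl// mulr_ge0.
by move=> /(_ p0); rewrite gerDl ler10.
Unshelve. all: by end_near.
Qed.

(** The indicators of bounded measurable sets are admissible in [inner_vanishes], so both parts of
    [h] integrate to zero over all such sets. *)
Lemma wavelet_complete h : inX rho h -> (forall i, inner h (wv i) = 0) ->
  {ae mu, forall x, h x = 0}.
Proof.
move=> hX hz; have sr := bfn_sublinear bfn; have [hr hi] := sn_cloc_int sr hX.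
have part (P : C -> R) : loc_int (fun x => P (h x)) ->
    (forall E, measurable E -> mu.-integrable setT (EFin \o (fun x => P (h x) * \1_E x)) ->
      inner h (rc (\1_E)) = 0 -> \int[mu]_x (P (h x) * \1_E x) = 0) ->
    {ae mu, forall x, P (h x) = 0}.
  move=> lP hP.
  have : {ae mu, forall x, forall n : nat, `[(- n%:R)%R, n%:R]%classic x -> (P (h x))%:E = 0%:E}.
    apply: ae_foralln => n; have ln := lP (- n%:R) n%:R.
    apply: (@integral_ae_eq _ _ _ mu _ _ (cst 0%E) _ ln) => //.
    move=> E En mE; rewrite integral0.
    have iE : mu.-integrable E (fun x => (P (h x))%:E) by exact: integrableS (lP (- n%:R) n%:R).
    have e1 : ((fun x => (P (h x))%:E) \_ E) = EFin \o (fun x => P (h x) * \1_E x).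
      by apply/funext => x; rewrite /patch /= indicE; case: (_ \in _); rewrite ?mulr1 ?mulr0.
    have i1 : mu.-integrable setT (EFin \o (fun x => P (h x) * \1_E x)).
      by rewrite -e1; apply/(integrable_mkcond _ mE).1.
    have z : inner h (rc (\1_E)) = 0.
      apply: (@inner_vanishes _ _ n%:R 1) => //.
      - by split; [exact: measurable_indic|exact: measurable_cst].
      - by move=> x; rewrite /rc /= expr0n addr0 sqrtr_sqr indicE; case: (_ \in _); rewrite ?normr1 ?normr0.
      - move=> x xn; have xE : ~ E x by move=> Ex; apply: xn; have := En _ Ex; rewrite /= in_itv.
        by rewrite /rc indicE memNset.
    have := hP E mE i1 z; rewrite /Rintegral => h0.
    by rewrite integral_mkcond e1 -[LHS]fineK ?h0//; exact: integrable_fin_num i1.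
  apply: ae_imp => x hx; suff /hx[] : `[(- (Num.truncn `|x|).+1%:R)%R, (Num.truncn `|x|).+1%:R]%classic x by [].
  by rewrite /= in_itv/= -ler_norml; apply: ltW; exact: truncnS_gt.
have e1 E : complex.Re (inner h (rc \1_E)) = \int[mu]_x (complex.Re (h x) * \1_E x).
  by apply: eq_Rintegral => x _; rewrite re_mul_conj /= mulr0 addr0.
have e2 E : complex.Im (inner h (rc \1_E)) = \int[mu]_x (complex.Im (h x) * \1_E x).
  by apply: eq_Rintegral => x _; rewrite im_mul_conj /= mulr0 subr0.
have a1 : {ae mu, forall x, complex.Re (h x) = 0}.
  by apply: part => // E mE _ z; rewrite -e1 z.
have a2 : {ae mu, forall x, complex.Im (h x) = 0}.
  by apply: part => // E mE _ z; rewrite -e2 z.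
by apply: ae_imp2 a1 a2 => x x1 x2; apply/eqP; rewrite eq_complex x1 x2 !eqxx.
Qed.
End Completeness.

(** * Density of the wavelet span *)
Section WaveletSpan.
Variable R : realType.
Local Notation C := (R[i]).
Local Notation mu := (@lebesgue_measure R).
Implicit Types (f g h u v : R -> C) (s : seq (int * int)) (a b z : C).
Variable rho : (R -> \bar R) -> \bar R.
Hypothesis bfn : banach_function_norm rho.
Local Notation rho' := (assoc_norm rho).

Definition normX f : R := fine (rho (cabs f)).

Lemma normX_ge0 f : cmeasurable f -> 0 <= normX f.
Proof. by move=> mf; rewrite fine_ge0// (bfn_ge0 bfn (nnmf_cabs mf)). Qed.

Lemma normXE f : inX rho f -> rho (cabs f) = (normX f)%:E.
Proof. by move=> [mf rf]; rewrite fineK// ge0_fin_numE// (bfn_ge0 bfn (nnmf_cabs mf)). Qed.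

Lemma inX_normX_comb a b f g : inX rho f -> inX rho g ->
  inX rho (fun x => a * f x + b * g x) /\
  normX (fun x => a * f x + b * g x) <= Normc.normc a * normX f + Normc.normc b * normX g.
Proof.
move=> fX gX; have [[mf _] [mg _]] := (fX, gX); have mfg := cmeasurable_comb a b mf mg.
have nf := nnmf_cabs mf; have ng := nnmf_cabs mg.
have nZ (c : C) (F : R -> \bar R) : nnmf F -> nnmf (fun x => ((Normc.normc c)%:E * F x)%E).
  move=> [mF F0]; split; first by apply: emeasurable_funM => //; exact: measurable_cst.
  by move=> x; apply: mule_ge0 => //; rewrite lee_fin normc_ge0.
have nfa := nZ a _ nf; have ngb := nZ b _ ng.
have nS : nnmf (fun x => ((Normc.normc a)%:E * cabs f x + (Normc.normc b)%:E * cabs g x)%E).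
  split; first by apply: emeasurable_funD; [case: nfa|case: ngb].
  by move=> x; apply: adde_ge0; [case: nfa|case: ngb].
have le : (rho (cabs (fun x => (a * f x + b * g x)%R)) <= (Normc.normc a * normX f + Normc.normc b * normX g)%:E)%E.
  apply: (@le_trans _ _ (rho (fun x => ((Normc.normc a)%:E * cabs f x + (Normc.normc b)%:E * cabs g x)%E))).
    apply: (bfn_lattice bfn) => //; first exact: nnmf_cabs.
    apply: ae_all => x; rewrite /cabs -!EFinM -EFinD lee_fin -!Normc.normcM; exact: normcD.
  apply: (le_trans (bfn_subadd bfn nfa ngb)).
  rewrite (bfn_homog bfn nf (normc_ge0 a)) (bfn_homog bfn ng (normc_ge0 b)).
  by rewrite (normXE fX) (normXE gX) -!EFinM -EFinD.
have fgX : inX rho (fun x => a * f x + b * g x) by split => //; apply: (le_lt_trans le); rewrite ltry.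
by split => //; rewrite -lee_fin -normXE.
Qed.

Lemma inX_comb a b f g : inX rho f -> inX rho g -> inX rho (fun x => a * f x + b * g x).
Proof. by move=> fX gX; have [] := inX_normX_comb a b fX gX. Qed.

Lemma inX_normXD f g : inX rho f -> inX rho g ->
  inX rho (fun x => f x + g x) /\ normX (fun x => f x + g x) <= normX f + normX g.
Proof.
move=> fX gX; have := inX_normX_comb 1 1 fX gX; rewrite Normc.normc1 !mul1r.
by under eq_fun do rewrite !mul1r.
Qed.

Lemma inX_normXZ a f : inX rho f ->
  inX rho (fun x => a * f x) /\ normX (fun x => a * f x) <= Normc.normc a * normX f.
Proof.
move=> fX; have := inX_normX_comb a 0 fX fX; rewrite Normc.normc0 mul0r addr0.
by under eq_fun do rewrite mul0r addr0.
Qed.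

Lemma inX_normXB f g : inX rho f -> inX rho g ->
  inX rho (fun x => f x - g x) /\ normX (fun x => f x - g x) <= normX f + normX g.
Proof.
move=> fX gX; have := inX_normX_comb 1 (-1) fX gX; rewrite normcN Normc.normc1 !mul1r.
by under eq_fun do rewrite mul1r mulN1r.
Qed.

Variables (psi : R -> C) (L A : R).
Hypothesis bre : bump L A (fun y => complex.Re (psi y)).
Hypothesis bim : bump L A (fun y => complex.Im (psi y)).
Hypothesis ow : orthonormal_wavelet psi.
Local Notation wv i := (wav psi i.1 i.2).

Definition expansion s f : R -> C := wave_sum psi s (fun i => inner f (wv i)).

Let pairw f i : inX rho f -> pairable f (wv i).
Proof. exact: (inX_pairable_wav bfn bre bim). Qed.

Lemma expansion_comb s a b f g : inX rho f -> inX rho g ->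
  expansion s (fun x => a * f x + b * g x) = fun x => a * expansion s f x + b * expansion s g x.
Proof.
move=> fX gX; apply/funext => x; rewrite /expansion /wave_sum !mulr_sumr -big_split; apply: eq_bigr => i _ /=.
by rewrite inner_comb ?mulrDl ?mulrA//; exact: pairw.
Qed.

(* The finite linear combinations of wavelets, recognized by their expansions. *)
Definition wavelet_span v := inX rho v /\
  exists N : seq (int * int), forall s, uniq s -> {subset N <= s} -> expansion s v = v.

Lemma wavelet_span_comb a b u v : wavelet_span u -> wavelet_span v ->
  wavelet_span (fun x => a * u x + b * v x).
Proof.
move=> [uX [N hN]] [vX [N' hN']]; split; first exact: inX_comb.
exists (N ++ N') => s us sub; rewrite expansion_comb// hN ?hN'//.
  by move=> i iN; apply: sub; rewrite mem_cat iN orbT.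
by move=> i iN; apply: sub; rewrite mem_cat iN.
Qed.

Lemma wavelet_span_wave_sum s (a : int * int -> C) : uniq s -> wavelet_span (wave_sum psi s a).
Proof.
move=> us; have mw := wav_cmeasurable bre bim; split; first exact: (wave_sum_inX bfn bre bim).
exists s => t ut st; apply/funext => x; rewrite /expansion /wave_sum.
under eq_bigr do rewrite (inner_wave_sum_wav ow mw)//.
rewrite (bigID (mem s))/= [X in _ + X]big1 ?addr0; last by move=> i /negbTE ->; rewrite mul0r.
rewrite -big_filter; have pe : perm_eq [seq i <- t | i \in s] s.
  apply: uniq_perm => //; first exact: filter_uniq.
  by move=> i; rewrite mem_filter; case: (boolP (i \in s)) => //= /st.
by rewrite (perm_big _ pe)/= big_seq [RHS]big_seq; apply: eq_bigr => i ->.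
Qed.

Lemma wavelet_span_expansion s f : uniq s -> wavelet_span (expansion s f).
Proof. exact: wavelet_span_wave_sum. Qed.

Let span0 : wavelet_span (fun=> 0).
Proof.
have := wavelet_span_wave_sum (s := [::]) (fun=> 0) isT.
by congr wavelet_span; apply/funext => x; rewrite /wave_sum big_nil.
Qed.

(** The quotient seminorm modulo the span. A functional dominated by it vanishes on the span, and
    Hahn-Banach makes it attain the distance at a given point. *)
Definition span_dist h : R := inf [set normX (fun x => h x - v x) | v in wavelet_span].

Let dist_lb h : inX rho h -> lbound [set normX (fun x => h x - v x) | v in wavelet_span] 0.
Proof. by move=> hX _ [v [vX _] <-]; apply: normX_ge0; case: (inX_normXB hX vX) => -[]. Qed.

Lemma span_dist_le h v : inX rho h -> wavelet_span v -> span_dist h <= normX (fun x => h x - v x).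
Proof. by move=> hX vs; apply: ge_inf; [exists 0; exact: dist_lb|exists v]. Qed.

Lemma span_dist_adherent h (e : R) : inX rho h -> 0 < e ->
  exists2 v, wavelet_span v & normX (fun x => h x - v x) < span_dist h + e.
Proof.
move=> hX e0.
have [|_ [v vs <-] hv] := @inf_adherent _ [set normX (fun x => h x - v x) | v in wavelet_span] _ e0.
  split; last by exists 0; exact: dist_lb.
  by eexists; exists (fun=> 0); [exact: span0|].
by exists v.
Qed.

Let rsc (t : R) h : R -> C := fun x => real_complex R t * h x.

Lemma normc_real (t : R) : Normc.normc (real_complex R t) = `|t|.
Proof. by rewrite /= expr0n addr0 sqrtr_sqr. Qed.

Lemma span_dist_sublinear : sublinear rsc (inX rho) span_dist.
Proof.
split.
  move=> x y xX yX; apply/ler_addgt0Pl => e e0; have e20 : 0 < e / 2 by rewrite divr_gt0.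
  have [u us hu] := span_dist_adherent xX e20; have [v vs hv] := span_dist_adherent yX e20.
  have [xu _] := inX_normXB xX us.1; have [yv _] := inX_normXB yX vs.1.
  have suv : wavelet_span (fun t => u t + v t).
    by have := wavelet_span_comb 1 1 us vs; under eq_fun do rewrite !mul1r.
  have := span_dist_le (inX_normXD xX yX).1 suv.
  have [_] := inX_normXD xu yv; under eq_fun do rewrite addrACA -opprD.
  by rewrite -/(_ + _) => h1 h2; move: hu hv h1 h2; move: (normX _) (normX _) (normX _) => p q r; lra.
have le t x : 0 < t -> inX rho x -> span_dist (rsc t x) <= t * span_dist x.
  move=> t0 xX; apply/ler_addgt0Pl => e e0; have et0 : 0 < e / t by rewrite divr_gt0.
  have [u us hu] := span_dist_adherent xX et0.
  have tu : wavelet_span (rsc t u).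
    have := wavelet_span_comb (real_complex R t) 0 us us.
    by under eq_fun do rewrite mul0r addr0.
  have txX := (inX_normXZ (real_complex R t) xX).1.
  apply: (le_trans (span_dist_le txX tu)); have [xu _] := inX_normXB xX us.1.
  have [_] := inX_normXZ (real_complex R t) xu; rewrite normc_real gtr0_norm// /rsc.
  under eq_fun do rewrite mulrBr.
  move=> /le_trans; apply; have := ltW hu; rewrite -(ler_pM2l t0) mulrDr mulrCA divff ?mulr1 ?gt_eqF//.
  by rewrite addrC.
move=> t x t0 xX; apply/eqP; rewrite eq_le le//=.
have txX := (inX_normXZ (real_complex R t) xX).1.
have ti0 : 0 < t^-1 by rewrite invr_gt0.
have := le t^-1 (rsc t x) ti0 txX; rewrite (_ : rsc t^-1 (rsc t x) = x).
  by rewrite mulrC ler_pdivlMr// mulrC.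
by apply/funext => y; rewrite /rsc mulrA -rmorphM/= mulVf ?gt_eqF// mul1r.
Qed.

(** Hahn-Banach yields a real functional [l]; its complexification is [l h - i l (i h)]. The span is
    closed under multiplication by [i], so both parts vanish there, and the bound 2 adds up the two
    parts. *)
Lemma separating_functional f : inX rho f -> exists l, [/\ in_dual rho l,
  forall v, wavelet_span v -> l v = 0 & complex.Re (l f) = span_dist f].
Proof.
move=> fX.
have XD : forall x y : R -> C, inX rho x -> inX rho y -> inX rho (x + y).
  by move=> x y xX yX; exact: (inX_normXD xX yX).1.
have XZ : forall (t : R) (x : R -> C), inX rho x -> inX rho (rsc t x).
  by move=> t x xX; exact: (inX_normXZ _ xX).1.
have [||||l [lD lZ lp lf]] := @hahn_banach_point R (R -> C)%type rsc (inX rho) _ _ _ _ XD XZ span_dist f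
   span_dist_sublinear fX.
- by move=> a b h; apply/funext => x; rewrite /rsc rmorphD mulrDl.
- by move=> a h g; apply/funext => x; rewrite /rsc mulrDr.
- by move=> a b h; apply/funext => x; rewrite /rsc rmorphM mulrA.
- by move=> h; apply/funext => x; rewrite /rsc rmorph1 mul1r.
pose im : C := Complex 0 1; pose J h : R -> C := fun x => im * h x.
have JX h : inX rho h -> inX rho (J h) by move=> hX; exact: (inX_normXZ im hX).1.
have lC (a : C) h : inX rho h -> l (fun x => a * h x) = complex.Re a * l h + complex.Im a * l (J h).
  move=> hX; have JhX := JX _ hX; rewrite -!lZ// -lD; [|exact: XZ..].
  congr l; apply/funext => x.
  rewrite -[RHS]/(real_complex R (complex.Re a) * h x + real_complex R (complex.Im a) * (im * h x)).
  by case: a (h x) => [p q] [r t]; apply/eqP; rewrite eq_complex /=; apply/andP; split; apply/eqP; ring.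
have JJ h : J (J h) = fun x => -1 * h x.
  apply/funext => x; rewrite /J /im.
  by case: (h x) => [r t]; apply/eqP; rewrite eq_complex /=; apply/andP; split; apply/eqP; ring.
have lJ (a : C) h : inX rho h -> l (J (fun x => a * h x)) = complex.Re a * l (J h) - complex.Im a * l h.
  move=> hX; have -> : J (fun x => a * h x) = fun x => a * J h x.
    by apply/funext => x; rewrite /J mulrCA.
  rewrite lC; last exact: JX.
  by rewrite JJ (lC (-1))//= oppr0 mul0r addr0 mulN1r mulrN.
have lnorm h : inX rho h -> `|l h| <= normX h.
  have le g : inX rho g -> l g <= normX g.
    move=> gX; apply: (le_trans (lp _ gX)); apply: (le_trans (span_dist_le gX span0)).
    by under eq_fun do rewrite subr0.
  move=> hX; rewrite ler_norml le// andbT lerNl.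
  have [NX Nn] := inX_normXZ (-1) hX; have := le _ NX; rewrite (lC (-1) _ hX) /= oppr0 mul0r addr0 mulN1r => /le_trans.
  by apply; apply: (le_trans Nn); rewrite normcN Normc.normc1 mul1r.
exists (fun h => Complex (l h) (- l (J h))); split.
- split.
    move=> g h a b gX hX; have agX := (inX_normXZ a gX).1; have bhX := (inX_normXZ b hX).1.
    have e1 : l (fun x => a * g x + b * h x) = l (fun x => a * g x) + l (fun x => b * h x).
      by rewrite -lD.
    have e2 : l (J (fun x => a * g x + b * h x)) = l (J (fun x => a * g x)) + l (J (fun x => b * h x)).
      rewrite -lD; [|exact: JX..]; congr l; apply/funext => x; rewrite /J /= mulrDr//.
    rewrite e1 e2 (lC a _ gX) (lC b _ hX) (lJ a _ gX) (lJ b _ hX).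
    case: a b {agX bhX e1 e2} => [p q] [p' q'].
    by apply/eqP; rewrite eq_complex /=; apply/andP; split; apply/eqP; ring.
  exists 2 => h hX; rewrite (normXE hX) -EFinM lee_fin.
  apply: (le_trans (normc_le_parts _)) => /=; rewrite normrN mulrDl !mul1r.
  apply: lerD; first exact: lnorm.
  apply: (le_trans (lnorm _ (JX _ hX))); have [_] := inX_normXZ im hX.
  by rewrite /im /= expr0n expr1n add0r sqrtr1 mul1r.
- have z v : wavelet_span v -> l v = 0.
    have le u : wavelet_span u -> l u <= 0.
      move=> us; apply: (le_trans (lp _ us.1)); apply: (le_trans (span_dist_le us.1 us)).
      under eq_fun do rewrite subrr.
      by have := (inX_normXZ 0 us.1).2; rewrite Normc.normc0 mul0r; under eq_fun do rewrite mul0r.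
    move=> vs; apply/eqP; rewrite eq_le le//=.
    have := wavelet_span_comb (-1) 0 vs vs; under eq_fun do rewrite mul0r addr0.
    by move=> /le; rewrite (lC (-1) _ vs.1) /= oppr0 mul0r addr0 mulN1r oppr_le0.
  move=> v vs; rewrite z// z ?oppr0//.
  by have := wavelet_span_comb im 0 vs vs; under eq_fun do rewrite mul0r addr0.
- exact: lf.
Qed.

End WaveletSpan.

(** * Weak convergence, density and unconditional convergence *)

Section UnconditionalBasis.
Variable R : realType.
Local Notation C := (R[i]).
Local Notation mu := (@lebesgue_measure R).
Implicit Types (f g h u v : R -> C) (s : seq (int * int)) (l : (R -> C) -> C).
Variable rho : (R -> \bar R) -> \bar R.
Hypothesis bfn : banach_function_norm rho.
Hypothesis mrho : maximal_bounded rho.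
Hypothesis mrho' : maximal_bounded (assoc_norm rho).
Local Notation rho' := (assoc_norm rho).
Local Notation normX := (normX rho).

Variables (psi : R -> C) (L A : R).
Hypothesis A0 : 0 < A.
Hypothesis bre : bump L A (fun y => complex.Re (psi y)).
Hypothesis bim : bump L A (fun y => complex.Im (psi y)).
Hypothesis ow : orthonormal_wavelet psi.
Local Notation wv i := (wav psi i.1 i.2).
Local Notation expansion := (expansion psi).
Local Notation wavelet_span := (wavelet_span rho psi).
Let mw : forall i, cmeasurable (wv i) := wav_cmeasurable bre bim.

Lemma wav_inX i : inX rho (wv i).
Proof. by rewrite wav_sum1; exact: (wave_sum_inX bfn bre bim). Qed.

Lemma inner_wav_in_dual i : in_dual rho (fun h => inner h (wv i)).
Proof.
split.
  by move=> f g a b fX gX; apply: inner_comb; exact: (inX_pairable_wav bfn bre bim).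
have wX : inX rho' (wv i) by rewrite wav_sum1; exact: (wave_sum_inX' bfn bre bim).
exists (2 * fine (rho' (cabs (wv i)))) => f fX; have p := inX_pairable bfn fX wX.
have r0 := assoc_norm_ge0 bfn (cabs (wv i)).
rewrite (normXE bfn fX) -EFinM lee_fin; apply: (le_trans (inner_le p)); rewrite -mulrA ler_wpM2l//.
have [mf rf] := fX; have [_ _ ip] := p.
rewrite -lee_fin /Rintegral fineK; last exact: integrable_fin_num ip.
have := hoelder_assoc bfn (nnmf_cabs mf) (nnmf_cabs (mw i)) rf.
have r'f : rho' (cabs (wv i)) \is a fin_num by rewrite ge0_fin_numE//; case: wX.
by move=> h; rewrite EFinM fineK// muleC -(normXE bfn fX); apply: le_trans h; rewrite le_eqVlt; apply/orP; left; apply/eqP; apply: eq_integral.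
Qed.

Lemma in_dual_wave_sum l s (a : int * int -> C) : in_dual rho l ->
  l (wave_sum psi s a) = \sum_(i <- s) a i * l (wv i).
Proof.
move=> [lin _]; elim: s => [|i s IH].
  rewrite big_nil; have := lin _ _ 0 0 (wav_inX (0, 0)) (wav_inX (0, 0)).
  rewrite !mul0r addr0 => <-; congr l; apply/funext => x.
  by rewrite /wave_sum big_nil !mul0r addr0.
rewrite big_cons -IH -[l (wave_sum _ _ _) in RHS]mul1r -lin.
- by congr l; apply/funext => x; rewrite /wave_sum big_cons mul1r.
- exact: wav_inX.
- exact: (wave_sum_inX bfn bre bim).
Qed.

Lemma normX_wav_gt0 i : 0 < normX (wv i).
Proof.
rewrite lt_def normX_ge0// andbT; apply/eqP => z.
have [wX n0] := (wav_inX i, nnmf_cabs (mw i)).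
have /(bfn_eq0 bfn n0) ae0 : rho (cabs (wv i)) = 0%E by rewrite normXE// z.
have := inner_wav ow i i; rewrite eqxx inner_self => /(congr1 (@complex.Re R)) /=.
rewrite /sqnorm /Rintegral (ae_eq_integral (cst 0%E)) ?integral0//=.
- by move/eqP; rewrite eq_sym oner_eq0.
- by apply/measurable_EFinP; exact: cmeasurable_sqr.
- by apply: ae_imp ae0 => x /eqP; rewrite eqe => /eqP -> _; rewrite expr0n.
Qed.

(** This rests on a nonzero element of [X], provided by any wavelet. *)
Lemma functional_bound_ge0 l c : functional_bound rho l c -> 0 <= c.
Proof.
move=> /(_ _ (wav_inX (0, 0))); rewrite (normXE bfn (wav_inX _)) -EFinM lee_fin.
by move=> h; have := le_trans (normc_ge0 _) h; rewrite pmulr_lge0// normX_wav_gt0.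
Qed.

(** The second bound makes the expansion absolutely convergent when tested against a functional;
    this is where general multipliers are needed. *)
Lemma expansion_bound : exists2 K : R, 0 <= K & forall f, inX rho f -> forall s, uniq s ->
  normX (expansion s f) <= K * normX f /\
  forall l c, in_dual rho l -> functional_bound rho l c ->
    \sum_(i <- s) Normc.normc (inner f (wv i) * l (wv i)) <= K * normX f * c.
Proof.
have [K K0 hK] := operator_bound A0 bre bim bfn mrho mrho'; exists K => // f fX s us; split.
  have := hK f fX s us (fun=> 1); rewrite (_ : (fun i => 1 * _) = fun i => inner f (wv i)).
    rewrite -/(expansion s f) (normXE bfn (wave_sum_inX bfn bre bim _ _)) lee_fin; apply.
    by move=> _; rewrite Normc.normc1.
  by apply/funext => i; rewrite mul1r.
move=> l c ld lc; have c0 := functional_bound_ge0 lc.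
pose z i := inner f (wv i) * l (wv i).
(* [th i] rotates the [i]-th term of [l w] to its absolute value. *)
pose th i : C := Num.conj (z i) * real_complex R (Normc.normc (z i))^-1.
have th1 i : Normc.normc (th i) <= 1.
  rewrite Normc.normcM normc_conj normc_real ger0_norm ?invr_ge0 ?normc_ge0//.
  have [->|n0] := eqVneq (Normc.normc (z i)) 0; first by rewrite mul0r.
  by rewrite divff.
have thz i : th i * z i = real_complex R (Normc.normc (z i)).
  have [n0|n0] := eqVneq (Normc.normc (z i)) 0.
    by rewrite (Normc.eq0_normc n0) mulr0 Normc.normc0.
  rewrite /th mulrAC; have -> : Num.conj (z i) * z i = real_complex R (Normc.normc (z i) ^+ 2).
    rewrite normc_sqr; case: (z i) => [p q]; apply/eqP; rewrite eq_complex /=.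
    by apply/andP; split; apply/eqP; ring.
  by rewrite -rmorphM/= expr2 mulfK.
set w := wave_sum psi s (fun i => th i * inner f (wv i)).
have wX : inX rho w by exact: (wave_sum_inX bfn bre bim).
have lw : l w = real_complex R (\sum_(i <- s) Normc.normc (z i)).
  rewrite /w in_dual_wave_sum// rmorph_sum; apply: eq_bigr => i _.
  by rewrite -mulrA thz.
have := lc _ wX; rewrite lw normc_real ger0_norm; last by apply: sumr_ge0 => i _; exact: normc_ge0.
rewrite (normXE bfn wX) -EFinM lee_fin => /le_trans; apply.
rewrite mulrC ler_wpM2r// -lee_fin -(normXE bfn wX); exact: hK.
Qed.

(* Reflexivity provides the weak limit of the partial sums; it has the coefficients of [f]. *)
Lemma expansion_weak_cvg f (e : nat -> int * int) : reflexive_space rho -> bijective e -> inX rho f ->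
  forall l, in_dual rho l ->
  (fun n => complex.Re (l (expansion [seq e i | i <- iota 0 n] f))) @ \oo --> complex.Re (l f).
Proof.
move=> refl be fX; have [K K0 hK] := expansion_bound.
pose S n := expansion [seq e i | i <- iota 0 n] f.
have us n : uniq [seq e i | i <- iota 0 n] by rewrite map_inj_uniq ?iota_uniq//; exact: bij_inj.
have SX n : inX rho (S n) by exact: (wave_sum_inX bfn bre bim).
have SE l n : in_dual rho l -> l (S n) = \sum_(k < n) inner f (wv (e k)) * l (wv (e k)).
  by move=> ld; rewrite in_dual_wave_sum// big_map -val_enum_ord big_map big_enum.
have bounded_series (u : nat -> R) M : (forall n, \sum_(k < n) `|u k| <= M) ->
    cvgn (fun n => \sum_(k < n) u k).
  move=> uM; have : cvgn (series (fun k => `|u k|)).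
    apply: nondecreasing_is_cvgn.
      by apply/nondecreasing_seqP => n; rewrite /series /= big_nat_recr//= lerDl.
    by exists M => _ [n _ <-]; rewrite /series /= big_mkord.
  move=> /normed_cvg; congr (cvgn _); apply/funext => n; rewrite /series /= big_mkord//.
have cv l : in_dual rho l -> cvgn (fun n => complex.Re (l (S n))) /\ cvgn (fun n => complex.Im (l (S n))).
  move=> ld; have [c lc] := ld.2.
  have part (P : C -> R) : (forall z, `|P z| <= Normc.normc z) ->
      (forall n, P (l (S n)) = \sum_(k < n) P (inner f (wv (e k)) * l (wv (e k)))) ->
      cvgn (fun n => P (l (S n))).
    move=> Ple PS; rewrite (_ : (fun n => _) = (fun n => \sum_(k < n) P (inner f (wv (e k)) * l (wv (e k))))).
      apply: (bounded_series (fun k => P (inner f (wv (e k)) * l (wv (e k)))) (K * normX f * c)) => n.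
      have [_ h] := hK f fX _ (us n); apply: le_trans (h l c ld lc).
      rewrite big_map -val_enum_ord big_map big_enum; apply: ler_sum => k _; exact: Ple.
    by apply/funext => n.
  split; apply: part => [z|n]; rewrite ?ler_re_normc ?ler_im_normc//.
    by rewrite SE// re_sum.
  by rewrite SE// im_sum.
(* Only its values at bounded functionals matter, where [cv] guarantees the limits. *)
pose Phi l : C := Complex (limn (fun n => complex.Re (l (S n)))) (limn (fun n => complex.Im (l (S n)))).
have bid : in_bidual rho Phi.
  split.
    move=> l1 l2 a b d1 d2; have [r1 i1] := cv _ d1; have [r2 i2] := cv _ d2.
    rewrite /Phi; case: a b => [p q] [p' q']; apply/eqP; rewrite eq_complex /=; apply/andP; split; apply/eqP.
      apply: cvg_lim => //; rewrite (_ : (fun n => _) = (fun n => p * complex.Re (l1 (S n)) - q * complex.Im (l1 (S n)) +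
         (p' * complex.Re (l2 (S n)) - q' * complex.Im (l2 (S n))))).
        by apply: cvgD; apply: cvgB; apply: cvgM => //; exact: cvg_cst.
      by apply/funext => n; case: (l1 _) (l2 _) => [? ?] [? ?].
    apply: cvg_lim => //; rewrite (_ : (fun n => _) = (fun n => p * complex.Im (l1 (S n)) + q * complex.Re (l1 (S n)) +
         (p' * complex.Im (l2 (S n)) + q' * complex.Re (l2 (S n))))).
      by apply: cvgD; apply: cvgD; apply: cvgM => //; exact: cvg_cst.
    by apply/funext => n; case: (l1 _) (l2 _) => [? ?] [? ?].
  exists (2 * (K * normX f)) => l c ld lc; have c0 := functional_bound_ge0 lc.
  have nl n : Normc.normc (l (S n)) <= K * normX f * c.
    have := lc _ (SX n); rewrite (normXE bfn (SX n)) -EFinM lee_fin mulrC => /le_trans; apply.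
    by rewrite ler_wpM2r//; case: (hK f fX _ (us n)).
  have part (P : C -> R) : (forall z, `|P z| <= Normc.normc z) -> cvgn (fun n => P (l (S n))) ->
      `|limn (fun n => P (l (S n)))| <= K * normX f * c.
    move=> Ple cP; have le n : `|P (l (S n))| <= K * normX f * c by exact: le_trans (Ple _) (nl n).
    rewrite ler_norml; apply/andP; split.
      by apply: limr_ge => //; near=> n; have := le n; rewrite ler_norml => /andP[].
    by apply: limr_le => //; near=> n; have := le n; rewrite ler_norml => /andP[].
  have [r1 i1] := cv _ ld.
  apply: (le_trans (normc_le_parts _)); rewrite -mulrA mulrDl !mul1r.
  by apply: lerD; apply: part => // z; [exact: ler_re_normc|exact: ler_im_normc].
have [g [gX hg]] := refl _ bid.
have gf i : inner g (wv i) = inner f (wv i).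
  rewrite -(hg _ (inner_wav_in_dual i)); have [d ed de] := be.
  have ev n : (d i < n)%N -> inner (S n) (wv i) = inner f (wv i).
    move=> dn; rewrite /S /expansion (inner_wave_sum_wav ow mw)// ifT//.
    by apply/mapP; exists (d i); rewrite ?de// mem_iota/= add0n.
  have evn : \forall n \near \oo, inner (S n) (wv i) = inner f (wv i).
    by near=> n; apply: ev; near: n; exact: nbhs_infty_gt.
  apply/eqP; rewrite eq_complex; apply/andP; split; apply/eqP.
    have : (fun n => complex.Re (inner (S n) (wv i))) @ \oo --> complex.Re (inner f (wv i)).
      by apply: cvg_near_cst; apply: filterS evn => n ->.
    by apply: cvg_lim.
  have : (fun n => complex.Im (inner (S n) (wv i))) @ \oo --> complex.Im (inner f (wv i)).
    by apply: cvg_near_cst; apply: filterS evn => n ->.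
  by apply: cvg_lim.
have [fgX _] := inX_normXB bfn fX gX.
have fg0 : {ae mu, forall x, f x - g x = 0}.
  apply: (wavelet_complete bfn mrho mrho' A0 bre bim ow fgX) => i.
  by rewrite innerB ?gf ?subrr//; exact: (inX_pairable_wav bfn bre bim).
move=> l ld; have lfg : l f = l g.
  apply/eqP; rewrite -subr_eq0; apply/eqP; apply: Normc.eq0_normc; apply/eqP.
  have [lin [c lc]] := ld; rewrite eq_le normc_ge0 andbT.
  have := lin f g 1 (-1) fX gX; rewrite mul1r mulN1r => <-.
  have -> : (fun x => 1 * f x + -1 * g x) = (fun x => f x - g x).
    by apply/funext => x; rewrite mul1r mulN1r.
  rewrite -lee_fin; apply: (le_trans (lc _ fgX)).
  rewrite (_ : rho _ = 0%E) ?mule0//; apply/(bfn_eq0 bfn); first exact: nnmf_cabs fgX.1.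
  by apply: ae_imp fg0 => x xz; rewrite /cabs xz Normc.normc0.
rewrite lfg -hg//; exact: (cv _ ld).1.
Unshelve. all: by end_near.
Qed.

(** The separating functional kills the partial sums, which converge weakly to [f]; so its real part
    at [f], the distance to the span, is 0. *)
Lemma wavelet_span_dense f (d : R) : reflexive_space rho -> inX rho f -> 0 < d ->
  exists2 v, wavelet_span v & normX (fun x => f x - v x) < d.
Proof.
move=> refl fX d0; have [e be] := int_pair_enumeration.
have [l [ld l0 lf]] := separating_functional bfn bre bim ow fX.
have us n : uniq [seq e i | i <- iota 0 n] by rewrite map_inj_uniq ?iota_uniq//; exact: bij_inj.
have := span_dist_adherent bfn bre bim ow fX d0.
suff -> : span_dist rho psi f = 0 by rewrite add0r.
rewrite -lf; apply/esym; have := expansion_weak_cvg refl be fX ld.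
under eq_fun do rewrite (l0 _ (wavelet_span_expansion bfn bre bim ow f (us _))) /=.
move=> h; have h0 : (fun _ : nat => 0 : R) @ \oo --> (0 : R) by exact: cvg_cst.
by apply: (@cvg_unique _ _ _ _ _ _ h0).
Qed.

Lemma wavelet_uncond_sum f : reflexive_space rho -> inX rho f ->
  uncond_sum rho (fun i => inner f (wv i)) (fun i => wv i) f.
Proof.
move=> refl fX sigma bs; have [K K0 hK] := expansion_bound.
pose sq n := [seq sigma i | i <- iota 0 n].
have us n : uniq (sq n) by rewrite map_inj_uniq ?iota_uniq//; exact: bij_inj.
have -> : (fun n => rho (cabs (fun x => (f x - \sum_(i < n) inner f (wv (sigma i)) * wv (sigma i) x)%R))) =
  (fun n => (normX (fun x => f x - expansion (sq n) f x))%:E).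
  apply/funext => n; rewrite -normXE//; last first.
    by apply: (inX_normXB bfn fX _).1; exact: (wave_sum_inX bfn bre bim).
  congr (rho (cabs _)); apply/funext => x; rewrite /expansion /wave_sum.
  by rewrite big_map -val_enum_ord big_map big_enum.
apply: cvg_EFin; first by near=> n.
apply/cvgrPdist_le => d d0.
have dK : 0 < d / (1 + K) by rewrite divr_gt0// ltr_wpDr.
have [v vs fv] := wavelet_span_dense refl fX dK; have [vX [N hN]] := vs.
have [g' eg ge] := bs.
near=> n; rewrite /= sub0r normrN.
have subN : {subset N <= sq n}.
  have /allP hall : all (fun i => (g' i < n)%N) N.
    near: n; elim: (N) => [|i N' IH] /=; first by near=> n.
    by near=> n; apply/andP; split; near: n; [exact: nbhs_infty_gt|exact: IH].
  by move=> i /hall gi; apply/mapP; exists (g' i); rewrite ?ge// mem_iota/= add0n.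
have [fvX _] := inX_normXB bfn fX vX.
have eX : inX rho (expansion (sq n) (fun x => f x - v x)) by exact: (wave_sum_inX bfn bre bim).
(* Once the partial sum reproduces [v], the error is the one made on [f - v], at most [1 + K] times
   its norm. *)
have -> : (fun x => f x - expansion (sq n) f x) = (fun x => (f x - v x) - expansion (sq n) (fun x => f x - v x) x).
  have e1 : expansion (sq n) (fun x => f x - v x) = fun x => expansion (sq n) f x - v x.
    have := expansion_comb bfn bre bim (sq n) 1 (-1) fX vX.
    rewrite hN//; have -> : (fun x => 1 * f x + -1 * v x) = (fun x => f x - v x).
      by apply/funext => x; rewrite mul1r mulN1r.
    by move=> ->; apply/funext => x; rewrite mul1r mulN1r.
  by rewrite e1; apply/funext => x; rewrite opprB addrA subrK.
have [nX nle] := inX_normXB bfn fvX eX.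
rewrite ger0_norm ?normX_ge0//; last by case: nX.
apply: (le_trans nle); have [h1 _] := hK _ fvX _ (us n).
apply: (le_trans (lerD (lexx _) h1)); rewrite -{1}[normX _]mul1r -mulrDl mulrC -ler_pdivlMr ?ltr_wpDr//.
exact: ltW.
Unshelve. all: by end_near.
Qed.

(** The coefficient functionals are bounded on [X], and by orthonormality the [j]-th one takes the
    value [c j] on all late partial sums; a single enumeration is enough. *)
Lemma uncond_sum_unique f c : inX rho f -> uncond_sum rho c (fun i => wv i) f ->
  c = fun i => inner f (wv i).
Proof.
move=> fX hc; apply/funext => j; have [e be] := int_pair_enumeration.
have [d ed de] := be; have [lin [b lb]] := inner_wav_in_dual j.
have us n : uniq [seq e i | i <- iota 0 n] by rewrite map_inj_uniq ?iota_uniq//; exact: bij_inj.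
apply/eqP; rewrite -subr_eq0; apply/eqP; apply: Normc.eq0_normc; apply/eqP.
rewrite eq_le normc_ge0 andbT normcB -lee_fin.
have lim : (fun n => (b%:E * rho (cabs (fun x => (f x - \sum_(i < n) c (e i) * wv (e i) x)%R)))%E) @ \oo --> 0%E.
  by rewrite -(mule0 b%:E); apply: cvgeZl => //; exact: hc.
rewrite -[leRHS](cvg_lim (@ereal_hausdorff R) lim); apply: lime_ge; first by apply/cvg_ex; eexists; exact: lim.
near=> n; have dn : (d j < n)%N by near: n; exact: nbhs_infty_gt.
have SX : inX rho (wave_sum psi [seq e i | i <- iota 0 n] c) by exact: (wave_sum_inX bfn bre bim).
have -> : (fun x => f x - \sum_(i < n) c (e i) * wv (e i) x) = (fun x => f x - wave_sum psi [seq e i | i <- iota 0 n] c x).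
  by apply/funext => x; rewrite /wave_sum big_map -val_enum_ord big_map big_enum.
apply: le_trans (lb _ (inX_normXB bfn fX SX).1); rewrite lee_fin innerB; [|exact: (inX_pairable_wav bfn bre bim)..].
rewrite (inner_wave_sum_wav ow mw)// ifT//.
by apply/mapP; exists (d j); rewrite ?de// mem_iota/= add0n.
Unshelve. all: by end_near.
Qed.

End UnconditionalBasis.

Theorem theorem2p10 (R : realType) (rho : (R -> \bar R) -> \bar R) (psi : R -> R[i]) :
  banach_function_norm rho ->
  reflexive_space rho ->
  maximal_bounded rho ->
  maximal_bounded (assoc_norm rho) ->
  orthonormal_wavelet psi -> C1 psi -> compact_support psi ->
  uncond_basis rho (fun jk => wav psi jk.1 jk.2)
  /\ forall f, inX rho f ->
       uncond_sum rho (fun jk => inner f (wav psi jk.1 jk.2))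
                      (fun jk => wav psi jk.1 jk.2) f.
Proof.
move=> bfn refl mrho mrho' ow c1 cs; have [A [L [A0 bre bim]]] := wavelet_bumps ow c1 cs.
have us f : inX rho f -> uncond_sum rho (fun jk => inner f (wav psi jk.1 jk.2)) (fun jk => wav psi jk.1 jk.2) f.
  exact: (wavelet_uncond_sum bfn mrho mrho' A0 bre bim ow refl).
split=> //; split; first exact: (wav_inX bfn bre bim).
move=> f fX; exists (fun jk => inner f (wav psi jk.1 jk.2)); split; first exact: us.
by move=> c' hc'; exact: (uncond_sum_unique bfn bre bim ow fX hc').
Qed.
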